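(* Let $p$ be a prime, $n\ge1$, $f\in\mathcal{S}(\mathbb{Q}_p^n)$, $\alpha>\frac n2$, and $m_p^2=p^{\alpha}+p^{n-\alpha}-p^n-1$. Consider the problem \[ \begin{cases}(\Delta-m_p^2)\varphi(v)=0,& v\in\mathcal{T}_{p^n};\\ \lim_{k\to+\infty}p^{(n-\alpha)k}\varphi_k=f,&\text{in }L^2(\mathbb{Q}_p^n).\end{cases} \] Then: 1. The problem has a unique solution within the class of layer functions $\varphi_k\in L^2(\mathbb{Q}_p^n)$ that are constant on the cosets of $p^k\mathbb{Z}_p^n$. 2. The canonical locally constant representatives of the renormalized layers $p^{(n-\alpha)k}\varphi_k$ converge uniformly as $k\to+\infty$; and if $v_R(\boldsymbol{x})$ denotes the unique height-$R$ vertex on the ray ending at $\boldsymbol{x}$, then $f(\boldsymbol{x})=\lim_{R\to+\infty}p^{R(n-\alpha)}\varphi(v_R(\boldsymbol{x}))$. 3. The scale-corrected boundary normal derivative \[\partial_{n,\alpha}\varphi(\boldsymbol{x})=\lim_{k\to+\infty}\bigl(f(\boldsymbol{x})-p^{(n-\alpha)k}\varphi_k(\boldsymbol{x})\bigr)p^{(k+1)(2\alpha-n)}\quad(\text{limit in }L^2(\mathbb{Q}_p^n))\] satisfies $\partial_{n,\alpha}\varphi=D^{2\alpha-n}f$ in $L^2(\mathbb{Q}_p^n)$. 4. For $v_R$ a vertex of height $R$ with upper neighbor $v_{R-1}$, define the cutoff residual $\mathcal{R}_R\varphi(v_R):=\varphi(v_{R-1})-p^{n-\alpha}\varphi(v_R)$.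 Then \[\lim_{R\to+\infty}\sum_{v_R\in\partial\mathcal{T}_{p^n}^R}\varphi(v_R)\,\mathcal{R}_R\varphi(v_R)=p^{n-2\alpha}\bigl(p^{n-\alpha}-p^{\alpha}\bigr)\int_{\mathbb{Q}_p^n}f(\boldsymbol{x})D^{2\alpha-n}f(\boldsymbol{x})\,d\boldsymbol{x}.\]
   Context: Norm and measure: for $\boldsymbol{x}\in\mathbb{Q}_p^n$, $\|\boldsymbol{x}\|_p=\max_i|x_i|_p$; $d\boldsymbol{x}$ is Haar measure with $|\mathbb{Z}_p^n|=1$. $\mathcal{S}(\mathbb{Q}_p^n)$ is the Bruhat--Schwartz space of locally constant, compactly supported complex-valued functions. Fourier transform: $\hat f(\boldsymbol{\xi})=\int_{\mathbb{Q}_p^n}f(\boldsymbol{x})\chi_p(\boldsymbol{x}\cdot\boldsymbol{\xi})\,d\boldsymbol{x}$, $\chi_p(x)=e^{2\pi i\{x\}_p}$ ($\{\cdot\}_p$ the $p$-adic fractional part). For $s>0$, the Vladimirov--Taibleson operator $D^s$ is defined by $\widehat{D^sf}(\boldsymbol{\xi})=\|\boldsymbol{\xi}\|_p^s\hat f(\boldsymbol{\xi})$. Tree: the vertices of $\mathcal{T}_{p^n}$ are the pairs $(\boldsymbol{x},k)$ with height $k\in\mathbb{Z}$ and $\boldsymbol{x}\in\mathbb{Q}_p^n/p^k\mathbb{Z}_p^n$. Each vertex $(\boldsymbol{x},k)$ is adjacent to its unique upper neighbor $(\boldsymbol{x},k-1)$ and to its $p^n$ lower neighbors $(\boldsymbol{x}+\boldsymbol{a}p^k,k+1)$,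 $\boldsymbol{a}\in\mathbb{F}_p^n$ (identified with $\{0,\dots,p-1\}^n$), and to no other vertex. For a function $\varphi$ on vertices, $\varphi_k(\boldsymbol{x})=\varphi(\boldsymbol{x},k)$ is regarded as a function on $\mathbb{Q}_p^n$ constant on cosets of $p^k\mathbb{Z}_p^n$. The vertex $v_R(\boldsymbol{x})$ is $(\boldsymbol{x},R)$. The unweighted Laplacian is $\Delta\varphi(v)=\sum_{u\sim v}(\varphi(u)-\varphi(v))$. Set $\partial\mathcal{T}_{p^n}^R=\{(\boldsymbol{x},R):\boldsymbol{x}\in\mathbb{Q}_p^n/p^R\mathbb{Z}_p^n\}$ (all vertices of height $R$). Origin of the cutoff residual: truncate the solution at level $R$ and assign the value $p^{\alpha-n}\varphi(v_R)$ to each of the $p^n$ artificial (''ghost'') children of $v_R$; then $\mathcal{R}_R\varphi(v_R)$ is $(\Delta-m_p^2)\varphi(v_R)$ evaluated with these ghost children. The ghost values are used only to define $\mathcal{R}_R$. The symbol $m_p^2$ is a real parameter and need not be nonnegative. *)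

(* Defs.v *)
From HB Require Import structures.
From mathcomp Require Import all_boot all_order all_algebra.
From mathcomp Require Import complex.
From mathcomp Require Import all_classical all_reals all_analysis.
From mathcomp Require Import ring lra zify.
Set Implicit Arguments.
Unset Strict Implicit.
Unset Printing Implicit Defensive.
Import Order.TTheory GRing.Theory Num.Theory.
Import numFieldNormedType.Exports.
Local Open Scope classical_set_scope.
Local Open Scope ring_scope.
Local Open Scope complex_scope.

(* q \in p^k Z, for a rational q *)
Definition ppowZ (p : nat) (k : int) (q : rat) : bool :=
  q / (p%:R : rat) ^ k \is a Num.int.

(* [trunc x k] is the truncated expansion \sum_(i < k) a_i p^i of
   x = \sum_i a_i p^i, i.e. the representative of x + p^k Z_p in
   Z[1/p] `&` [0, p^k[; thus Q_p is realised as lim_k Z[1/p] / p^k Z. *)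
Record Qp (p : nat) (p_prime : prime p) := MkQp {
  trunc : int -> rat ;
  truncP : [/\ forall k, 0 <= trunc k < (p%:R : rat) ^ k,
               forall k, ppowZ p k (trunc (k + 1) - trunc k) &
               exists j : nat, trunc (- j%:Z) == 0] }.

Section padic_numbers.
Variables (p : nat) (p_prime : prime p).
Local Notation P := (p%:R : rat).
Local Notation ppowZ := (ppowZ p).
Local Notation Qp := (Qp p_prime).

HB.instance Definition _ := gen_eqMixin Qp.
HB.instance Definition _ := gen_choiceMixin Qp.

Let p_gt0 : 0 < P. Proof. by rewrite ltr0n prime_gt0. Qed.
Let p_neq0 : P != 0. Proof. exact: lt0r_neq0. Qed.
Let pX_gt0 k : 0 < P ^ k. Proof. exact: exprz_gt0. Qed.
Let pX_neq0 k : P ^ k != 0. Proof. exact: lt0r_neq0. Qed.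
Let pD k l : P ^ (k + l) = P ^ k * P ^ l. Proof. exact: expfzDr. Qed.

Lemma ppowZ0 k : ppowZ k 0. Proof. by rewrite /ppowZ mul0r rpred0. Qed.
Lemma ppowZD k a b : ppowZ k a -> ppowZ k b -> ppowZ k (a + b).
Proof. by move=> ka kb; rewrite /ppowZ mulrDl rpredD. Qed.
Lemma ppowZN k a : ppowZ k a -> ppowZ k (- a).
Proof. by move=> ka; rewrite /ppowZ mulNr rpredN. Qed.
Lemma ppowZB k a b : ppowZ k a -> ppowZ k b -> ppowZ k (a - b).
Proof. by move=> ka kb; rewrite ppowZD// ppowZN. Qed.
Lemma ppowZM k l a b : ppowZ k a -> ppowZ l b -> ppowZ (k + l) (a * b).
Proof. by move=> ka lb; rewrite /ppowZ pD invfM mulrACA rpredM. Qed.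
Lemma ppowZ_le k l a : l <= k -> ppowZ k a -> ppowZ l a.
Proof.
move=> lk ka; have -> : a = a / P ^ k * P ^ (k - l) * P ^ l.
  by rewrite -mulrA -pD subrK divfK.
rewrite /ppowZ mulfK// rpredM//.
case: (k - l) (subr_ge0 l k) => [m _|m]; last by rewrite lk.
by rewrite -exprnP rpredX// natr_int.
Qed.
Lemma ppowZ_sym k a b : ppowZ k (a - b) -> ppowZ k (b - a).
Proof. by move=> /ppowZN; rewrite opprB. Qed.
Lemma ppowZ_trans k b a c : ppowZ k (a - b) -> ppowZ k (b - c) -> ppowZ k (a - c).
Proof. by move=> ab bc; rewrite -(subrKA b) ppowZD. Qed.

Lemma ppowZ_small k a b : 0 <= a < P ^ k -> 0 <= b < P ^ k ->
  ppowZ k (a - b) -> a = b.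
Proof.
move=> /andP[a0 ak] /andP[b0 bk] /intrP[z zE].
have {zE} abE : a - b = z%:~R * P ^ k by rewrite -zE divfK.
have [z0|z0|z0] := ltrgtP z 0; last by apply/eqP; rewrite -subr_eq0 abE z0 mul0r.
- have : a - b <= -1 * P ^ k.
    by rewrite abE ler_pM2r// -[-1]/((-1)%:~R) ler_int; lia.
  by lra.
- have : 1 * P ^ k <= a - b.
    by rewrite abE ler_pM2r// -[1]/((1)%:~R) ler_int; lia.
  by lra.
Qed.

Lemma trunc_bound (x : Qp) k : 0 <= trunc x k < P ^ k. Proof. by case: x => ? []. Qed.

Lemma trunc_succ (x : Qp) k : ppowZ k (trunc x (k + 1) - trunc x k).
Proof. by case: (truncP x). Qed.

Lemma trunc_step (x : Qp) k l : k <= l -> ppowZ k (trunc x l - trunc x k).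
Proof.
move=> kl; rewrite -(subrK k l); move: (l - k) (subr_ge0 k l); rewrite kl.
case=> // m _; elim: m => [|m IH]; first by rewrite add0r subrr ppowZ0.
apply: ppowZ_trans IH; rewrite -addn1 PoszD -addrAC.
by apply: (@ppowZ_le (m%:Z + k)); [lia|exact: trunc_succ].
Qed.

Lemma truncE (x : Qp) k l a : k <= l -> 0 <= a < P ^ k -> ppowZ k (trunc x l - a) ->
  trunc x k = a.
Proof.
move=> kl ak xa; apply: (ppowZ_small (trunc_bound x k) ak).
by apply: ppowZ_trans xa; exact/ppowZ_sym/trunc_step.
Qed.

(* [dpole x] bounds the order of the pole of x : x \in p^(- dpole x) Z_p *)
Definition dpole (x : Qp) : nat := let: And3 _ _ h := truncP x in xchoose h.

Lemma trunc_dpole (x : Qp) : trunc x (- (dpole x)%:Z) = 0.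
Proof. by rewrite /dpole; case: (truncP x) => _ _ h; exact/eqP/(xchooseP h). Qed.

Lemma ppowZ_trunc (x : Qp) k : ppowZ (- (dpole x)%:Z) (trunc x k).
Proof.
have [kx|xk] := leP (- (dpole x)%:Z) k.
  by rewrite -[trunc x k]subr0 -(trunc_dpole x) trunc_step.
rewrite (@truncE x k (- (dpole x)%:Z) 0) ?ppowZ0 ?lexx ?pX_gt0//; first exact: ltW.
by rewrite trunc_dpole subrr ppowZ0.
Qed.

Lemma Qp_ext (x y : Qp) : (forall k, ppowZ k (trunc x k - trunc y k)) -> x = y.
Proof.
move=> xy; have E : trunc x = trunc y.
  by apply/funext => k; exact: ppowZ_small (trunc_bound x k) (trunc_bound y k) _.
by case: x y E {xy} => x Hx [y Hy] /= E; subst y; congr (@MkQp p p_prime); exact: Prop_irrelevance.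
Qed.

Definition coherent (u : int -> rat) :=
  (forall k, ppowZ k (u (k + 1) - u k)) /\ exists j k, ppowZ j (u k).

Definition reduce (k : int) (q : rat) : rat := q - (Num.floor (q / P ^ k))%:~R * P ^ k.

Lemma reduce_bound k q : 0 <= reduce k q < P ^ k.
Proof.
rewrite /reduce -[q in q - _](divfK (pX_neq0 k)) -mulrBl.
rewrite mulr_ge0 ?subr_ge0 ?floor_le_tmp ?(ltW (pX_gt0 k))//=.
rewrite gtr_pMl// ltrBlDr addrC.
by have := floorD1_gt (q / P ^ k); rewrite intrD.
Qed.

Lemma reduceP k q : ppowZ k (reduce k q - q).
Proof. by rewrite /reduce addrAC subrr add0r /ppowZ mulNr mulfK// rpredN intr_int. Qed.

Lemma coherent_step u k l : coherent u -> k <= l -> ppowZ k (u l - u k).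
Proof.
move=> [u1 _] kl; rewrite -(subrK k l); move: (l - k) (subr_ge0 k l); rewrite kl.
case=> // m _; elim: m => [|m IH]; first by rewrite add0r subrr ppowZ0.
apply: ppowZ_trans IH; rewrite -addn1 PoszD -addrAC.
by apply: (@ppowZ_le (m%:Z + k)); [lia|exact: u1].
Qed.

Lemma limQp_subproof u : coherent u ->
  [/\ forall k, 0 <= reduce k (u k) < P ^ k,
      forall k, ppowZ k (reduce (k + 1) (u (k + 1)) - reduce k (u k)) &
      exists j : nat, reduce (- j%:Z) (u (- j%:Z)) == 0].
Proof.
move=> cu; split=> [k|k|]; first exact: reduce_bound.
  apply: (@ppowZ_trans _ (u (k + 1))).
    by apply: (@ppowZ_le (k + 1)); [lia|exact: reduceP].
  apply: (@ppowZ_trans _ (u k)); first exact: cu.1.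
  exact/ppowZ_sym/reduceP.
have [u1 [j [k ujk]]] := cu; exists (`|j| + `|k|)%N.
set l := - _; apply/eqP/(@ppowZ_small l); rewrite ?lexx ?pX_gt0 ?reduce_bound// subr0.
rewrite -(subrK (u l) (reduce _ _)) ppowZD ?reduceP//.
rewrite -[u l](subKr (u k)) ppowZB//; first by apply: ppowZ_le ujk; lia.
by apply: coherent_step => //; lia.
Qed.

(* the p-adic limit of u k as k tends to +oo *)
Definition limQp u (cu : coherent u) : Qp := MkQp p_prime (limQp_subproof cu).

(* [approx u x] : the sequence u converges p-adically to x *)
Definition approx (u : nat -> rat) (x : Qp) :=
  forall k : int, exists M, forall m, (M <= m)%N -> ppowZ k (u m - trunc x k).

Lemma approx_uniq u x y : approx u x -> approx u y -> x = y.
Proof.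
move=> ux uy; apply: Qp_ext => k.
have [[M HM] [N HN]] := (ux k, uy k); apply: (@ppowZ_trans _ (u (M + N)%N)).
  by apply/ppowZ_sym/HM; lia.
by apply: HN; lia.
Qed.

Lemma approx_trunc x : approx (fun m => trunc x m%:Z) x.
Proof. by move=> k; exists `|k|%N => m km; apply: trunc_step; lia. Qed.

Lemma approx_limQp u (cu : coherent u) : approx (fun m => u m%:Z) (limQp cu).
Proof.
move=> k; exists `|k|%N => m km /=; apply: (@ppowZ_trans _ (u k)).
  by apply: coherent_step => //; lia.
exact/ppowZ_sym/reduceP.
Qed.

Lemma eq_approx u v x : u =1 v -> approx u x -> approx v x.
Proof. by move=> uv ux k; have [M HM] := ux k; exists M => m /HM; rewrite uv. Qed.

Lemma coherent_cst (a : int) : coherent (fun=> a%:~R).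
Proof. by split=> [k|]; [rewrite subrr ppowZ0|exists 0, 0; rewrite /ppowZ divr1 intr_int]. Qed.

Lemma coherentD (x y : Qp) : coherent (fun k => trunc x k + trunc y k).
Proof.
split=> [k|]; first by rewrite opprD addrACA ppowZD// trunc_step// lerDl.
exists (- (dpole x + dpole y)%:Z), 0; apply: ppowZD.
  by apply: ppowZ_le (ppowZ_trunc x 0); lia.
by apply: ppowZ_le (ppowZ_trunc y 0); lia.
Qed.

Lemma coherentN (x : Qp) : coherent (fun k => - trunc x k).
Proof.
split=> [k|]; first by rewrite -opprD ppowZN// trunc_step// lerDl.
by exists (- (dpole x)%:Z), 0; exact/ppowZN/ppowZ_trunc.
Qed.

Lemma ppowZM_trunc (x y : Qp) (k a b : int) : k + (dpole x)%:Z + (dpole y)%:Z <= a ->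
  a <= b -> ppowZ k (trunc x b * trunc y b - trunc x a * trunc y a).
Proof.
move=> ka ab.
have -> : trunc x b * trunc y b - trunc x a * trunc y a =
  (trunc x b - trunc x a) * trunc y b + trunc x a * (trunc y b - trunc y a) by ring.
apply: ppowZD.
  apply: (@ppowZ_le (a - (dpole y)%:Z)); first lia.
  by apply: ppowZM; [exact: trunc_step|exact: ppowZ_trunc].
apply: (@ppowZ_le (- (dpole x)%:Z + a)); first lia.
by apply: ppowZM; [exact: ppowZ_trunc|exact: trunc_step].
Qed.

Lemma coherentM (x y : Qp) : coherent (fun k =>
  let l := k + (dpole x)%:Z + (dpole y)%:Z in trunc x l * trunc y l).
Proof.
split=> [k/=|]; first by apply: ppowZM_trunc; lia.
by exists (- (dpole x)%:Z + - (dpole y)%:Z), 0; apply: ppowZM; exact: ppowZ_trunc.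
Qed.

Definition Qp0 := limQp (coherent_cst 0).
Definition Qp1 := limQp (coherent_cst 1).
Definition addQp x y := limQp (coherentD x y).
Definition oppQp x := limQp (coherentN x).
Definition mulQp x y := limQp (coherentM x y).

Lemma approxD u v x y : approx u x -> approx v y ->
  approx (fun m => u m + v m) (addQp x y).
Proof.
move=> ux vy k; have [[M HM] [N HN]] := (ux k, vy k); exists (M + N)%N => m MNm.
apply: (@ppowZ_trans _ (trunc x k + trunc y k)); last exact/ppowZ_sym/reduceP.
by rewrite opprD addrACA ppowZD// ?HM ?HN; lia.
Qed.

Lemma approxN u x : approx u x -> approx (fun m => - u m) (oppQp x).
Proof.
move=> ux k; have [M HM] := ux k; exists M => m Mm.
apply: (@ppowZ_trans _ (- trunc x k)); last exact/ppowZ_sym/reduceP.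
by rewrite -opprD ppowZN// HM.
Qed.

Lemma approxM u v x y : approx u x -> approx v y ->
  approx (fun m => u m * v m) (mulQp x y).
Proof.
move=> ux vy k.
set l := `|k|%:Z + (dpole x)%:Z + (dpole y)%:Z.
have [[M HM] [N HN]] := (ux l, vy l); exists (M + N)%N => m MNm.
apply: (@ppowZ_trans _ (trunc x l * trunc y l)); last first.
  apply: (@ppowZ_trans _ _ _ _ _ (ppowZ_sym (reduceP k _))).
  by apply: ppowZM_trunc; lia.
have {}HM : ppowZ l (u m - trunc x l) by apply: HM; lia.
have {}HN : ppowZ l (v m - trunc y l) by apply: HN; lia.
have -> : u m * v m - trunc x l * trunc y l = (u m - trunc x l) * (v m - trunc y l)
  + ((u m - trunc x l) * trunc y l + trunc x l * (v m - trunc y l)) by ring.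
apply: ppowZD; first by apply: (@ppowZ_le (l + l)); [lia|exact: ppowZM].
apply: ppowZD.
  by apply: (@ppowZ_le (l - (dpole y)%:Z)); [lia|apply: ppowZM => //; exact: ppowZ_trunc].
by apply: (@ppowZ_le (- (dpole x)%:Z + l)); [lia|apply: ppowZM => //; exact: ppowZ_trunc].
Qed.

Let ax := approx_trunc.
Let a0 : approx (fun=> 0) Qp0. Proof. exact: approx_limQp. Qed.
Let a1 : approx (fun=> 1) Qp1. Proof. exact: approx_limQp. Qed.

Lemma addQpA : associative addQp.
Proof.
move=> x y z; apply: approx_uniq (approxD (ax x) (approxD (ax y) (ax z))) _.
by apply: eq_approx (approxD (approxD (ax x) (ax y)) (ax z)) => m /=; rewrite addrA.
Qed.
Lemma addQpC : commutative addQp.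
Proof.
move=> x y; apply: approx_uniq (approxD (ax x) (ax y)) _.
by apply: eq_approx (approxD (ax y) (ax x)) => m /=; rewrite addrC.
Qed.
Lemma add0Qp : left_id Qp0 addQp.
Proof.
move=> x; apply: approx_uniq (approxD a0 (ax x)) _.
by apply: eq_approx (ax x) => m /=; rewrite add0r.
Qed.
Lemma addNQp : left_inverse Qp0 oppQp addQp.
Proof.
move=> x; apply: approx_uniq (approxD (approxN (ax x)) (ax x)) _.
by apply: eq_approx a0 => m /=; rewrite addNr.
Qed.
HB.instance Definition _ := GRing.isZmodule.Build Qp addQpA addQpC add0Qp addNQp.

Lemma mulQpA : associative mulQp.
Proof.
move=> x y z; apply: approx_uniq (approxM (ax x) (approxM (ax y) (ax z))) _.
by apply: eq_approx (approxM (approxM (ax x) (ax y)) (ax z)) => m /=; rewrite mulrA.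
Qed.
Lemma mulQpC : commutative mulQp.
Proof.
move=> x y; apply: approx_uniq (approxM (ax x) (ax y)) _.
by apply: eq_approx (approxM (ax y) (ax x)) => m /=; rewrite mulrC.
Qed.
Lemma mul1Qp : left_id Qp1 mulQp.
Proof.
move=> x; apply: approx_uniq (approxM a1 (ax x)) _.
by apply: eq_approx (ax x) => m /=; rewrite mul1r.
Qed.
Lemma mulQpDl : left_distributive mulQp addQp.
Proof.
move=> x y z; apply: approx_uniq (approxM (approxD (ax x) (ax y)) (ax z)) _.
apply: eq_approx (approxD (approxM (ax x) (ax z)) (approxM (ax y) (ax z))) => m /=.
by rewrite mulrDl.
Qed.
Lemma Qp1_neq0 : Qp1 != 0 :> Qp.
Proof.
apply/eqP => Q10; have [M /(_ M (leqnn _))] := a1 1; rewrite Q10.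
have [N /(_ N (leqnn _))] := a0 1 => h0 h1.
have : ppowZ 1 1 by rewrite -[1]subr0; exact: ppowZ_trans h1 (ppowZ_sym h0).
rewrite /ppowZ mul1r expr1z => /intrP[z] /(congr1 (fun a => P * a)).
rewrite mulfV// -[P]/((Posz p)%:~R) -intrM -[1]/(1%:~R) => /intr_inj.
move=> /(congr1 absz)/esym/eqP; rewrite abszM muln_eq1 => /andP[/eqP/= p1 _].
by have := prime_gt1 p_prime; rewrite p1.
Qed.
HB.instance Definition _ := GRing.Zmodule_isComNzRing.Build Qp
  mulQpA mulQpC mul1Qp mulQpDl Qp1_neq0.


Lemma approx_trunc_ge x (g : nat -> int) : (forall m, m%:Z <= g m) ->
  approx (fun m => trunc x (g m)) x.
Proof.
by move=> mg k; exists `|k|%N => m km; apply: trunc_step; have := mg m; lia.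
Qed.

Lemma ppowZ0E q : ppowZ 0 q = (q \is a Num.int).
Proof. by rewrite /ppowZ expr0z divr1. Qed.

Let ppowZV v : ppowZ (- v) (P ^ v)^-1.
Proof. by rewrite /ppowZ -invfM -pD subrr expr0z invr1. Qed.

Lemma Qp_val_ex x : x != 0 :> Qp ->
  exists v : int, trunc x v = 0 /\ trunc x (v + 1) != 0.
Proof.
move=> x0; have [[m xm]|xall] := pselect (exists m : nat, trunc x (- (dpole x)%:Z + m%:Z) != 0).
  have ex : exists m : nat, trunc x (- (dpole x)%:Z + m%:Z) != 0 by exists m.
  case: (ex_minnP ex) => -[|n]; first by rewrite addr0 trunc_dpole eqxx.
  move=> xn minn; exists (- (dpole x)%:Z + n%:Z); split.
    by apply/eqP/negP => /negP/minn; rewrite ltnn.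
  by rewrite -addrA -PoszD addn1.
case/eqP: x0; apply: approx_uniq a0; have := @approx_trunc_ge x.
move=> /(_ (fun m => - (dpole x)%:Z + (dpole x + m)%N%:Z)) H.
apply: eq_approx (H _) => m; last by lia.
by apply/eqP/negP => /negP xm; apply: xall; eexists; exact: xm.
Qed.

Lemma mulVQp_ex x : x != 0 :> Qp -> exists y : Qp, y * x = 1.
Proof.
move=> /Qp_val_ex[v [xv xv1]].
pose A (m : nat) : rat := trunc x (v + 1 + m%:Z) / P ^ v.
have A_int m : A m \is a Num.int.
  by rewrite -[_ \is a _]/(ppowZ v _) -[trunc x _]subr0 -xv trunc_step//; lia.
have A_step m l : (m <= l)%N -> ppowZ m.+1%:Z (A l - A m).
  move=> ml; rewrite /A -mulrBl -[m.+1%:Z](addrK v) ; apply: ppowZM.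
    by apply: (@ppowZ_le (v + 1 + m%:Z)); [lia|apply: trunc_step; lia].
  exact: ppowZV.
have /choice[b bP] : forall m : nat, exists b : int, ppowZ m.+1%:Z (A m * b%:~R - 1).
  move=> m; have /intrP[a aE] := A_int m.
  have pa : coprimez a (p ^ m.+1)%N%:Z.
    rewrite coprimezE/= coprime_sym coprimeXl// prime_coprime//.
    apply/negP => /dvdnP[c cE]; case/negP: xv1; apply/eqP.
    apply: (@truncE x (v + 1) (v + 1 + m%:Z) 0); rewrite ?lexx ?pX_gt0//; first by lia.
    rewrite subr0 /ppowZ pD invfM mulrA -/(A m) aE expr1z.
    have [d ->] : exists d : int, a = d * p%:Z.
      by exists (sgz a * c%:Z); rewrite -mulrA -PoszM -cE abszE -numEsg.
    by rewrite intrM mulfK// intr_int.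
  have /coprimezP[[u w]/= uw] := pa; exists u; rewrite aE -intrM.
  have -> : a * u = 1 - w * (p ^ m.+1)%N%:Z by rewrite -uw; ring.
  rewrite rmorphB/= addrAC subrr add0r ppowZN// /ppowZ intrM.
  by rewrite -[X in _ * X / _]/((p ^ m.+1)%:R) natrX -exprnP mulfK ?intr_int ?expf_neq0.
have b_step m l : (m <= l)%N -> ppowZ m.+1%:Z ((b l)%:~R - (b m)%:~R).
  move=> ml; have -> : (b l)%:~R - (b m)%:~R =
    (1 - A m * (b m)%:~R) * (b l)%:~R + (A l * (b l)%:~R - 1) * (b m)%:~R
    + (A m - A l) * ((b m)%:~R * (b l)%:~R) by ring.
  have Z0 (z : int) : ppowZ 0 z%:~R by rewrite ppowZ0E intr_int.
  rewrite -[m.+1%:Z]addr0; apply: ppowZD; [apply: ppowZD|]; apply: ppowZM => //.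
  - exact/ppowZ_sym/bP.
  - by apply: ppowZ_le (bP l); lia.
  - exact/ppowZ_sym/A_step.
  - by rewrite -intrM.
pose u (k : int) : rat := (b (`|k| + `|v|)%N)%:~R / P ^ v.
have u_step k l m : (m <= `|k|)%N -> (`|k| <= `|l|)%N -> ppowZ m%:Z (u l - u k).
  move=> mk kl; rewrite /u -mulrBl.
  apply: (@ppowZ_le ((`|k| + `|v|).+1%:Z + - v)); first by lia.
  apply: ppowZM; first by apply: b_step; lia.
  exact: ppowZV.
have cu : coherent u.
  split=> [k|]; last first.
    exists (- v), 0; rewrite -[- v]add0r; apply: ppowZM; last exact: ppowZV.
    by rewrite ppowZ0E intr_int.
  have [k0|k0] := leP 0 k.
    by apply: (@ppowZ_le `|k|%N%:Z); [lia|apply: u_step; lia].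
  apply: ppowZ_sym.
  by apply: (@ppowZ_le (absz (k + 1)%R)%:Z); [lia|apply: u_step; lia].
exists (limQp cu); apply: approx_uniq a1.
have gP m : m%:Z <= v + 1 + (m + `|v|)%N%:Z by lia.
have := approxM (approx_limQp cu) (approx_trunc_ge x gP).
move=> H k; have [M HM] := H k; exists (M + `|k|)%N => m Mm.
apply: (@ppowZ_trans _ (u m%:Z * trunc x (v + 1 + (m + `|v|)%N%:Z))); last by apply: HM; lia.
apply: ppowZ_sym; apply: (@ppowZ_le (m + `|v|)%N.+1%:Z); first lia.
have -> : u m%:Z * trunc x (v + 1 + (m + `|v|)%N%:Z) = A (m + `|v|)%N * (b (m + `|v|)%N)%:~R.
  by rewrite /u /A absz_nat -mulrA mulrC mulrA [in RHS]mulrAC mulrA.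
exact: bP.
Qed.

Definition invQp (x : Qp) : Qp := xget 0 [set y | y * x = 1].

Lemma mulVQp x : x != 0 -> invQp x * x = 1.
Proof. by move=> /mulVQp_ex[y yx]; exact: (@xgetPex _ 0 [set y | y * x = 1] (ex_intro _ y yx)). Qed.

Lemma invQp0 : invQp 0 = 0.
Proof.
by apply: xgetPN => y /= /esym/eqP; rewrite mulr0 oner_eq0.
Qed.
HB.instance Definition _ := GRing.ComNzRing_isField.Build Qp mulVQp invQp0.

End padic_numbers.

Section padic_topology.
Variables (p : nat) (p_prime : prime p).
Local Notation Qp := (Qp p_prime).

(* no negative powers of p in the expansion *)
Definition Zp : set Qp := [set x | trunc x 0 = 0].

Lemma Zp_approx u x : approx u x -> (forall m, ppowZ p 0 (u m)) -> Zp x.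
Proof.
move=> ux u0; have [M /(_ M (leqnn _)) uM] := ux 0; rewrite /Zp/=.
apply: (ppowZ_small p_prime (trunc_bound x 0)); first by rewrite expr0z lexx ltr01.
by rewrite subr0 -[trunc x 0](subKr (u M)) ppowZB.
Qed.

Lemma Zp_trunc (x : Qp) (m : nat) : Zp x -> ppowZ p 0 (trunc x m%:Z).
Proof. by move=> x0; rewrite -[trunc _ _]subr0 -[X in _ - X]x0 trunc_step. Qed.

Lemma ZpD (x y : Qp) : Zp x -> Zp y -> Zp (x + y).
Proof.
move=> xZ yZ; apply: Zp_approx (approxD (approx_trunc x) (approx_trunc y)) _.
by move=> m; rewrite ppowZD// Zp_trunc.
Qed.

Lemma ZpM (x y : Qp) : Zp x -> Zp y -> Zp (x * y).
Proof.
move=> xZ yZ; apply: Zp_approx (approxM (approx_trunc x) (approx_trunc y)) _.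
by move=> m; rewrite -[0]addr0 ppowZM// Zp_trunc.
Qed.

Lemma approx_nat (m : nat) : approx (fun=> m%:R) (m%:R : Qp).
Proof.
have a (c : int) : approx (fun=> c%:~R) (limQp p_prime (coherent_cst p c)).
  exact: approx_limQp.
elim: m => [|m IH]; first exact: (a 0).
rewrite -[in X in approx _ X]natr1.
by apply: eq_approx (approxD IH (a 1)) => k; rewrite -natr1.
Qed.

Lemma Zp_nat (m : nat) : Zp m%:R.
Proof. by apply: Zp_approx (approx_nat m) _ => _; rewrite ppowZ0E natr_int. Qed.

Lemma pQp_neq0 : p%:R != 0 :> Qp.
Proof.
apply/eqP => p0; have := approx_nat p; rewrite p0 => /(_ 2)[M /(_ M (leqnn _))].
rewrite (truncE (k := 2) (l := 2) (a := 0)) ?lexx ?exprz_gt0 ?ltr0n ?prime_gt0//.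
- have pr : (p%:R : rat) != 0 by rewrite pnatr_eq0 -lt0n prime_gt0.
  rewrite subr0 /ppowZ -exprnP expr2 invfM mulrA mulfV// mul1r => /intrP[z].
  move=> /(congr1 (fun a => p%:R * a)); rewrite mulfV// -[p%:R]/((Posz p)%:~R).
  rewrite -intrM -[1]/(1%:~R) => /intr_inj /(congr1 absz)/esym/eqP.
  by rewrite abszM muln_eq1 => /andP[/eqP/= p1 _]; have := prime_gt1 p_prime; rewrite p1.
- have [K /(_ K (leqnn _))] := approx_nat 0 2.
  by rewrite sub0r => /ppowZN; rewrite opprK subr0.
Qed.

Definition openQp (U : set Qp) :=
  forall x, U x -> exists k : int, forall z, Zp z -> U (x + p%:R ^ k * z).

Lemma openQpT : openQp setT. Proof. by move=> x _; exists 0. Qed.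

Lemma openQpI : setI_closed openQp.
Proof.
move=> U V oU oV x [Ux Vx].
have [[k kU] [l lV]] := (oU x Ux, oV x Vx).
have Zpow (i : int) (j : nat) z : Zp z -> exists2 w, Zp w &
    p%:R ^ (i + j%:Z) * z = p%:R ^ i * w :> Qp.
  move=> zZ; exists (p%:R ^+ j * z); last by rewrite expfzDr ?pQp_neq0// mulrA.
  by apply: ZpM zZ; rewrite -natrX; exact: Zp_nat.
exists (k + (absz (l - k)%R)%:Z) => z zZ; split.
  by have [w wZ ->] := Zpow k (absz (l - k)%R) z zZ; exact: kU.
have [j ->] : exists j : nat, k + (absz (l - k)%R)%:Z = l + j%:Z.
  by exists (absz (k + (absz (l - k)%R)%:Z - l)%R); lia.
by have [w wZ ->] := Zpow l j z zZ; exact: lV.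
Qed.

Lemma openQp_bigcup (I : Type) (f : I -> set Qp) :
  (forall i, openQp (f i)) -> openQp (\bigcup_i f i).
Proof.
move=> fo x [i _ fix_]; have [k kP] := fo i x fix_.
by exists k => z /kP fz; exists i.
Qed.
HB.instance Definition _ := isPointed.Build Qp 0.
HB.instance Definition _ := isOpenTopological.Build Qp
  openQpT openQpI openQp_bigcup.

End padic_topology.

(* Borel sigma-algebra of Q_p^n, for the product topology *)
HB.instance Definition _ (p : nat) (p_prime : prime p) (n : nat) :=
  Measurable.copy 'rV[Qp p_prime]_n
    (g_sigma_algebraType (@open 'rV[Qp p_prime]_n)).

Definition Zpn (p : nat) (p_prime : prime p) (n : nat) : set 'rV[Qp p_prime]_n :=
  [set z | forall i, Zp (z 0 i)].
Arguments Zpn {p} p_prime n _.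

Section complex_valued.
Variable R : realType.

Definition ccvg (u : nat -> R[i]) (l : R[i]) :=
  Normc.normc (u k - l) @[k --> \oo] --> (0 : R).

Definition ucvg (T : Type) (u : nat -> T -> R[i]) (f : T -> R[i]) :=
  forall e : R, 0 < e ->
  \forall k \near \oo, forall x, Normc.normc (u k x - f x) < e.

(* meaningful for absolutely summable families only *)
Definition csum (V : choiceType) (D : set V) (F : V -> R[i]) : R[i] :=
  let rsum (g : V -> R) : R := fine (\esum_(v in D) (Num.max (g v) 0)%:E)
                           - fine (\esum_(v in D) (Num.max (- g v) 0)%:E) in
  rsum (fun v => complex.Re (F v)) +i* rsum (fun v => complex.Im (F v)).

Section integration.
Context d (T : measurableType d) (mu : {measure set T -> \bar R}).
Implicit Types f g : T -> R[i].

Definition cintegrable f :=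
  mu.-integrable setT (EFin \o (fun x => complex.Re (f x))) /\
  mu.-integrable setT (EFin \o (fun x => complex.Im (f x))).

Definition cintegral f : R[i] :=
  (\int[mu]_x complex.Re (f x)) +i* (\int[mu]_x complex.Im (f x)).

Definition cL2norm f : \bar R := Lnorm mu 2%:E (fun x => (Normc.normc (f x))%:E).

Definition L2 f :=
  [/\ measurable_fun setT (fun x => complex.Re (f x)),
      measurable_fun setT (fun x => complex.Im (f x)) &
      (cL2norm f < +oo)%E].

Definition L2cvg (u : nat -> T -> R[i]) f :=
  [/\ forall k, L2 (u k), L2 f &
      cL2norm (fun x => u k x - f x) @[k --> \oo] --> 0%E].

End integration.
End complex_valued.

Section padic_analysis.
Variables (R : realType) (p : nat) (p_prime : prime p) (n : nat).
Local Notation Qp := (Qp p_prime).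
Local Notation Qpn := ('rV[Qp]_n).

(* |x|_p : the least p^(-k) such that x \in p^k Z_p; it is 0 for x = 0 *)
Definition padic_norm (x : Qp) : R :=
  inf [set p%:R ^ (- k) | k in [set k : int | Zp (p%:R ^ (- k) * x)]].

Definition vnorm (x : Qpn) : R := \big[Num.max/0]_(i < n) padic_norm (x 0 i).

(* the fractional part {x}_p is \sum_(i < 0) a_i p^i *)
Definition chi (x : Qp) : R[i] :=
  let t := 2 * pi * ratr (trunc x 0) in cos t +i* sin t.

Definition dot (x y : Qpn) : Qp := \sum_(i < n) x 0 i * y 0 i.

(* Haar measure of Q_p^n, normalised by |Z_p^n| = 1 *)
Definition haar (mu : {measure set Qpn -> \bar R}) :=
  (forall (a : Qpn) (A : set Qpn), measurable A ->
     mu [set a + x | x in A] = mu A) /\ mu (Zpn p_prime n) = 1%E.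

Definition schwartz (f : Qpn -> R[i]) :=
  (forall x, \forall y \near x, f y = f x) /\
  compact (closure [set x | f x != 0]).

Variable mu : {measure set Qpn -> \bar R}.

Definition fourier (f : Qpn -> R[i]) (xi : Qpn) : R[i] :=
  cintegral mu (fun x => f x * chi (dot x xi)).

(* g represents D^s f, a class of functions modulo null sets; for s > 0 and f
   in the Bruhat-Schwartz space it is integrable, so that its Fourier transform
   is given by the integral. *)
Definition vladimirov (s : R) (f g : Qpn -> R[i]) :=
  cintegrable mu g /\
  forall xi, fourier g xi = (vnorm xi `^ s)%:C * fourier f xi.

End padic_analysis.

Section tree.
Variables (p : nat) (p_prime : prime p) (n : nat).
Local Notation Qp := (Qp p_prime).
Local Notation Qpn := ('rV[Qp]_n).

(* x + p^k Z_p^n *)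
Definition pcoset (x : Qpn) (k : int) : set Qpn :=
  [set x + p%:R ^ k *: z | z in Zpn p_prime n].

Record vertex := MkVertex {
  height : int ;
  residue : set Qpn ;
  residueP : exists x, residue = pcoset x height }.

HB.instance Definition _ := gen_eqMixin vertex.
HB.instance Definition _ := gen_choiceMixin vertex.

Definition vtx (x : Qpn) (k : int) : vertex :=
  MkVertex (ex_intro (fun y => pcoset x k = pcoset y k) x erefl).

(* a representative of the coset; neither [upper v] nor the set of all
   [lower v a] depends on its choice *)
Definition repr_vtx (v : vertex) : Qpn := sval (cid (residueP v)).

Definition upper (v : vertex) : vertex := vtx (repr_vtx v) (height v - 1).

Definition lower (v : vertex) (a : {ffun 'I_n -> 'I_p}) : vertex :=
  vtx (repr_vtx v + p%:R ^ height v *: \row_i (a i)%:R) (height v + 1).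

Definition adj (v u : vertex) := u = upper v \/ exists a, u = lower v a.

Definition laplacian (R : realType) (phi : vertex -> R[i]) (v : vertex) : R[i] :=
  \sum_(u \in [set u | adj v u]) (phi u - phi v).

Definition layer (R : realType) (phi : vertex -> R[i]) (k : int) (x : Qpn) : R[i] :=
  phi (vtx x k).

Definition boundary (k : int) : set vertex := [set v | height v = k].

End tree.
Arguments boundary {p} p_prime n k _.

Section problem.
Variables (R : realType) (p : nat) (p_prime : prime p) (n : nat).
Local Notation Qpn := ('rV[Qp p_prime]_n).
Variables (mu : {measure set Qpn -> \bar R}) (alpha : R).

Definition mass2 : R :=
  p%:R `^ alpha + p%:R `^ (n%:R - alpha) - p%:R ^+ n - 1.

(* p^((n - alpha) k) phi_k; layers are indexed by int, but only the natural
   ones matter for limits as k tends to +oo *)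
Definition renormalized (phi : vertex p_prime n -> R[i]) (k : nat) (x : Qpn) : R[i] :=
  (p%:R `^ ((n%:R - alpha) * k%:R))%:C * layer phi k%:Z x.

Definition solution (f : Qpn -> R[i]) (phi : vertex p_prime n -> R[i]) :=
  [/\ forall k : int, L2 mu (layer phi k),
      forall v, laplacian phi v - mass2%:C * phi v = 0 &
      L2cvg mu (renormalized phi) f].

Definition normal_derivative (f : Qpn -> R[i]) (phi : vertex p_prime n -> R[i])
    (g : Qpn -> R[i]) :=
  L2cvg mu (fun k x => (f x - renormalized phi k x) *
    (p%:R `^ ((k%:R + 1) * (2 * alpha - n%:R)))%:C) g.

Definition cutoff_residual (phi : vertex p_prime n -> R[i]) (v : vertex p_prime n) :=
  phi (upper v) - (p%:R `^ (n%:R - alpha))%:C * phi v.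

End problem.

(* Main.v *)
(* Write F_k for the average of f over the cosets of p^k Z_p^n, and s = 2 alpha - n.
   The Fourier transform of F_k is that of f cut off to |xi| <= p^k; as f is invariant
   under p^K Z_p^n for some K, this gives D^s f = g = \sum_(j <= K) p^(s j) (F_j - F_(j - 1)).
   The equation of the problem is a linear recursion whose characteristic roots are
   p^(alpha - n) and p^(- alpha), and it is solved by
     phi_k = p^((alpha - n) k) F_k - p^(- alpha k - s) G_k,
   G_k being the average of g. For k >= K one has F_k = f and G_k = g, hence
     p^((n - alpha) k) phi_k = f - p^(- s (k + 1)) g
   exactly, from which all the limits follow by algebra.

   If eta is the difference of two solutions, renormalized, then its averages over the
   descendants of a vertex v satisfy a recursion with roots 1 and rho = p^(- s), and they
   tend to 0 by the L^2 condition; so eta v = rho eta (upper v) for every v. Each layer of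
   eta is then constant, and it is zero because Q_p^n has infinite measure.

   An integrable function d with zero Fourier transform is orthogonal to all finite
   products of finite sums of characters; such products converge boundedly to the
   indicator of any coset, so d has integral zero on every coset, and d = 0 a.e. *)
Require Import Defs.
From HB Require Import structures.
From mathcomp Require Import all_boot all_order all_algebra.
From mathcomp Require Import complex.
From mathcomp Require Import all_classical all_reals all_analysis.
From mathcomp Require Import measurable_realfun.
From mathcomp Require Import ring lra zify.
Set Implicit Arguments.
Unset Strict Implicit.
Unset Printing Implicit Defensive.
Import Order.TTheory GRing.Theory Num.Theory.
Import numFieldNormedType.Exports.
(* mathcomp has its own [Zp] and [approx] *)
Import Defs.
Local Open Scope classical_set_scope.
Local Open Scope ring_scope.
Local Open Scope complex_scope.

(** * p-adic integers *)

(** The family G is forced by the equation. The sum over the children sees F_k while the upper term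
    sees F_(k - 1), so the sequence p^((alpha - n) k) F_k misses the equation at height k by a
    multiple of the jump F_k - F_(k - 1). A second term on the other root cancels this defect
    exactly when the jumps of its family G are proportional to p^(s k) (F_k - F_(k - 1)); the factor
    p^(- s) makes the ratio equal to 1. Solved for G, this is a series over all ancestors. It
    converges because F is bounded and s > 0, and its sum is integrable because the L^1 norms of the
    layers of F do not grow on going up the tree.

    D^s f is specified only through its Fourier transform, so statements about an arbitrary
    representative g reduce to the explicit one only once the transform is known to be injective.

    Uniqueness concerns layers that need not be bounded, for which pointwise control near the
    boundary is missing. Smallness in L^2 is passed to averages instead: at every depth the
    descendants of a vertex fill the same coset, of fixed finite measure. *)

Section padic_integers.
Variables (p : nat) (p_prime : prime p).
Local Notation P := (p%:R : rat).
Local Notation Qp := (Qp p_prime).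
Local Notation pp := (p%:R : Qp).
Implicit Types (x y z : Qp) (k l : int).

Let P_gt0 : 0 < P. Proof. by rewrite ltr0n prime_gt0. Qed.
Let P_neq0 : P != 0. Proof. exact: lt0r_neq0. Qed.
Let PX_gt0 k : 0 < P ^ k. Proof. exact: exprz_gt0. Qed.
Let PX_neq0 k : P ^ k != 0. Proof. exact: lt0r_neq0. Qed.

Let ppowZ_pX k : ppowZ p k (P ^ k).
Proof. by rewrite /ppowZ mulfV ?rpred1. Qed.

Lemma pXQp_neq0 k : pp ^ k != 0.
Proof. by rewrite expfz_neq0 ?pQp_neq0. Qed.

Lemma pXD k l : pp ^ (k + l) = pp ^ k * pp ^ l.
Proof. by rewrite expfzDr ?pQp_neq0. Qed.

Lemma ZpN x : Zp x -> Zp (- x).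
Proof.
move=> xZ; apply: Zp_approx (approxN (approx_trunc x)) _ => m.
by rewrite ppowZN// Zp_trunc.
Qed.

Lemma Zp_0 : Zp (0 : Qp). Proof. exact: (Zp_nat p_prime 0). Qed.

Lemma ZpB x y : Zp x -> Zp y -> Zp (x - y).
Proof. by move=> xZ yZ; apply: ZpD => //; exact: ZpN. Qed.

Lemma Zp_pX (m : nat) : Zp (pp ^ m%:Z).
Proof. by rewrite -exprnP -natrX; exact: Zp_nat. Qed.

Lemma Zp_approx_ev u x : approx u x ->
  (exists M, forall m, (M <= m)%N -> ppowZ p 0 (u m)) -> Zp x.
Proof.
move=> ux [M u0]; apply: (@Zp_approx _ _ (fun m => u (m + M)%N)).
  by move=> k; have [N HN] := ux k; exists N => m Nm; apply: HN; lia.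
by move=> m; apply: u0; lia.
Qed.

Lemma approx_pX k : approx (fun=> P ^ k) (pp ^ k).
Proof.
have H (m : nat) : approx (fun=> P ^ m%:Z) (pp ^ m%:Z).
  by rewrite -!exprnP -!natrX; exact: approx_nat.
have [k0|k0] := leP 0 k; first by case: k k0 => // m _; exact: H.
have cq : coherent p (fun=> P ^ k).
  split=> [l|]; first by rewrite subrr ppowZ0.
  by exists k, 0; exact: ppowZ_pX.
suff <- : limQp p_prime cq = pp ^ k by exact: approx_limQp.
have [m mk] : exists m : nat, - k = m%:Z by exists (absz k); lia.
(* For negative [k], the limit of the constant sequence is identified as an inverse: its product
   with [pp ^ (- k)] is 1. *)
have E : limQp p_prime cq * pp ^ (- k) = 1.
  rewrite mk; apply: approx_uniq (approxM (approx_limQp p_prime cq) (H m)) _.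
  apply: (eq_approx _ (@approx_nat _ p_prime 1)) => j.
  by rewrite -mk -expfzDr// subrr expr0z.
apply: (mulIf (pXQp_neq0 (- k))).
by rewrite E -pXD subrr expr0z.
Qed.

(** Multiplying an approximating sequence by a power of [P] shifts the modulus of its congruences.
    Together with [trunc_eq], this trades truncated expansions for integrality of [pp ^ (- k) * x],
    the form in which cosets are handled afterwards. *)
Lemma trunc_eq0 x k : trunc x k = 0 <-> Zp (pp ^ (- k) * x).
Proof.
split=> [xk|xZ].
  apply: (Zp_approx_ev (approxM (approx_pX (- k)) (approx_trunc x))).
  exists (absz k) => m km; rewrite -[X in ppowZ p X _](addNr k).
  apply: ppowZM => //.
  by rewrite -[trunc x _]subr0 -xk trunc_step//; lia.
set z := _ * x in xZ; have xE : x = pp ^ k * z.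
  by rewrite /z mulrA -pXD subrr expr0z mul1r.
have := approxM (approx_pX k) (approx_trunc z).
rewrite -[mulQp _ _]/(pp ^ k * z) -xE => /(_ k)[M /(_ M (leqnn _))] H.
apply: (ppowZ_small p_prime (trunc_bound x k)); first by rewrite lexx PX_gt0.
rewrite subr0 -[trunc x k](subKr (P ^ k * trunc z M)) ppowZB//.
rewrite -[X in ppowZ p X _]addr0; by apply: ppowZM => //; exact: Zp_trunc.
Qed.

Lemma trunc_eq x y k : trunc x k = trunc y k <-> Zp (pp ^ (- k) * (x - y)).
Proof.
rewrite -trunc_eq0.
have D : ppowZ p k (trunc (x - y) k - (trunc x k - trunc y k)).
  apply: (ppowZ_trans (b := trunc x k + trunc (- y) k)); first exact: reduceP.
  by rewrite opprD addrACA subrr add0r; exact: reduceP.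
split=> [xy|xy].
  apply: (ppowZ_small p_prime (trunc_bound _ k)); first by rewrite lexx PX_gt0.
  by move: D; rewrite xy subrr.
apply: (ppowZ_small p_prime (trunc_bound _ k) (trunc_bound _ k)).
by move: D; rewrite xy sub0r => /ppowZN; rewrite opprK.
Qed.

Lemma Zp_pXle x k l : k <= l -> Zp (pp ^ k * x) -> Zp (pp ^ l * x).
Proof.
move=> kl xZ; have [m mE] : exists m : nat, l = m%:Z + k by exists (absz (l - k)); lia.
by rewrite mE pXD -mulrA; apply: ZpM => //; exact: Zp_pX.
Qed.

Lemma Zp_pole x : Zp (pp ^ (dpole x)%:Z * x).
Proof. by rewrite -[X in pp ^ X]opprK; exact: (trunc_eq0 _ _).1 (trunc_dpole x). Qed.

Lemma Zp_all_eq0 x : (forall k, Zp (pp ^ k * x)) -> x = 0.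
Proof.
move=> xZ; apply: Qp_ext => k.
have xk : trunc x k = 0 by exact: (trunc_eq0 _ _).2 (xZ _).
have yk : trunc (0 : Qp) k = 0 by apply: (trunc_eq0 _ _).2; rewrite mulr0; exact: Zp_0.
by rewrite xk yk subrr ppowZ0.
Qed.

Lemma Zp_order x k : ~ Zp (pp ^ k * x) ->
  exists m : nat, ~ Zp (pp ^ (k + m%:Z) * x) /\ Zp (pp ^ (k + m%:Z + 1) * x).
Proof.
move=> xk; have ex : exists m : nat, `[< Zp (pp ^ (k + m%:Z) * x) >].
  exists (absz ((dpole x)%:Z - k)); apply/asboolP.
  by apply: Zp_pXle (Zp_pole x); lia.
case: (ex_minnP ex) => -[|m] /asboolP; first by rewrite addr0.
move=> xm mmin; exists m; split; last by rewrite -addrA -PoszD addn1.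
by move=> /asboolP/mmin; rewrite ltnn.
Qed.

Lemma Zp_natV (c : nat) : (c < p)%N -> Zp (pp ^ (- 1) * c%:R) -> c = 0%N.
Proof.
move=> cp /(trunc_eq0 c%:R 1).2 c1; have [M /(_ M (leqnn _))] := approx_nat p_prime c 1.
rewrite c1 subr0 => H.
have : (c%:R : rat) = 0.
  apply: (ppowZ_small p_prime (k := 1)); last by rewrite subr0.
    by rewrite ler0n expr1z ltr_nat cp.
  by rewrite lexx PX_gt0.
by move/eqP; rewrite pnatr_eq0 => /eqP.
Qed.

(** The digit is [trunc z 1], which for a p-adic integer is an integer in [0, p[. *)
Lemma Zp_digit z : Zp z -> exists2 c : 'I_p, true & Zp (pp ^ (- 1) * (z - c%:R)).
Proof.
move=> zZ; have z1 : trunc z 1 \is a Num.int by rewrite -(ppowZ0E p); exact: (Zp_trunc 1 zZ).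
have /andP[z0 zp] := trunc_bound z 1.
have /natrP[c cE] : trunc z 1 \is a Num.nat by rewrite natrEint z1.
have cp : (c < p)%N by rewrite -(ltr_nat rat) -cE.
exists (Ordinal cp) => //=; apply: (trunc_eq _ _ _).1; rewrite cE; apply/esym.
have [M /(_ M (leqnn _))/ppowZ_sym H] := approx_nat p_prime c 1.
apply: (ppowZ_small p_prime (trunc_bound _ 1) _ H).
by rewrite ler0n expr1z ltr_nat cp.
Qed.

Lemma Zp_digit_inj z (c d : 'I_p) :
  Zp (pp ^ (- 1) * (z - c%:R)) -> Zp (pp ^ (- 1) * (z - d%:R)) -> c = d.
Proof.
wlog cd : c d / (c <= d)%N.
  move=> W Hc Hd; have [|/ltnW] := leqP c d => cd; first exact: W.
  by apply/esym; exact: W.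
move=> Hc Hd; apply/val_inj/eqP; rewrite eqn_leq cd /=.
have := ZpB Hc Hd; rewrite -mulrBr.
have -> : z - c%:R - (z - d%:R) = (d - c)%:R by rewrite natrB//; ring.
rewrite -subn_eq0 => /Zp_natV ->//; exact: leq_ltn_trans (leq_subr _ _) (ltn_ord d).
Qed.

End padic_integers.

(** * Cosets and vertices *)

Section cosets.
Variables (p : nat) (p_prime : prime p) (n : nat).
Local Notation Qp := (Qp p_prime).
Local Notation Qpn := ('rV[Qp]_n).
Local Notation pp := (p%:R : Qp).
Local Notation digits := {ffun 'I_n -> 'I_p}.
Implicit Types (x y z : Qpn) (k l : int) (v : vertex p_prime n) (a : digits).

Lemma pcosetP x k y :
  pcoset x k y <-> forall i, Zp (pp ^ (- k) * (y 0 i - x 0 i)).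
Proof.
split=> [[z zZ <-] i|H].
  by rewrite !mxE addrAC subrr add0r mulrA -pXD addNr expr0z mul1r; exact: zZ.
exists (pp ^ (- k) *: (y - x)); first by move=> i; rewrite !mxE; exact: H.
by rewrite scalerA -pXD subrr expr0z scale1r addrC subrK.
Qed.

Lemma pcoset_refl x k : pcoset x k x.
Proof. by apply/pcosetP => i; rewrite subrr mulr0; exact: Zp_0. Qed.

Lemma pcoset_sym x k y : pcoset x k y -> pcoset y k x.
Proof. by move=> /pcosetP H; apply/pcosetP => i; rewrite -opprB mulrN; exact: ZpN. Qed.

Lemma pcoset_trans y x k z : pcoset x k y -> pcoset y k z -> pcoset x k z.
Proof.
move=> /pcosetP xy /pcosetP yz; apply/pcosetP => i.
by rewrite -(subrKA (y 0 i)) mulrDr; exact: ZpD.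
Qed.

Lemma pcoset_le x k l : k <= l -> pcoset x l `<=` pcoset x k.
Proof.
by move=> kl y /pcosetP xy; apply/pcosetP => i; apply: Zp_pXle (xy i); rewrite lerN2.
Qed.

Lemma pcoset_eq x k y : pcoset x k y -> pcoset x k = pcoset y k.
Proof.
move=> xy; apply/seteqP; split=> z; last exact: pcoset_trans xy.
exact/pcoset_trans/pcoset_sym.
Qed.

Lemma pcosetD w x k y : pcoset x k y -> pcoset (w + x) k (w + y).
Proof.
move=> /pcosetP xy; apply/pcosetP => i; rewrite !mxE.
by rewrite opprD addrACA subrr add0r; exact: xy.
Qed.

Lemma pcoset_shift w x k : pcoset (w + x) k = [set w + y | y in pcoset x k].
Proof.
apply/seteqP; split=> [y|_ [y xy <-]]; last exact: pcosetD.
move=> /(pcosetD (- w)); rewrite addKr => wy.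
by exists (- w + y) => //; rewrite addNKr.
Qed.

(** Finitely many coordinates have a common bound on their poles. In the tree, any two vertices of a
    layer thus have a common ancestor. *)
Lemma pcoset_common x y : exists m : nat, pcoset x (- m%:Z) y.
Proof.
exists (\max_(i < n) dpole (y 0%R i - x 0%R i)%R)%N; apply/pcosetP => i.
rewrite opprK; apply: Zp_pXle (Zp_pole _).
by rewrite lez_nat; exact: (leq_bigmax_cond (F := fun i => dpole (y 0 i - x 0 i))).
Qed.

Definition digit_row a : Qpn := \row_i (a i)%:R.

Let shift_digit (F : fieldType) (P u v d : F) k : P != 0 ->
  P ^ (- (k + 1)) * (v - (u + P ^ k * d)) = P ^ (- 1) * (P ^ (- k) * (v - u) - d).
Proof.
move=> P0; rewrite [- (k + 1)]opprD [- k - 1]addrC expfzDr// -mulrA; congr (_ * _).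
by rewrite opprD addrA mulrBr mulrA -expfzDr// addNr expr0z mul1r.
Qed.

(** Coordinatewise, the child [a] of a coset collects the points whose rescaled offset has leading
    digit [a]; existence and uniqueness of the child containing a point then come from those of
    digits. *)
Lemma pcoset_digit x k a y : pcoset (x + pp ^ k *: digit_row a) (k + 1) y <->
  forall i, Zp (pp ^ (- 1) * (pp ^ (- k) * (y 0 i - x 0 i) - (a i)%:R)).
Proof.
have E i := shift_digit (x 0 i) (y 0 i) (a i)%:R k (pQp_neq0 p_prime).
by rewrite pcosetP; split=> H i; have := H i; rewrite !mxE E.
Qed.

Lemma pcoset_child x k a : pcoset (x + pp ^ k *: digit_row a) (k + 1) `<=` pcoset x k.
Proof.
move=> y /pcoset_digit H; apply/pcosetP => i.
rewrite -[X in Zp X](subrK (a i)%:R); apply: ZpD; last exact: Zp_nat.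
have := @Zp_pXle _ p_prime _ (- 1) 0 isT (H i).
by rewrite expr0z mul1r.
Qed.

Lemma pcoset_digit_ex x k y : pcoset x k y ->
  exists a, pcoset (x + pp ^ k *: digit_row a) (k + 1) y.
Proof.
move=> /pcosetP xy.
have /choice[a aP] : forall i, exists c : 'I_p,
    Zp (pp ^ (- 1) * (pp ^ (- k) * (y 0 i - x 0 i) - c%:R)).
  by move=> i; have [c _ cP] := Zp_digit (xy i); exists c.
by exists [ffun i => a i]; apply/pcoset_digit => i; rewrite ffunE.
Qed.

Lemma pcoset_digit_inj x k y a b : pcoset (x + pp ^ k *: digit_row a) (k + 1) y ->
  pcoset (x + pp ^ k *: digit_row b) (k + 1) y -> a = b.
Proof.
move=> /pcoset_digit aP /pcoset_digit bP; apply/ffunP => i.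
exact: Zp_digit_inj (aP i) (bP i).
Qed.

Lemma pcoset_children x k : pcoset x k =
  \bigcup_(a in [set: digits]) pcoset (x + pp ^ k *: digit_row a) (k + 1).
Proof.
apply/seteqP; split=> y; last by move=> [a _]; exact: pcoset_child.
by move=> /pcoset_digit_ex[a ay]; exists a.
Qed.

Lemma trivIset_children x k :
  trivIset [set: digits] (fun a => pcoset (x + pp ^ k *: digit_row a) (k + 1)).
Proof. by move=> a b _ _ [y [/pcoset_digit_inj]]; apply. Qed.

Lemma vertex_eq v w : height v = height w -> residue v = residue w -> v = w.
Proof.
case: v w => [k X Xk] [l Y Yl] /= kl XY; subst l Y.
by congr MkVertex; exact: Prop_irrelevance.
Qed.

Lemma vtx_eq x y k : vtx x k = vtx y k <-> pcoset x k y.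
Proof.
split=> [/(congr1 (@residue _ _ _))/= ->|xy]; first exact: pcoset_refl.
by apply: vertex_eq => //=; exact: pcoset_eq.
Qed.

Lemma vtxK v : vtx (repr_vtx v) (height v) = v.
Proof. by apply: vertex_eq => //=; rewrite /repr_vtx; case: cid. Qed.

Lemma repr_vtxP x k : pcoset x k (repr_vtx (vtx x k)).
Proof. exact/vtx_eq/esym/(vtxK (vtx x k)). Qed.

Lemma vtxP v : exists x, v = vtx x (height v).
Proof. by exists (repr_vtx v); rewrite vtxK. Qed.

Lemma vtx_le x y k l : k <= l -> vtx x l = vtx y l -> vtx x k = vtx y k.
Proof. by move=> kl /vtx_eq xy; apply/vtx_eq; exact: pcoset_le xy. Qed.

Lemma upper_vtx x k : upper (vtx x k) = vtx x (k - 1).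
Proof.
rewrite /upper/=; apply/vtx_eq/pcoset_sym/(@pcoset_le _ _ k); first lia.
exact: repr_vtxP.
Qed.

Lemma lowerE v a : lower v a = vtx (repr_vtx v + pp ^ height v *: digit_row a) (height v + 1).
Proof. by []. Qed.

Lemma lower_inj v : injective (lower v).
Proof.
move=> a b; rewrite !lowerE => /vtx_eq ab.
exact: pcoset_digit_inj ab (pcoset_refl _ _).
Qed.

Lemma upper_lower v a : upper (lower v a) = v.
Proof.
rewrite lowerE upper_vtx addrK -[RHS]vtxK; apply/vtx_eq/pcoset_sym.
by apply: pcoset_child; exact: pcoset_refl.
Qed.

Lemma card_digits : #|{: digits}| = (p ^ n)%N.
Proof. by rewrite card_ffun !card_ord. Qed.

(** The sum over the set of neighbours splits this way because the children are pairwise distinct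
    and the upper neighbour, lying at another height, is not one of them. *)
Lemma laplacianE (R : realType) (phi : vertex p_prime n -> R[i]) v :
  laplacian phi v = (phi (upper v) - phi v) + \sum_a (phi (lower v a) - phi v).
Proof.
rewrite /laplacian.
have -> : [set u | adj v u] = [set upper v] `|` [set lower v a | a in [set: digits]].
  apply/seteqP; split=> u; first by move=> [->|[a ->]]; [left|right; exists a].
  by move=> [->|[a _ <-]]; [left|right; exists a].
have U : uniq (map (lower v) (enum digits)).
  by rewrite (map_inj_uniq (@lower_inj v)) enum_uniq.
have lowerT : [set lower v a | a in [set: digits]] = [set` map (lower v) (enum digits)].
  apply/seteqP; split=> u /=; last by move=> /mapP[a _ ->]; exists a.
  by move=> [a _ <-]; apply/map_f; rewrite mem_enum.
rewrite lowerT fsbigU//=.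
- rewrite fsbig_set1; congr (_ + _).
  by rewrite -(fsbig_seq _ _ U) big_map big_enum.
- move=> u [/= -> /mapP[a _ /(congr1 (@height _ _ _))]].
  by rewrite lowerE /upper/=; lia.
Qed.

End cosets.

Arguments digit_row {p p_prime n} a.

(** * Topology *)

Section coset_topology.
Variables (p : nat) (p_prime : prime p) (n : nat).
Local Notation Qp := (Qp p_prime).
Local Notation Qpn := ('rV[Qp]_n).
Local Notation pp := (p%:R : Qp).
Local Notation digits := {ffun 'I_n -> 'I_p}.
Implicit Types (x y z : Qpn) (k l : int) (v : vertex p_prime n) (a : digits).

Lemma nbhs_Qp_ball (x : Qp) k : nbhs x [set y | Zp (pp ^ (- k) * (y - x))].
Proof.
exists [set y | Zp (pp ^ (- k) * (y - x))]; split=> //=; last first.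
  by rewrite subrr mulr0; exact: Zp_0.
move=> y yx; exists k => z zZ /=; rewrite addrAC mulrDr; apply: ZpD => //.
by rewrite mulrA -pXD addNr expr0z mul1r.
Qed.

Lemma nbhs_QpP (x : Qp) (A : set Qp) : nbhs x A ->
  exists m : nat, forall z : Qp, Zp z -> A (x + pp ^ m%:Z * z).
Proof.
move=> [B [oB Bx BA]]; have [k kB] := oB x Bx; exists (absz k) => z zZ; apply: BA.
have -> : pp ^ (absz k)%:Z * z = pp ^ k * (pp ^ ((absz k)%:Z - k) * z).
  by rewrite mulrA -pXD addrC subrK.
apply: kB; have [m ->] : exists m : nat, (absz k)%:Z - k = m%:Z.
  by exists (absz ((absz k)%:Z - k)); lia.
by apply: ZpM => //; exact: Zp_pX.
Qed.

Lemma nbhs_pcoset x k : nbhs x (pcoset x k).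
Proof.
exists (fun i j => [set y | Zp (pp ^ (- k) * (y - x i j))]).
  by move=> i j; exact: nbhs_Qp_ball.
by move=> y xy; apply/pcosetP => i; exact: xy.
Qed.

Lemma nbhs_pcosetP x (A : set Qpn) : nbhs x A ->
  exists m : nat, pcoset x m%:Z `<=` A.
Proof.
move=> [B xB BA].
have /choice[f fP] i : exists m : nat, forall z : Qp, Zp z -> B 0 i (x 0 i + pp ^ m%:Z * z).
  exact/nbhs_QpP/xB.
exists (\max_(i < n) f i)%N => y [z zZ <-]; apply: BA => i j; rewrite ord1 !mxE.
have fj : (f j <= \max_(i < n) f i)%N by exact: leq_bigmax.
rewrite -(subnKC fj) PoszD pXD -mulrA; apply: fP.
by apply: ZpM; [exact: Zp_pX|exact: zZ].
Qed.

Let openP (A : set Qpn) : open A <-> forall x, A x -> nbhs x A.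
Proof. by rewrite openE. Qed.

Lemma measurable_open (A : set Qpn) : open A -> measurable A.
Proof. by move=> oA; apply: sub_sigma_algebra. Qed.

Lemma open_pcoset x k : open (pcoset x k).
Proof.
by apply/openP => y xy; rewrite (pcoset_eq xy); exact: nbhs_pcoset.
Qed.

Lemma measurable_pcoset x k : measurable (pcoset x k).
Proof. by apply: measurable_open; exact: open_pcoset. Qed.

Definition coset_periodic (T : Type) k (u : Qpn -> T) :=
  forall x y, pcoset x k y -> u x = u y.

Lemma open_periodic (T : Type) k (u : Qpn -> T) (A : set T) :
  coset_periodic k u -> open (u @^-1` A).
Proof.
move=> uP; apply/openP => x Ax; apply: filterS (nbhs_pcoset x k) => y /uP xy.
by rewrite /preimage/= -xy.
Qed.

(** Every preimage is a union of cosets, hence open, whatever the target sigma-algebra. *)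
Lemma measurable_periodic d (T : measurableType d) k (u : Qpn -> T) :
  coset_periodic k u -> measurable_fun setT u.
Proof.
move=> uP _ A mA; rewrite setTI; apply: measurable_open.
exact: open_periodic uP.
Qed.

Lemma measurable_translation x : measurable_fun setT (fun y : Qpn => x + y).
Proof.
apply: (@measurability _ _ _ _ _ _ (@open Qpn)) => // _ [A oA <-].
rewrite setTI; apply: measurable_open; apply/openP => y Axy.
have /nbhs_pcosetP[m mA] : nbhs (x + y) A by exact: (openP A).1.
 apply: filterS (nbhs_pcoset y m%:Z) => z yz.
by apply: mA; exact: pcosetD.
Qed.

(** A coset of height [k] is determined by the truncations at [k] of the coordinates of any of its
    points, that is, by a vector of rationals. *)
Lemma countable_boundary k : countable (boundary p_prime n k).
Proof.
pose t v : 'rV[rat]_n := \row_i trunc (repr_vtx v 0 i) k.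
have tI : {in boundary p_prime n k &, injective t}.
  move=> v w; rewrite !inE => vk wk vw; rewrite -[v]vtxK -[w]vtxK vk wk.
  apply/vtx_eq/pcoset_sym/pcosetP => i; apply: (trunc_eq _ _ _).1.
  by move/rowP : vw => /(_ i); rewrite !mxE.
by rewrite -(eq_countable (inj_card_eq tI)); exact: countableP.
Qed.

End coset_topology.

Arguments coset_periodic {p p_prime n T} k u.

(** * Haar measure *)

Section haar_measure.
Variables (R : realType) (p : nat) (p_prime : prime p) (n : nat).
Local Notation Qp := (Qp p_prime).
Local Notation Qpn := ('rV[Qp]_n).
Local Notation pp := (p%:R : Qp).
Local Notation digits := {ffun 'I_n -> 'I_p}.
Local Notation q := ((p ^ n)%:R : R).
Variables (mu : {measure set Qpn -> \bar R}) (mu_haar : haar mu).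
Implicit Types (x y z w : Qpn) (k l : int) (v : vertex p_prime n) (a : digits).

Lemma q_gt0 : 0 < q.
Proof. by rewrite ltr0n expn_gt0 prime_gt0. Qed.

Lemma q_neq0 : q != 0.
Proof. exact/lt0r_neq0/q_gt0. Qed.

Lemma sum_digits_cst (r : \bar R) : (\sum_(a : digits) r = q%:E * r)%E.
Proof. by rewrite sumr_const card_digits mule_natl. Qed.

Lemma haar_translate w (A : set Qpn) : measurable A ->
  pushforward mu (fun x => w + x) A = mu A.
Proof.
move=> mA; rewrite -(mu_haar.1 (- w) A mA) /pushforward; congr (mu _).
apply/seteqP; split=> [x Ax|_ [x Ax <-]] /=; last by rewrite addNKr.
by exists (w + x) => //; rewrite addKr.
Qed.

Lemma ge0_haar_integral w (h : Qpn -> \bar R) : measurable_fun setT h ->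
  (forall x, (0 <= h x)%E) -> (\int[mu]_x h (w + x)%R = \int[mu]_x h x)%E.
Proof.
move=> mh h0; have mw := measurable_translation w.
transitivity (\int[pushforward mu (fun x => w + x)%R]_x h x)%E; last first.
  by apply: eq_measure_integral => A mA _; exact: haar_translate.
by rewrite (ge0_integral_pushforward mw).
Qed.

Lemma haar_integrable w (h : Qpn -> \bar R) : mu.-integrable setT h ->
  mu.-integrable setT (fun x => h (w + x)).
Proof.
move=> /integrableP[mh hoo]; have mw := measurable_translation w.
apply/integrableP; split; first exact: (measurableT_comp mh mw).
rewrite (ge0_haar_integral w (h := fun x => `|h x|%E))//.
exact: measurableT_comp.
Qed.

Lemma haar_integral w (h : Qpn -> \bar R) : mu.-integrable setT h ->
  (\int[mu]_x h (w + x)%R = \int[mu]_x h x)%E.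
Proof.
move=> ih; have mw := measurable_translation w.
transitivity (\int[pushforward mu (fun x => w + x)%R]_x h x)%E; last first.
  by apply: eq_measure_integral => A mA _; exact: haar_translate.
rewrite (integral_pushforward mw)//; first exact: measurable_int ih.
exact: haar_integrable.
Qed.

Lemma ge0_integral_children x k (h : Qpn -> \bar R) : measurable_fun setT h ->
  (forall y, (0 <= h y)%E) ->
  (\int[mu]_(y in pcoset x k) h y =
   \sum_(a : digits) \int[mu]_(y in pcoset (x + pp ^ k *: digit_row a)%R (k + 1)%R) h y)%E.
Proof.
move=> mh h0.
have -> : pcoset x k = \big[setU/set0]_(a <- enum digits)
    pcoset (x + pp ^ k *: digit_row a) (k + 1).
  rewrite pcoset_children -bigcup_seq; congr (bigcup _ _).
  by apply/seteqP; split=> // a _ /=; rewrite mem_enum.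
rewrite ge0_integral_bigsetU ?big_enum//.
- by move=> a; exact: measurable_pcoset.
- exact: enum_uniq.
- by move=> a b _ _; apply: trivIset_children.
- exact: measurable_funTS.
Qed.

(** The [p ^ n] children are translates of one another, so they have the same measure. *)
Lemma haar_pcoset_step x k : mu (pcoset x k) = (q%:E * mu (pcoset x (k + 1)))%E.
Proof.
have tr w y l : mu (pcoset (w + y) l) = mu (pcoset y l).
  by rewrite pcoset_shift; apply: mu_haar.1; exact: measurable_pcoset.
have := @ge0_integral_children x k (cst 1%E) (measurable_cst _) (fun=> lee01).
rewrite integral_cst; last exact: measurable_pcoset.
rewrite mul1e => ->.
under eq_bigr => a _.
  rewrite integral_cst; last exact: measurable_pcoset.
  rewrite mul1e addrC tr.
  over.
by rewrite sum_digits_cst.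
Qed.

Lemma haar_pcoset x k : mu (pcoset x k) = (q ^ (- k))%:E.
Proof.
have q0 := q_neq0.
have base : mu (pcoset x 0) = 1%E.
  rewrite -(addr0 x) pcoset_shift mu_haar.1; last exact: measurable_pcoset.
  rewrite -mu_haar.2; congr (mu _); apply/seteqP; split=> y.
    by move=> [z zZ <-]; rewrite add0r expr0z scale1r.
  by move=> yZ; exists y => //; rewrite add0r expr0z scale1r.
have up (m : nat) : mu (pcoset x m%:Z) = (q ^ (- m%:Z))%:E.
  elim: m => [|m IH]; first by rewrite base oppr0 expr0z.
  have := haar_pcoset_step x m%:Z; rewrite IH -PoszD addn1.
  (* The smaller coset has finite measure: otherwise [q] times its measure could not be the finite
     measure of the larger one. *)
  case: (mu _) => [r [rE]| |]; last 2 first.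
  - by rewrite gt0_muley ?lte_fin ?q_gt0.
  - by rewrite gt0_muleNy ?lte_fin ?q_gt0.
  by congr EFin; apply: (mulfI q0); rewrite -rE -{2}(expr1z q) -expfzDr//; congr (_ ^ _); lia.
have dn (m : nat) : mu (pcoset x (- m%:Z)) = (q ^ m%:Z)%:E.
  elim: m => [|m IH]; first by rewrite oppr0 base expr0z.
  rewrite haar_pcoset_step; have -> : - m.+1%:Z + 1 = - m%:Z by lia.
  by rewrite IH -EFinM; congr EFin; rewrite -{1}(expr1z q) -expfzDr//; congr (_ ^ _); lia.
have [k0|k0] := leP 0 k.
  by have -> : k = (absz k)%:Z; [lia|rewrite up].
have -> : k = - (absz k)%:Z by lia.
by rewrite dn opprK.
Qed.

(** Each coset of height [k] has measure [q ^ (- k)], so a sum over vertices is a rescaled integral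
    of the layer. The cosets are indexed by an injection of the layer into the naturals. *)
Lemma ge0_integral_boundary k (h : vertex p_prime n -> \bar R) :
  (forall v, (0 <= h v)%E) ->
  (\esum_(v in boundary p_prime n k) h v = (q ^ k)%:E * \int[mu]_x h (vtx x k))%E.
Proof.
move=> h0; have /countable_injP[f fI] := countable_boundary p_prime n k.
pose E (i : nat) : set Qpn := [set x | f (vtx x k) = i].
have per (T : Type) (g : vertex p_prime n -> T) : coset_periodic k (fun x => g (vtx x k)).
  by move=> x y /vtx_eq ->.
have mE i : measurable (E i).
  by apply: measurable_open; exact: (open_periodic (A := [set i]) (per _ f)).
have mh : measurable_fun setT (fun x => h (vtx x k)) by exact: measurable_periodic (per _ h).
(* [b i] is [h v] when [i] is the code of a vertex [v] of height [k], and 0 when the fibre [E i] is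
   empty. *)
pose b (i : nat) : \bar R := ((q ^ k)%:E * \int[mu]_(x in E i) h (vtx x k))%E.
have b0 i : (0 <= b i)%E.
  rewrite mule_ge0 ?integral_ge0// lee_fin exprz_ge0//; exact/ltW/q_gt0.
have bf v : boundary p_prime n k v -> b (f v) = h v.
  rewrite /boundary/= => vk; have vE := vtxK v; rewrite vk in vE.
  have Ev : E (f v) = pcoset (repr_vtx v) k.
    apply/seteqP; split=> x /=; last by move=> /vtx_eq xv; rewrite /E/= -xv vE.
    by rewrite -{1}vE => /fI xv; apply/vtx_eq/esym/xv; rewrite inE.
  rewrite /b Ev (eq_integral (cst (h v))); last first.
    by move=> x /[!inE] /vtx_eq; rewrite vE => <-.
  rewrite integral_cst; last exact: measurable_pcoset.
  rewrite muleCA haar_pcoset -EFinM -expfzDr ?q_neq0// subrr expr0z mule1//.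
transitivity (\esum_(v in boundary p_prime n k) b (f v))%E.
  by apply: eq_esum => v vk; rewrite bf.
rewrite -(reindex_esum (boundary p_prime n k) (f @` boundary p_prime n k)); last first.
  by split=> [v vk|v w|_ [v vk <-]]; [exists v|exact: fI|exists v].
transitivity (\esum_(i in [set: nat]) b i)%E.
  rewrite esum_mkcond; apply: eq_esum => i _; case: ifPn => //; rewrite notin_setE => iN.
  rewrite /b; have -> : E i = set0; last by rewrite integral_set0 mule0.
  by apply/seteqP; split=> x //; rewrite /E/= => xi; apply: iN; exists (vtx x k).
rewrite -nneseries_esumT// /b nneseriesZl; last by move=> i _; exact: integral_ge0.
congr (_ * _)%E; rewrite -ge0_integral_bigcup//.
- by congr (integral _ _ _); apply/seteqP; split=> x //= _; exists (f (vtx x k)).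
- exact: measurable_funTS.
- by move=> i j _ _ [x [<- <-]].
Qed.

End haar_measure.

(** * Characters and norms *)

Section characters.
Variables (R : realType) (p : nat) (p_prime : prime p).
Local Notation Qp := (Qp p_prime).
Local Notation pp := (p%:R : Qp).
Implicit Types (t u : R) (x y z : Qp).

Definition circ t : R[i] := cos (2 * pi * t) +i* sin (2 * pi * t).

Lemma circD t u : circ (t + u) = circ t * circ u.
Proof.
rewrite /circ mulrDr cosD sinD; simpc; congr (_ +i* _).
exact: addrC.
Qed.

Lemma circ0 : circ 0 = 1.
Proof. by rewrite /circ mulr0 cos0 sin0. Qed.

Lemma circ_nat (m : nat) : circ m%:R = 1.
Proof.
elim: m => [|m IH]; first by rewrite circ0.
rewrite -natr1 circD IH mul1r /circ mulr1 -[2 * pi]/(2%:R * pi) mulr_natl.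
by rewrite cos2pi sin2pi.
Qed.

Lemma circ_int t : t \is a Num.int -> circ t = 1.
Proof.
move=> /intrP[m ->]; case: m => m; first exact: circ_nat.
rewrite NegzE mulrNz; have := circD (- (m.+1)%:~R) (m.+1)%:R.
by rewrite addNr circ0 circ_nat mulr1 => <-.
Qed.

(** By duplication, cos (2 pi t) = 1 forces sin (pi t) = 0, whereas the sine is positive inside ]0,
    pi[. *)
Lemma circ_eq1 t : 0 <= t < 1 -> circ t = 1 -> t = 0.
Proof.
move=> /andP[t0 t1] [+ _]; rewrite -mulrA mulr_natl cos_mulr2n.
have [->//|tN0 E] := eqVneq t 0.
have s0 : 0 < sin (pi * t).
  have tp : 0 < t by rewrite lt_def tN0.
  by apply: sin_gt0_pi; rewrite mulr_gt0 ?gtr_pMr ?pi_gt0.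
have := cos2Dsin2 (pi * t); nra.
Qed.

Lemma chiE x : chi R x = circ (ratr (trunc x 0)). Proof. by []. Qed.

(** Truncation at 0 is additive up to an integer, which [circ] does not see. *)
Lemma chiD x y : chi R (x + y) = chi R x * chi R y.
Proof.
have : ppowZ p 0 (trunc (x + y) 0 - (trunc x 0 + trunc y 0)) by exact: reduceP.
rewrite ppowZ0E !chiE => /intrP[m mE].
have -> : trunc (x + y) 0 = m%:~R + (trunc x 0 + trunc y 0) by rewrite -mE subrK.
by rewrite 2!rmorphD 2!circD circ_int ?mul1r// rmorph_int intr_int.
Qed.

Lemma chi_Zp x : Zp x -> chi R x = 1.
Proof. by move=> xZ; rewrite chiE xZ raddf0 circ0. Qed.

Lemma chi0 : chi R (0 : Qp) = 1. Proof. exact/chi_Zp/Zp_0. Qed.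

Lemma chi_eq1 x : chi R x = 1 -> Zp x.
Proof.
rewrite chiE => x1; rewrite /Zp/=; apply/eqP; rewrite -(fmorph_eq0 (@ratr R)).
apply/eqP/circ_eq1 => //; have /andP[x0 xp] := trunc_bound x 0.
by rewrite ler0q x0/= -[1](ratr_nat R 1) ltr_rat.
Qed.

Lemma normc_chi x : Normc.normc (chi R x) = 1.
Proof. by rewrite /Normc.normc chiE/= cos2Dsin2 sqrtr1. Qed.

Lemma chiMn x (m : nat) : chi R (m%:R * x) = chi R x ^+ m.
Proof.
elim: m => [|m IH]; first by rewrite mul0r chi0 expr0.
by rewrite -natr1 mulrDl mul1r chiD IH exprSr.
Qed.

(** A geometric sum whose ratio is a p-th root of unity other than 1. *)
Lemma chi_sum x : ~ Zp x -> Zp (pp * x) -> \sum_(c < p) chi R (c%:R * x) = 0.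
Proof.
move=> xZ pxZ; under eq_bigr do rewrite chiMn.
have w1 : chi R x - 1 != 0 by rewrite subr_eq0; apply/eqP => /chi_eq1.
by apply: (mulfI w1); rewrite -subrX1 mulr0 -chiMn chi_Zp// subrr.
Qed.

Lemma chi_sum_Zp x : Zp x -> \sum_(c < p) chi R (c%:R * x) = p%:R.
Proof.
move=> xZ; rewrite (eq_bigr (fun=> 1)); first by rewrite sumr_const card_ord.
by move=> c _; rewrite chi_Zp//; apply: ZpM => //; exact: Zp_nat.
Qed.

End characters.

(** * Pairing and norm on Q_p^n *)

Section dot_norm.
Variables (R : realType) (p : nat) (p_prime : prime p) (n : nat).
Local Notation Qp := (Qp p_prime).
Local Notation Qpn := ('rV[Qp]_n).
Local Notation pp := (p%:R : Qp).
Implicit Types (x y z xi : Qpn) (k l : int).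

Lemma dotDl x y z : dot (x + y) z = dot x z + dot y z.
Proof. by rewrite /dot -big_split/=; apply: eq_bigr => i _; rewrite mxE mulrDl. Qed.

Lemma dotDr x y z : dot x (y + z) = dot x y + dot x z.
Proof. by rewrite /dot -big_split/=; apply: eq_bigr => i _; rewrite mxE mulrDr. Qed.

Lemma dot_delta x i (c : Qp) : dot x (c *: delta_mx 0 i) = c * x 0 i.
Proof.
rewrite /dot (bigD1 i)//= !mxE !eqxx mulr1 big1 ?addr0 1?mulrC// => j ji.
by rewrite !mxE eqxx (negbTE ji) mulr0 mulr0.
Qed.

Lemma dot_deltal xi i (c : Qp) : dot (c *: delta_mx 0 i) xi = c * xi 0 i.
Proof.
by rewrite -dot_delta /dot; apply: eq_bigr => j _; rewrite mulrC.
Qed.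

Lemma chi_dot_periodic xi k : (forall i, Zp (pp ^ k * xi 0 i)) ->
  coset_periodic k (fun x => chi R (dot x xi)).
Proof.
move=> xiZ x _ [z zZ <-]; rewrite dotDl chiD [X in _ * X]chi_Zp ?mulr1//.
rewrite /dot; elim/big_ind: _ => [||i _]; [exact: Zp_0|exact: ZpD|].
by rewrite mxE mulrAC; apply: ZpM; [exact: xiZ|exact: zZ].
Qed.

Lemma chi_dot_ex xi k : ~ (forall i, Zp (pp ^ k * xi 0 i)) ->
  exists2 b, pcoset 0 k b & chi R (dot b xi) != 1.
Proof.
move=> /existsNP[i xiN]; exists (pp ^ k *: delta_mx 0 i).
  apply/pcosetP => j; rewrite !mxE subr0 mulrA -pXD addNr expr0z mul1r eqxx/=.
  exact: Zp_nat.
by rewrite dot_deltal; apply/eqP => /chi_eq1.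
Qed.

Lemma padic_norm_le (x : Qp) k : Zp (pp ^ k * x) -> padic_norm R x <= p%:R ^ k.
Proof.
move=> xk; apply: ge_inf; last by exists (- k) => //=; rewrite opprK.
by exists 0 => _ [l _ <-]; exact/exprz_ge0/ler0n.
Qed.

Lemma padic_norm_ge (x : Qp) k : ~ Zp (pp ^ (k - 1) * x) -> p%:R ^ k <= padic_norm R x.
Proof.
move=> xk; apply: lb_le_inf.
  by exists (p%:R ^ (dpole x)%:Z); exists (- (dpole x)%:Z) => /=; rewrite opprK//; exact: Zp_pole.
move=> _ [l /= xl <-]; apply: ler_weXz2l; first by rewrite ler1n prime_gt0.
rewrite leNgt; apply/negP => lk; apply: xk; apply: Zp_pXle xl; lia.
Qed.

(** All coordinates obey the upper bound, and one that is not integral at [k - 1] attains it. In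
    this form the norm is compared with heights without returning to the infimum. *)
Lemma vnormE xi k : (forall i, Zp (pp ^ k * xi 0 i)) ->
  ~ (forall i, Zp (pp ^ (k - 1) * xi 0 i)) -> vnorm R xi = p%:R ^ k.
Proof.
move=> xk /existsNP[i xkN]; apply/eqP; rewrite eq_le; apply/andP; split.
  apply/bigmax_leP; split=> [|j _]; first exact/exprz_ge0/ler0n.
  exact: padic_norm_le.
by apply: le_trans (padic_norm_ge xkN) _; exact: (le_bigmax _ (fun i => padic_norm R (xi 0 i))).
Qed.

Lemma padic_norm0 : padic_norm R (0 : Qp) = 0.
Proof.
apply/eqP; rewrite eq_le; apply/andP; split; last first.
  apply: lb_le_inf; last by move=> _ [k _ <-]; exact/exprz_ge0/ler0n.
  by exists (p%:R ^ (- 0)); exists 0 => //=; rewrite mulr0; exact: Zp_0.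
rewrite leNgt; apply/negP; set r := padic_norm _ _ => r0.
(* Since p^m > m > 1 / r, the power p^(- m) lies below [r], although it is an upper bound of the
   norm of 0. *)
pose m := Num.bound r^-1.
have : r <= p%:R ^ (- m%:Z) by apply: padic_norm_le; rewrite mulr0; exact: Zp_0.
rewrite -exprnN; apply/negP; rewrite -ltNge invf_plt ?posrE ?exprn_gt0 ?ltr0n ?prime_gt0//.
apply: lt_trans (archi_boundP _) _; first by rewrite invr_ge0 ltW.
by rewrite -natrX ltr_nat ltn_expl// prime_gt1.
Qed.

Lemma vnorm0 : vnorm R (0 : Qpn) = 0.
Proof.
rewrite /vnorm; elim/big_ind: _ => [//|a b -> ->|i _]; first exact: maxxx.
by rewrite mxE padic_norm0.
Qed.

(** Only 0 is divisible by all powers of p, so integrality fails at some exponent [l]; [k] is the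
    least exponent from [l] on at which it holds. *)
Lemma vector_order xi : xi != 0 -> exists k, (forall i, Zp (pp ^ k * xi 0 i)) /\
  ~ (forall i, Zp (pp ^ (k - 1) * xi 0 i)).
Proof.
move=> xi0; have [l xl] : exists l, ~ forall i, Zp (pp ^ l * xi 0 i).
  apply/existsNP => H; case/eqP: xi0; apply/rowP => i; rewrite mxE.
  by apply: Zp_all_eq0 => l; exact: H.
have ex : exists m : nat, `[< forall i, Zp (pp ^ (l + m%:Z) * xi 0 i) >].
  have [m] := pcoset_common 0 xi; move=> /pcosetP xm.
  exists (absz (m%:Z - l)); apply/asboolP => i; have := xm i.
  by rewrite mxE subr0 opprK; apply: Zp_pXle; lia.
case: (ex_minnP ex) => -[|m] /asboolP xm mmin; first by rewrite addr0 in xm.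
exists (l + m.+1%:Z); split=> // H.
have /mmin : `[< forall i, Zp (pp ^ (l + m%:Z) * xi 0 i) >].
  by apply/asboolP => i; have := H i; apply: Zp_pXle; lia.
by rewrite ltnn.
Qed.

End dot_norm.

(** * Complex-valued integrals *)

Section complex_limits.
Variable R : realType.
Implicit Types (u v : nat -> R[i]) (l z w : R[i]) (a b : R).
Local Notation Re := complex.Re.
Local Notation Im := complex.Im.
Local Notation normc := Normc.normc.

Lemma ReD z w : Re (z + w) = Re z + Re w. Proof. by case: z w => ? ? []. Qed.
Lemma ImD z w : Im (z + w) = Im z + Im w. Proof. by case: z w => ? ? []. Qed.
Lemma ReM z w : Re (z * w) = Re z * Re w - Im z * Im w. Proof. by case: z w => ? ? []. Qed.
Lemma ImM z w : Im (z * w) = Re z * Im w + Im z * Re w. Proof. by case: z w => ? ? []. Qed.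
Lemma ReN z : Re (- z) = - Re z. Proof. by case: z. Qed.
Lemma ImN z : Im (- z) = - Im z. Proof. by case: z. Qed.

Lemma complex_ext z w : Re z = Re w -> Im z = Im w -> z = w.
Proof. by case: z w => a b [c d] /= -> ->. Qed.

Lemma sqr_normcE z : normc z ^+ 2 = Re z ^+ 2 + Im z ^+ 2.
Proof. by case: z => a b /=; rewrite sqr_sqrtr// addr_ge0 ?sqr_ge0. Qed.

Lemma normc_ge0 z : 0 <= normc z. Proof. by case: z => a b /=; exact: sqrtr_ge0. Qed.

Lemma normc_eq0 z : (normc z == 0) = (z == 0).
Proof.
by apply/eqP/eqP => [/Normc.eq0_normc|->]; [|exact: Normc.normc0].
Qed.

Lemma Re_le_normc z : `|Re z| <= normc z.
Proof.
case: z => a b /=; rewrite -[leLHS]ger0_norm// -sqrtr_sqr real_normK ?num_real//.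
by rewrite ler_wsqrtr// lerDl sqr_ge0.
Qed.

Lemma Im_le_normc z : `|Im z| <= normc z.
Proof.
case: z => a b /=; rewrite -[leLHS]ger0_norm// -sqrtr_sqr real_normK ?num_real//.
by rewrite ler_wsqrtr// lerDr sqr_ge0.
Qed.

Lemma normc_le_ReIm z : normc z <= `|Re z| + `|Im z|.
Proof.
rewrite -(@ler_pXn2r _ 2)// ?nnegrE ?normc_ge0 ?addr_ge0// sqr_normcE.
rewrite sqrrD !real_normK ?num_real// lerD2r lerDl mulrn_wge0// mulr_ge0//.
Qed.

Lemma normc_real a : normc a%:C = `|a|.
Proof. by rewrite /= expr0n/= addr0 sqrtr_sqr. Qed.

Lemma normc_sum (I : Type) (s : seq I) (P : pred I) (F : I -> R[i]) :
  normc (\sum_(i <- s | P i) F i) <= \sum_(i <- s | P i) normc (F i).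
Proof.
elim/big_rec2: _ => [|i x y _ xy]; first by rewrite Normc.normc0.
by rewrite (le_trans (le_normcD _ _))// lerD2l.
Qed.

Lemma ccvgP u l : ccvg u l <->
  (Re (u k) @[k --> \oo] --> Re l) /\ (Im (u k) @[k --> \oo] --> Im l).
Proof.
split=> [ul|[ul vl]].
  split; apply/cvgrPdist_le => e e0; move/cvgrPdist_le : ul => /(_ e e0).
    apply: filterS => k; rewrite sub0r normrN ger0_norm ?normc_ge0//.
    by apply: le_trans; rewrite distrC -ReN -ReD; exact: Re_le_normc.
  apply: filterS => k; rewrite sub0r normrN ger0_norm ?normc_ge0//.
  by apply: le_trans; rewrite distrC -ImN -ImD; exact: Im_le_normc.
apply: (@squeeze_cvgr _ _ _ _ (cst 0) (fun k => `|Re (u k) - Re l| + `|Im (u k) - Im l|)).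
- apply: nearW => k; rewrite normc_ge0/=.
  by rewrite (le_trans (normc_le_ReIm _))// ReD ImD ReN ImN.
- exact: cvg_cst.
- rewrite -[0]addr0 -[X in nbhs (X + _)](normr0 R) -[X in nbhs (_ + X)](normr0 R).
  apply: cvgD; apply: cvg_norm.
    by rewrite -(subrr (Re l)); apply: cvgB => //; exact: cvg_cst.
  by rewrite -(subrr (Im l)); apply: cvgB => //; exact: cvg_cst.
Qed.

Lemma ccvg_unique u l l' : ccvg u l -> ccvg u l' -> l = l'.
Proof.
move=> /ccvgP[a b] /ccvgP[c d]; apply: complex_ext; [move: a c|move: b d];
  exact: (@cvg_unique _ (@Rhausdorff R)).
Qed.

Lemma ccvg_cst l : ccvg (fun=> l) l.
Proof. by apply/ccvgP; split; exact: cvg_cst. Qed.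

Lemma ccvgD u v l l' : ccvg u l -> ccvg v l' -> ccvg (fun k => u k + v k) (l + l').
Proof.
move=> /ccvgP[a b] /ccvgP[c d]; apply/ccvgP; rewrite ReD ImD.
by split; [under eq_fun do rewrite ReD|under eq_fun do rewrite ImD]; exact: cvgD.
Qed.

Lemma ccvgMl z u l : ccvg u l -> ccvg (fun k => z * u k) (z * l).
Proof.
move=> /ccvgP[a b]; apply/ccvgP; rewrite ReM ImM.
split; [under eq_fun do rewrite ReM|under eq_fun do rewrite ImM].
  by apply: cvgB; exact: cvgMr.
by apply: cvgD; exact: cvgMr.
Qed.

Lemma ccvg_near u v l : (\forall k \near \oo, u k = v k) -> ccvg u l -> ccvg v l.
Proof.
move=> uv; apply: cvg_trans; apply: near_eq_cvg.
by apply: filterS uv => k ->.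
Qed.

Lemma ccvg_shift u l : ccvg (fun k => u k.+1) l <-> ccvg u l.
Proof. by rewrite /ccvg -(cvg_shiftS (fun k => normc (u k - l))). Qed.

End complex_limits.

Section complex_integrals.
Context d (T : measurableType d) (R : realType) (mu : {measure set T -> \bar R}).
Implicit Types (f g : T -> R[i]) (c : R[i]) (h : T -> R).
Local Notation Re := complex.Re.
Local Notation Im := complex.Im.
Local Notation normc := Normc.normc.

Definition cmeasurable f := measurable_fun setT (fun x => Re (f x)) /\
  measurable_fun setT (fun x => Im (f x)).

Lemma cmeasurable_cst c : cmeasurable (fun=> c).
Proof. by split; exact: measurable_cst. Qed.

Lemma cmeasurableD f g : cmeasurable f -> cmeasurable g -> cmeasurable (fun x => f x + g x).
Proof.
move=> [a b] [a' b']; split; [under eq_fun do rewrite ReD|under eq_fun do rewrite ImD];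
  exact: measurable_funD.
Qed.

Lemma cmeasurableM f g : cmeasurable f -> cmeasurable g -> cmeasurable (fun x => f x * g x).
Proof.
move=> [a b] [a' b']; split; [under eq_fun do rewrite ReM|under eq_fun do rewrite ImM].
  by apply: measurable_funB; exact: measurable_funM.
by apply: measurable_funD; exact: measurable_funM.
Qed.

Lemma cmeasurable_sum (I : Type) (s : seq I) (F : I -> T -> R[i]) :
  (forall i, cmeasurable (F i)) -> cmeasurable (fun x => \sum_(i <- s) F i x).
Proof.
move=> mF; elim: s => [|i s IH].
  by under eq_fun do rewrite big_nil; exact: cmeasurable_cst.
by under eq_fun do rewrite big_cons; exact: cmeasurableD.
Qed.

Lemma measurable_normc f : cmeasurable f -> measurable_fun setT (fun x => normc (f x)).
Proof.
move=> [a b]; have -> : (fun x => normc (f x)) =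
    (fun x => Num.sqrt (Re (f x) ^+ 2 + Im (f x) ^+ 2)).
  by apply/funext => x; case: (f x).
have ms := continuous_measurable_fun (@sqrt_continuous R).
by apply: (measurableT_comp ms); apply: measurable_funD; exact: measurable_funX.
Qed.

Lemma cintegrable_measurable f : cintegrable mu f -> cmeasurable f.
Proof.
by move=> [/measurable_int a /measurable_int b]; split; exact/measurable_EFinP.
Qed.

Lemma cintegrable_dom f h : cmeasurable f -> mu.-integrable setT (EFin \o h) ->
  (forall x, normc (f x) <= h x) -> cintegrable mu f.
Proof.
move=> [mr mi] ih fh; split; apply: (le_integrable _ _ _ ih) => //.
- exact/measurable_EFinP.
- move=> x _ /=; rewrite lee_fin (le_trans (Re_le_normc _))// (le_trans (fh x))//.
  exact: ler_norm.
- exact/measurable_EFinP.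
- move=> x _ /=; rewrite lee_fin (le_trans (Im_le_normc _))// (le_trans (fh x))//.
  exact: ler_norm.
Qed.

Lemma integrable_normc f : cintegrable mu f -> mu.-integrable setT (fun x => (normc (f x))%:E).
Proof.
move=> fi; have mf := cintegrable_measurable fi; have [ri ii] := fi.
have := integrableD measurableT (integrable_abse ri) (integrable_abse ii).
apply: le_integrable => //; first exact/measurable_EFinP/measurable_normc.
move=> x _ /=; rewrite lee_fin ger0_norm ?normc_ge0//.
by rewrite ger0_norm ?addr_ge0// normc_le_ReIm.
Qed.

Lemma cintegrable0 : cintegrable mu (fun=> 0).
Proof. by split; exact: integrable0. Qed.

Lemma cintegrableD f g : cintegrable mu f -> cintegrable mu g ->
  cintegrable mu (fun x => f x + g x).
Proof.
move=> fi gi.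
have ih : mu.-integrable setT (EFin \o (fun x => normc (f x) + normc (g x))).
  apply: (eq_integrable measurableT _ _ _
    (integrableD measurableT (integrable_normc fi) (integrable_normc gi))) => x _.
  by rewrite /= EFinD.
apply: (cintegrable_dom _ ih) => [|x]; last exact: le_normcD.
by apply: cmeasurableD; exact: cintegrable_measurable.
Qed.

Lemma cintegrable_bounded f g (C : R) : cintegrable mu f -> cmeasurable g ->
  (forall x, normc (g x) <= C) -> cintegrable mu (fun x => f x * g x).
Proof.
move=> fi mg gC.
have ih : mu.-integrable setT (EFin \o (fun x => C * normc (f x))).
  apply: (eq_integrable measurableT _ _ _
    (integrableZl measurableT C (integrable_normc fi))) => x _.
  by rewrite /= EFinM.
apply: (cintegrable_dom _ ih); first by apply: cmeasurableM => //; exact: cintegrable_measurable.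
by move=> x; rewrite Normc.normcM mulrC ler_wpM2r ?normc_ge0.
Qed.

Lemma cintegrableZ c f : cintegrable mu f -> cintegrable mu (fun x => c * f x).
Proof.
move=> fi; have := cintegrable_bounded fi (cmeasurable_cst c) (fun=> lexx _).
by under eq_fun do rewrite mulrC.
Qed.

Lemma cintegrable_sum (I : Type) (s : seq I) (F : I -> T -> R[i]) :
  (forall i, cintegrable mu (F i)) -> cintegrable mu (fun x => \sum_(i <- s) F i x).
Proof.
move=> iF; elim: s => [|i s IH].
  by under eq_fun do rewrite big_nil; exact: cintegrable0.
by under eq_fun do rewrite big_cons; exact: cintegrableD.
Qed.

Lemma cintegral0 : cintegral mu (fun=> 0) = 0.
Proof. by rewrite /cintegral/= Rintegral_cst// mul0r. Qed.

Lemma cintegralD f g : cintegrable mu f -> cintegrable mu g ->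
  cintegral mu (fun x => f x + g x) = cintegral mu f + cintegral mu g.
Proof.
move=> [fr fi] [gr gi]; apply: complex_ext; rewrite ?ReD ?ImD /cintegral/=.
  by under eq_Rintegral do rewrite ReD; rewrite RintegralD.
by under eq_Rintegral do rewrite ImD; rewrite RintegralD.
Qed.

Lemma cintegralZ c f : cintegrable mu f ->
  cintegral mu (fun x => c * f x) = c * cintegral mu f.
Proof.
move=> [fr fi]; have Z a (h : T -> R) : mu.-integrable setT (EFin \o h) ->
  mu.-integrable setT (EFin \o (fun x => a * h x)) by exact: integrableZl.
apply: complex_ext; rewrite ?ReM ?ImM /cintegral/=.
  under eq_Rintegral do rewrite ReM.
  by rewrite RintegralB//; [rewrite !RintegralZl|exact: Z|exact: Z].
under eq_Rintegral do rewrite ImM.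
by rewrite RintegralD//; [rewrite !RintegralZl|exact: Z|exact: Z].
Qed.

Lemma cintegral_sum (I : Type) (s : seq I) (F : I -> T -> R[i]) :
  (forall i, cintegrable mu (F i)) ->
  cintegral mu (fun x => \sum_(i <- s) F i x) = \sum_(i <- s) cintegral mu (F i).
Proof.
move=> iF; elim: s => [|i s IH].
  by under eq_fun do rewrite big_nil; rewrite big_nil cintegral0.
under eq_fun do rewrite big_cons.
by rewrite big_cons -IH cintegralD//; exact: cintegrable_sum.
Qed.

Lemma ae_cintegral f g : cmeasurable f -> cmeasurable g ->
  {ae mu, forall x, f x = g x} -> cintegral mu f = cintegral mu g.
Proof.
move=> [fr fi] [gr gi] fg; rewrite /cintegral /Rintegral.
congr (fine _ +i* fine _); apply: ae_eq_integral => //; try exact/measurable_EFinP.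
all: by apply: filterS fg => x + _ => /= ->.
Qed.

Lemma dominated_ccvg (u : nat -> T -> R[i]) f h :
  (forall k, cmeasurable (u k)) -> cmeasurable f -> mu.-integrable setT (EFin \o h) ->
  (forall k x, normc (u k x) <= h x) -> (forall x, ccvg (u ^~ x) (f x)) ->
  cintegrable mu f /\ ccvg (fun k => cintegral mu (u k)) (cintegral mu f).
Proof.
move=> mu_ mf ih uh uf.
(* [P] stands for the real or the imaginary part, both dominated by the modulus; real dominated
   convergence applies to each. *)
have D (P : R[i] -> R) : (forall z, `|P z| <= normc z) ->
    (forall k, measurable_fun setT (fun x => P (u k x))) ->
    measurable_fun setT (fun x => P (f x)) ->
    (forall x, P (u k x) @[k --> \oo] --> P (f x)) ->
    mu.-integrable setT (EFin \o (fun x => P (f x))) /\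
    \int[mu]_x P (u k x) @[k --> \oo] --> \int[mu]_x P (f x).
  move=> Pn mPu mPf Puf.
  have mE k := (measurable_EFinP _ _).2 (mPu k).
  have ae1 : {ae mu, forall x, setT x ->
      (fun k => (P (u k x))%:E) @ \oo --> (P (f x))%:E}.
    by apply: aeW => x _; apply: cvg_EFin; [exact: nearW|exact: Puf].
  have ae2 : {ae mu, forall x k, setT x -> (`|(P (u k x))%:E| <= (h x)%:E)%E}.
    by apply: aeW => x k _; rewrite lee_fin (le_trans (Pn _)).
  have [Pi _ Pl] := dominated_convergence measurableT mE
    ((measurable_EFinP _ _).2 mPf) ae1 ih ae2.
  split=> //; rewrite /Rintegral; apply: fine_cvg; rewrite fineK//.
  exact: integrable_fin_num Pi.
have [ri rl] := D (@complex.Re R) (@Re_le_normc R) (fun k => (mu_ k).1) mf.1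
  (fun x => ((ccvgP _ _).1 (uf x)).1).
have [ii il] := D (@complex.Im R) (@Im_le_normc R) (fun k => (mu_ k).2) mf.2
  (fun x => ((ccvgP _ _).1 (uf x)).2).
by split; [split|apply/ccvgP].
Qed.

End complex_integrals.

(** * Square-integrable complex functions *)

Section L2_space.
Context d (T : measurableType d) (R : realType) (mu : {measure set T -> \bar R}).
Implicit Types (f g : T -> R[i]) (c : R[i]).
Local Notation normc := Normc.normc.

Definition sqr_L2norm f : \bar R := (\int[mu]_x (normc (f x) ^+ 2)%:E)%E.

Lemma sqr_L2norm_ge0 f : (0 <= sqr_L2norm f)%E.
Proof. by apply: integral_ge0 => x _; rewrite lee_fin sqr_ge0. Qed.

Lemma cL2normE f : cL2norm mu f = sqrte (sqr_L2norm f).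
Proof.
rewrite -poweR12_sqrt ?sqr_L2norm_ge0// /cL2norm unlock; congr (_ `^ _)%E.
apply: eq_integral => x _; rewrite abse_EFin poweR_EFin powR_mulrn//.
by rewrite ger0_norm ?normc_ge0.
Qed.

Lemma L2P f : L2 mu f <-> cmeasurable f /\ (sqr_L2norm f < +oo)%E.
Proof.
rewrite /L2 cL2normE; have h0 := sqr_L2norm_ge0 f.
have E : (sqrte (sqr_L2norm f) < +oo)%E = (sqr_L2norm f < +oo)%E.
  by rewrite -!ge0_fin_numE ?sqrte_ge0// sqrte_fin_num.
by rewrite E; split=> [[a b c]|[[a b] c]].
Qed.

Lemma measurable_sqr_normc f : cmeasurable f ->
  measurable_fun setT (fun x => (normc (f x) ^+ 2)%:E).
Proof. by move=> mf; apply/measurable_EFinP/measurable_funX/measurable_normc. Qed.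

(** For bounded integrable functions, |f|^2 <= C |f|. *)
Lemma L2_bounded f (C : R) : cintegrable mu f -> (forall x, normc (f x) <= C) -> L2 mu f.
Proof.
move=> fi fC; apply/L2P; split; first exact: cintegrable_measurable fi.
have mf := cintegrable_measurable fi.
have /integrableP[_] := integrableZl measurableT C (integrable_normc fi).
apply: le_lt_trans; apply: ge0_le_integral => //.
- by move=> x _; rewrite lee_fin sqr_ge0.
- exact: measurable_sqr_normc.
- apply: measurableT_comp => //; apply: measurable_funeM.
  exact/measurable_EFinP/measurable_normc.
- move=> x _; rewrite -EFinM abse_EFin lee_fin; apply: le_trans (ler_norm _).
  by rewrite expr2 ler_wpM2r ?normc_ge0.
Qed.

Lemma sqr_L2normZ c f : cmeasurable f ->
  sqr_L2norm (fun x => c * f x) = ((normc c ^+ 2)%:E * sqr_L2norm f)%E.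
Proof.
move=> mf; rewrite /sqr_L2norm -ge0_integralZl_EFin//; last 3 first.
- by move=> x _; rewrite lee_fin sqr_ge0.
- exact: measurable_sqr_normc.
- exact: sqr_ge0.
by apply: eq_integral => x _; rewrite Normc.normcM exprMn EFinM.
Qed.

Lemma cL2normZ c f : cmeasurable f ->
  cL2norm mu (fun x => c * f x) = ((normc c)%:E * cL2norm mu f)%E.
Proof.
move=> mf; rewrite !cL2normE sqr_L2normZ// sqrteM ?lee_fin ?sqr_ge0//.
by rewrite /= sqrtr_sqr ger0_norm ?normc_ge0.
Qed.

Lemma L2Z c f : L2 mu f -> L2 mu (fun x => c * f x).
Proof.
move=> /L2P[mf foo]; apply/L2P; split.
  by apply: cmeasurableM => //; exact: cmeasurable_cst.
by rewrite sqr_L2normZ// lte_mul_pinfty// lee_fin sqr_ge0.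
Qed.

(** A substitute for the triangle inequality, from |a - b|^2 <= 2 (|a|^2 + |b|^2); it suffices
    because only finiteness and smallness of squared norms are at stake. *)
Lemma sqr_L2normB f g : cmeasurable f -> cmeasurable g ->
  (sqr_L2norm (fun x => f x - g x)%R <= 2%:E * (sqr_L2norm f + sqr_L2norm g))%E.
Proof.
move=> mf mg; have := measurable_sqr_normc mf; have := measurable_sqr_normc mg => mg2 mf2.
rewrite /sqr_L2norm -ge0_integralD//; last 2 first.
- by move=> x _; rewrite lee_fin sqr_ge0.
- by move=> x _; rewrite lee_fin sqr_ge0.
rewrite -ge0_integralZl_EFin//; last 2 first.
- by move=> x _; rewrite -EFinD lee_fin addr_ge0 ?sqr_ge0.
- exact: emeasurable_funD.
apply: ge0_le_integral => //.
- by move=> x _; rewrite lee_fin sqr_ge0.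
- apply: measurable_sqr_normc; apply: cmeasurableD => //.
  have := cmeasurableM (cmeasurable_cst T (-1)) mg.
  by under eq_fun do rewrite mulN1r.
- by apply: measurable_funeM; exact: emeasurable_funD.
move=> x _; rewrite -EFinD -EFinM lee_fin.
have := le_normcD (f x) (- g x); rewrite normcN.
have := normc_ge0 (f x); have := normc_ge0 (g x); have := normc_ge0 (f x - g x).
set a := normc (f x); set b := normc (g x); set c := normc _ => c0 b0 a0 cab.
have : c ^+ 2 <= (a + b) ^+ 2 by rewrite ler_pXn2r ?nnegrE// addr_ge0.
have := sqr_ge0 (a - b); nra.
Qed.

Lemma ae_sqr_L2norm f g : cmeasurable f -> cmeasurable g ->
  {ae mu, forall x, f x = g x} -> sqr_L2norm f = sqr_L2norm g.
Proof.
move=> mf mg fg; apply: ae_eq_integral => //; try exact: measurable_sqr_normc.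
by apply: filterS fg => x + _ => /= ->.
Qed.

Lemma cL2norm0 : cL2norm mu (fun=> 0) = 0%E.
Proof.
rewrite cL2normE /sqr_L2norm integral0_eq ?sqrte0// => x _.
by rewrite Normc.normc0 expr0n.
Qed.

Lemma cvg_sqr_L2norm (u : nat -> T -> R[i]) :
  cL2norm mu (u k) @[k --> \oo] --> 0%E ->
  forall e : R, 0 < e -> \forall k \near \oo, (sqr_L2norm (u k) <= e%:E)%E.
Proof.
move=> u0 e e0; have [s s0 sE] : exists2 s, 0 < s & s ^+ 2 = e.
  by exists (Num.sqrt e); rewrite ?sqrtr_gt0// sqr_sqrtr// ltW.
have near : \forall k \near \oo, (cL2norm mu (u k) < s%:E)%E.
  have s0E : (0 < s%:E)%E by rewrite lte_fin.
  exact: u0 _ (open_ereal_lt' s0E).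
apply: filterS near => k; rewrite cL2normE => us.
rewrite -(sqr_sqrte (sqr_L2norm_ge0 _)) -sE EFin_expe.
by rewrite expe2 expe2 lee_pmul ?sqrte_ge0// ltW.
Qed.

End L2_space.

(** * Averages on the tree *)

Section tree_averages.
Variables (R : realType) (p : nat) (p_prime : prime p) (n : nat).
Local Notation Qp := (Qp p_prime).
Local Notation Qpn := ('rV[Qp]_n).
Local Notation pp := (p%:R : Qp).
Local Notation digits := {ffun 'I_n -> 'I_p}.
Local Notation vertex := (vertex p_prime n).
Local Notation q := ((p ^ n)%:R : R).
Local Notation normc := Normc.normc.
Implicit Types (phi : vertex -> R[i]) (v : vertex) (x : Qpn) (k : int).

(* The two families enumerate the same vertices, in a different order. *)
Lemma children_sum (V : nmodType) (phi : vertex -> V) x k :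
  \sum_(a : digits) phi (lower (vtx x k) a) =
  \sum_(a : digits) phi (vtx (x + pp ^ k *: digit_row a) (k + 1)).
Proof.
have /choice[s sP] : forall a : digits, exists b : digits,
    lower (vtx x k) a = vtx (x + pp ^ k *: digit_row b) (k + 1).
  move=> a; rewrite lowerE /=.
  have /pcoset_digit_ex[b bP] : pcoset x k (repr_vtx (vtx x k) + pp ^ k *: digit_row a).
    apply: (pcoset_trans (repr_vtxP x k)); apply: pcoset_child; exact: pcoset_refl.
  by exists b; exact/vtx_eq/pcoset_sym.
have sI : injective s.
  by move=> a b ab; apply: (@lower_inj _ _ _ (vtx x k)); rewrite !sP ab.
by rewrite [RHS](reindex_inj sI); apply: eq_bigr => a _; rewrite sP.
Qed.

Definition child_avg phi v : R[i] := (q^-1)%:C * \sum_(a : digits) phi (lower v a).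

Definition tree_avg (m : nat) phi : vertex -> R[i] := iter m child_avg phi.

Lemma tree_avgSr m phi v : tree_avg m.+1 phi v = child_avg (tree_avg m phi) v.
Proof. by []. Qed.

Lemma child_avgD phi psi v :
  child_avg (fun u => phi u + psi u) v = child_avg phi v + child_avg psi v.
Proof. by rewrite /child_avg big_split mulrDr. Qed.

Lemma child_avgZ (c : R[i]) phi v : child_avg (fun u => c * phi u) v = c * child_avg phi v.
Proof. by rewrite /child_avg -mulr_sumr mulrCA. Qed.

Lemma child_avg_cst (c : R[i]) v : child_avg (fun=> c) v = c.
Proof.
rewrite /child_avg sumr_const card_digits -[c *+ _]mulr_natl mulrA.
have -> : (q^-1)%:C * (p ^ n)%:R = 1 :> R[i].
  by rewrite -(rmorph_nat (real_complex R)) -rmorphM/= mulVf ?rmorph1// q_neq0.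
by rewrite mul1r.
Qed.

Lemma normc_child_avg phi v :
  normc (child_avg phi v) <= q^-1 * \sum_(a : digits) normc (phi (lower v a)).
Proof.
rewrite /child_avg Normc.normcM normc_real ger0_norm ?invr_ge0 ?ler0n//.
by rewrite ler_wpM2l ?invr_ge0 ?ler0n// normc_sum.
Qed.

Lemma normc_tree_avg phi (C : R) m v : (forall u, normc (phi u) <= C) ->
  normc (tree_avg m phi v) <= C.
Proof.
move=> phiC; elim: m v => [|m IH] v //; rewrite tree_avgSr.
apply: (le_trans (normc_child_avg _ _)).
rewrite ler_pdivrMl ?q_gt0// mulr_natl -card_digits -sumr_const.
exact: ler_sum.
Qed.

(** All children of [v] have [v] as upper neighbour, so averaging [eta (upper u)] over them returns
    [eta v]. Averaging the one-step relation repeatedly therefore gives a linear recursion in the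
    depth [m], with [v] fixed. *)
Lemma child_avg_rec (eta : vertex -> R[i]) (a b : R[i]) m v :
  (forall u, child_avg eta u = a * eta u - b * eta (upper u)) ->
  tree_avg m.+2 eta v = a * tree_avg m.+1 eta v - b * tree_avg m eta v.
Proof.
have avgB (c c' : R[i]) f g u : child_avg (fun w => c * f w - c' * g w) u =
    c * child_avg f u - c' * child_avg g u.
  rewrite (child_avgD (fun w => c * f w) (fun w => - (c' * g w))) child_avgZ; congr (_ + _).
  rewrite -mulNr -child_avgZ; congr child_avg; apply/funext => w.
  by rewrite mulNr.
move=> E; elim: m v => [|m IH] v.
  have -> : tree_avg 2 eta v = child_avg (fun u => a * eta u - b * eta (upper u)) v.
    by rewrite /tree_avg/=; congr child_avg; apply/funext => u; rewrite E.
  rewrite avgB; congr (_ - b * _).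
  rewrite -[RHS](child_avg_cst _ v) /child_avg; congr (_ * _).
  by apply: eq_bigr => d _; rewrite upper_lower.
have -> : tree_avg m.+3 eta v =
    child_avg (fun u => a * tree_avg m.+1 eta u - b * tree_avg m eta u) v.
  by rewrite tree_avgSr; congr child_avg; apply/funext => u; rewrite IH.
by rewrite avgB.
Qed.

End tree_averages.

(** * Layers, the equation, and L^2 control of averages *)

Section layers.
Variables (R : realType) (p : nat) (p_prime : prime p) (n : nat).
Local Notation Qp := (Qp p_prime).
Local Notation Qpn := ('rV[Qp]_n).
Local Notation pp := (p%:R : Qp).
Local Notation digits := {ffun 'I_n -> 'I_p}.
Local Notation vertex := (vertex p_prime n).
Local Notation q := ((p ^ n)%:R : R).
Local Notation normc := Normc.normc.
Implicit Types (phi psi : vertex -> R[i]) (v : vertex) (x : Qpn) (k : int).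

Lemma vtx_periodic (T : Type) (phi : vertex -> T) k :
  coset_periodic k (fun x => phi (vtx x k)).
Proof. by move=> x y /vtx_eq ->. Qed.

Lemma cmeasurable_periodic (u : Qpn -> R[i]) k : coset_periodic k u -> cmeasurable u.
Proof.
move=> uP; split; apply: (@measurable_periodic _ _ _ _ _ k) => x y /uP xy;
  by rewrite xy.
Qed.

Lemma cmeasurable_layer phi k : cmeasurable (layer phi k).
Proof. by apply: (@cmeasurable_periodic _ k); exact: vtx_periodic. Qed.

Definition rpow (a : R) : R := p%:R `^ a.

Lemma rpow_gt0 a : 0 < rpow a.
Proof. by rewrite powR_gt0// ltr0n prime_gt0. Qed.

Lemma rpowD a b : rpow (a + b) = rpow a * rpow b.
Proof. by rewrite /rpow powRD//; apply/implyP => _; rewrite pnatr_eq0 -lt0n prime_gt0. Qed.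

Lemma rpow0 : rpow 0 = 1. Proof. exact: powRr0. Qed.

Lemma rpowN a : rpow (- a) = (rpow a)^-1. Proof. exact: powRN. Qed.

Lemma rpow_nat : rpow n%:R = q.
Proof. by rewrite /rpow powR_mulrn ?ler0n// natrX. Qed.

(** The degree [q + 1] of a vertex cancels the terms - p^n - 1 of the mass, leaving the sum p^alpha
    + p^(n - alpha) as eigenvalue of the adjacency operator. *)
Lemma laplacian_eq (alpha : R) phi v :
  laplacian phi v - (mass2 p n alpha)%:C * phi v = 0 <->
  phi (upper v) + \sum_a phi (lower v a) =
    (rpow alpha + rpow (n%:R - alpha))%:C * phi v.
Proof.
rewrite laplacianE big_split/= sumr_const card_digits.
have -> : (mass2 p n alpha)%:C = (rpow alpha + rpow (n%:R - alpha))%:C - (q + 1)%:C :> R[i].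
  by rewrite -rmorphB/= /mass2 natrX opprD addrA.
have -> : (- phi v) *+ p ^ n = - q%:C * phi v.
  by rewrite (rmorph_nat (real_complex R)) mulNrn mulNr mulr_natl.
rewrite (rmorphD (real_complex R) q 1) rmorph1.
set X := phi _; set S := \sum_a _; set C := (rpow alpha + _)%:C.
split=> [E|E].
  apply/eqP; rewrite -subr_eq0; apply/eqP; rewrite -[RHS]E; ring.
transitivity (X + S - C * phi v); last by rewrite E subrr.
ring.
Qed.

Variables (mu : {measure set Qpn -> \bar R}) (mu_haar : haar mu).

(* Averages [|z| <= t + |z|^2 / t] over the descendants, which have equal measure. *)
Lemma normc_tree_avg_sqr phi x k m (t : R) : 0 < t ->
  ((normc (tree_avg m phi (vtx x k)))%:E <= t%:E + (t^-1 * q ^ k)%:E *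
    \int[mu]_(y in pcoset x k) (normc (phi (vtx y (k + m%:Z)%R)) ^+ 2)%:E)%E.
Proof.
move=> t0; have q0 := q_gt0 R p_prime n.
have mf l : measurable_fun setT (fun y => (normc (phi (vtx y l)) ^+ 2)%:E).
  exact: measurable_sqr_normc (cmeasurable_layer phi l).
have f0 l y : (0 <= (normc (phi (vtx y l)) ^+ 2)%:E)%E by rewrite lee_fin sqr_ge0.
elim: m x k => [|m IH] x k.
  rewrite addr0 (eq_integral (cst (normc (phi (vtx x k)) ^+ 2)%:E)); last first.
    by move=> y /[!inE] /vtx_eq <-.
  rewrite integral_cst; last exact: measurable_pcoset.
  rewrite (haar_pcoset mu_haar) -!EFinM -EFinD lee_fin -[tree_avg 0 phi _]/(phi (vtx x k)).
  set z := normc _; have -> : t^-1 * q ^ k * (z ^+ 2 * q ^ (- k)) = t^-1 * z ^+ 2.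
    by rewrite mulrACA -expfzDr ?gt_eqF// subrr expr0z mulr1.
  rewrite -(ler_pM2l t0) mulrDr mulrA mulfV ?gt_eqF// mul1r.
  have := sqr_ge0 (t - z); have := sqr_ge0 t; have := normc_ge0 (phi (vtx x k)); rewrite -/z; nra.
apply: (@le_trans _ _ (q^-1 * \sum_(a : digits) normc (tree_avg m phi (lower (vtx x k) a)))%:E).
  by rewrite lee_fin normc_child_avg.
rewrite (children_sum (fun u => normc (tree_avg m phi u))) EFinM -sumEFin.
set J := (\int[mu]_(y in _) _)%E.
have -> : (t%:E + (t^-1 * q ^ k)%:E * J = (q^-1)%:E * \sum_(a : digits) (t%:E +
    (t^-1 * q ^ (k + 1))%:E * \int[mu]_(y in pcoset (x + pp ^ k *: digit_row a)%R (k + 1)%R)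
      (normc (phi (vtx y (k + 1 + m%:Z)%R)) ^+ 2)%:E))%E.
  rewrite big_split/= sum_digits_cst -EFinM -ge0_sume_distrr; last first.
    by move=> a _; exact: integral_ge0.
  have -> : (k + 1 + m%:Z = k + m.+1%:Z)%R by lia.
  rewrite -ge0_integral_children// -/J.
  have : (0 <= J)%E by exact: integral_ge0.
  move: J => J J0; rewrite ge0_muleDr; last 2 first.
  - by rewrite lee_fin mulr_ge0 ?ltW.
  - by rewrite mule_ge0// lee_fin mulr_ge0 ?invr_ge0 ?exprz_ge0 ?ltW.
  rewrite !muleA -!EFinM mulrA mulVf ?gt_eqF// mul1r; congr (_ + _%:E * _)%E.
  by rewrite [RHS]mulrCA expfzDr ?gt_eqF// expr1z (mulrC _ q) mulKf ?gt_eqF.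
apply: lee_wpmul2l; first by rewrite lee_fin invr_ge0 ltW.
by apply: lee_sum => a _; exact: IH.
Qed.

End layers.
Arguments rpow {R} p a.

(** * Uniqueness of the solution *)

Section uniqueness.
Variables (R : realType) (p : nat) (p_prime : prime p) (n : nat).
Local Notation Qp := (Qp p_prime).
Local Notation Qpn := ('rV[Qp]_n).
Local Notation vertex := (vertex p_prime n).
Local Notation q := ((p ^ n)%:R : R).
Local Notation normc := Normc.normc.
Local Notation e := (rpow p).
Variables (mu : {measure set Qpn -> \bar R}) (mu_haar : haar mu).
Implicit Types (phi psi eta : vertex -> R[i]) (v : vertex) (x : Qpn) (k : int).

(** A constant [c] contributes |c|^2 q^j over a coset of height - j. As [1 <= n], q^j exceeds j, so
    a finite L^2 norm leaves only [c = 0]. *)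
Lemma L2_layer_cst phi k : (1 <= n)%N -> L2 mu (layer phi k) ->
  (forall x y, phi (vtx x k) = phi (vtx y k)) -> forall x, phi (vtx x k) = 0.
Proof.
move=> n1 /L2P[mphi phioo] phic x; have q0 := q_gt0 R p_prime n.
set c := phi (vtx x k); apply/eqP; rewrite -normc_eq0 -sqrf_eq0; apply/eqP.
pose r := fine (sqr_L2norm mu (layer phi k)).
have rE : sqr_L2norm mu (layer phi k) = r%:E.
  by rewrite fineK// ge0_fin_numE// sqr_L2norm_ge0.
have bound (j : nat) : normc c ^+ 2 * j%:R <= r.
  have : (\int[mu]_(y in pcoset x (- j%:Z)) cst (normc c ^+ 2)%:E y <= r%:E)%E.
    rewrite -rE.
    apply: (@le_trans _ _ (\int[mu]_(y in pcoset x (- j%:Z)) (normc (layer phi k y) ^+ 2)%:E)%E).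
      rewrite le_eqVlt; apply/orP; left; apply/eqP/eq_integral => y _.
      by rewrite /layer (phic y x).
    apply: ge0_subset_integral => //; first exact: measurable_pcoset.
      exact: measurable_sqr_normc.
    by move=> y _; rewrite lee_fin sqr_ge0.
  rewrite integral_cst; last exact: measurable_pcoset.
  rewrite (haar_pcoset mu_haar) opprK -EFinM lee_fin; apply: le_trans.
  rewrite ler_wpM2l ?sqr_ge0// -exprnP -natrX ler_nat -expnM ltnW//.
  rewrite (leq_ltn_trans (leq_pmull j n1))// ltn_expl//; exact: prime_gt1.
apply/eqP; rewrite eq_le sqr_ge0 andbT leNgt; apply/negP => c0.
have := bound (Num.bound (r / normc c ^+ 2)).
rewrite -ler_pdivlMl// mulrC leNgt => /negP; apply; apply: archi_boundP.
by rewrite mulr_ge0 ?invr_ge0 ?sqr_ge0// fine_ge0// sqr_L2norm_ge0.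
Qed.

Lemma tree_avg_cvg0 eta v :
  (forall t : R, 0 < t -> \forall k \near \oo,
    (sqr_L2norm mu (layer eta k%:Z) <= t%:E)%E) ->
  ccvg (fun m => tree_avg m eta v) 0.
Proof.
move=> eta0; have q0 := q_gt0 R p_prime n.
have := vtxP v; move: (height v) => k [x ->].
pose C : R := 1 + q ^ k; have C0 : 0 < C by rewrite addr_gt0// exprz_gt0.
(* With squared norms at most [t ^+ 2], the bound on the average becomes t + t^(-1) q^k t^2 = t C =
   s; this dictates both [C] and [t]. *)
apply/cvgrPdist_le => s s0; pose t := s / C.
have t0 : 0 < t by rewrite divr_gt0.
have [N _ HN] := eta0 (t ^+ 2) (exprn_gt0 2 t0).
exists (N + absz k)%N => // m /= Nm; rewrite sub0r normrN subr0 ger0_norm ?normc_ge0//.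
have [j jE] : exists j : nat, k + m%:Z = j%:Z by exists (absz (k + m%:Z)); lia.
rewrite -lee_fin; apply: (le_trans (normc_tree_avg_sqr mu_haar eta x k m t0)).
have J : (\int[mu]_(y in pcoset x k) (normc (eta (vtx y (k + m%:Z)%R)) ^+ 2)%:E <= (t ^+ 2)%:E)%E.
  rewrite jE; apply: le_trans (HN j _); last by rewrite /=; lia.
  apply: ge0_subset_integral => //; first exact: measurable_pcoset.
    exact: measurable_sqr_normc (cmeasurable_layer eta _).
  by move=> y _; rewrite lee_fin sqr_ge0.
apply: (@le_trans _ _ (t%:E + (t^-1 * q ^ k)%:E * (t ^+ 2)%:E)%E).
  by rewrite leeD2l// lee_wpmul2l// lee_fin mulr_ge0 ?invr_ge0 ?exprz_ge0 ?ltW.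
rewrite -EFinM -EFinD lee_fin le_eqVlt; apply/orP; left; apply/eqP.
rewrite expr2 mulrC -mulrA (mulrA t t^-1) mulfV ?gt_eqF// mul1r.
by rewrite -[X in X + _]mulr1 -mulrDr -/C /t divfK// gt_eqF.
Qed.

(* The averages M_m of eta over the descendants of v, m levels below, satisfy
   M_(m + 2) = (1 + rho) M_(m + 1) - rho M_m, so that M_(m + 1) - rho M_m does not
   depend on m; it vanishes because M_m tends to 0. *)
Lemma harmonic_upper eta (rho : R) :
  (forall v, child_avg eta v = (1 + rho)%:C * eta v - rho%:C * eta (upper v)) ->
  (forall v, ccvg (fun m => tree_avg m eta v) 0) ->
  forall v, eta v = rho%:C * eta (upper v).
Proof.
move=> E lim0 v.
have y_cst m : tree_avg m.+1 eta v - rho%:C * tree_avg m eta v =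
    child_avg eta v - rho%:C * eta v.
  elim: m => [//|m <-]; rewrite (child_avg_rec m v E) rmorphD rmorph1/=; ring.
have : child_avg eta v - rho%:C * eta v = 0.
  apply: (ccvg_unique (u := fun m => tree_avg m.+1 eta v + (- rho%:C) * tree_avg m eta v)).
    by apply: ccvg_near (ccvg_cst _); apply: nearW => m; rewrite mulNr y_cst.
  rewrite -[0]addr0 -[X in _ + X](mulr0 (- rho%:C)).
  by apply: ccvgD; [exact: (ccvg_shift (fun m => tree_avg m eta v) 0).2|exact: ccvgMl].
rewrite E rmorphD rmorph1/= => H; apply/eqP; rewrite -subr_eq0 -[X in _ == X]H.
by apply/eqP; ring.
Qed.

(* Hence siblings have equal values, and two vertices of a layer have a common ancestor. *)
Lemma upper_determined eta (rho : R) :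
  (forall v, eta v = rho%:C * eta (upper v)) ->
  forall k x y, eta (vtx x k) = eta (vtx y k).
Proof.
move=> E k x y; have [m /vtx_eq xy] := pcoset_common x y.
have [km|mk] := leP k (- m%:Z); first by rewrite (vtx_le km xy).
have [j ->] : exists j : nat, k = - m%:Z + j%:Z by exists (absz (k + m%:Z)); lia.
elim: j => [|j IH]; first by rewrite addr0 xy.
rewrite E [RHS]E !upper_vtx.
have -> : - m%:Z + j.+1%:Z - 1 = - m%:Z + j%:Z by lia.
by rewrite IH.
Qed.

Lemma solution_unique (alpha : R) f phi psi : (1 <= n)%N ->
  solution mu alpha f phi -> solution mu alpha f psi -> phi = psi.
Proof.
move=> n1 [phiL2 phiE [_ fL2 phif]] [psiL2 psiE [_ _ psif]].
(* The weight divides the roots p^(alpha - n) and p^(- alpha) by the first of them, so they become 1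
   and [rho]; hence the coefficients [1 + rho] and [rho] in [etaE]. *)
pose w v : R := e ((n%:R - alpha) * (height v)%:~R).
pose delta v := phi v - psi v; pose eta v := (w v)%:C * delta v.
pose rho : R := e (n%:R - 2 * alpha).
have w0 v : (w v)%:C != 0 :> R[i].
  by rewrite fmorph_eq0 gt_eqF// (rpow_gt0 p_prime).
have deltaE v : delta (upper v) + \sum_a delta (lower v a) =
    (e alpha + e (n%:R - alpha))%:C * delta v.
  have := (laplacian_eq _ _ _).1 (phiE v); have := (laplacian_eq _ _ _).1 (psiE v) => Hpsi Hphi.
  by rewrite /delta mulrBr -Hphi -Hpsi sumrB; ring.
have etaE v : child_avg eta v = (1 + rho)%:C * eta v - rho%:C * eta (upper v).
  pose c : R := e (n%:R - alpha).
  have wl a : w (lower v a) = c * w v.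
    by rewrite /w /= intrD mulrDr mulr1 (rpowD p_prime) mulrC.
  have wu : w (upper v) = c^-1 * w v.
    by rewrite /w /= intrD mulrDr mulrN1 (rpowD p_prime) rpowN mulrC.
  have c0 : c != 0 by rewrite gt_eqF// (rpow_gt0 p_prime).
  have qE : q = e alpha * c by rewrite -(rpowD p_prime) addrC subrK rpow_nat.
  have ea0 : e alpha != 0 by rewrite gt_eqF// (rpow_gt0 p_prime).
  have rhoE : rho = c / e alpha.
    by rewrite -rpowN -(rpowD p_prime); congr e; ring.
  rewrite /child_avg /eta; under eq_bigr do rewrite wl.
  rewrite -mulr_sumr wu.
  have -> : \sum_a delta (lower v a) = (e alpha + c)%:C * delta v - delta (upper v).
    by rewrite -deltaE addrC addKr.
  rewrite qE rhoE; move: (delta v) (delta (upper v)) => X Y; set W := w v; set A := e alpha.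
  have M (a b : R) (z : R[i]) : a%:C * (b%:C * z) = (a * b)%:C * z.
    by rewrite mulrA -rmorphM.
  rewrite !mulrBr !M; congr (_%:C * _ - _%:C * _).
    by field; rewrite c0 ea0.
  by field; rewrite c0 ea0.
(* Both renormalized solutions tend to the same [f], which drops out of the difference. *)
have etaL2 (k : nat) : layer eta k%:Z =
    (fun x => (renormalized alpha phi k x - f x) - (renormalized alpha psi k x - f x)).
  apply/funext => x; rewrite /layer /eta /delta /renormalized /w /= /layer /rpow.
  by rewrite mulrBr; ring.
have mren phi' (k : nat) : L2 mu f -> cmeasurable (fun x => renormalized alpha phi' k x - f x).
  move=> /L2P[mf _]; apply: cmeasurableD.
    by apply: cmeasurableM; [exact: cmeasurable_cst|exact: cmeasurable_layer].
  have := cmeasurableM (cmeasurable_cst _ (-1)) mf.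
  by under eq_fun do rewrite mulN1r.
have eta0 (t : R) : 0 < t -> \forall k \near \oo, (sqr_L2norm mu (layer eta k%:Z) <= t%:E)%E.
  move=> t0; have t4 : 0 < t / 4 by rewrite divr_gt0.
  apply: filterS2 (cvg_sqr_L2norm phif t4) (cvg_sqr_L2norm psif t4) => k Hphi Hpsi.
  rewrite etaL2; apply: (le_trans (sqr_L2normB _ (mren phi k fL2) (mren psi k fL2))).
  apply: (@le_trans _ _ (2%:E * ((t / 4)%:E + (t / 4)%:E))%E).
    by rewrite lee_wpmul2l// leeD.
  by rewrite -EFinD -EFinM lee_fin; lra.
have upE := harmonic_upper etaE (fun v => tree_avg_cvg0 v eta0).
have det := upper_determined upE.
(* On one layer [w] is a nonzero constant, so [delta] is constant there as well. Layers of negative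
   height are included, since every layer of a solution is in L^2. *)
apply/funext => v; have [x ->] := vtxP v; move: (height v) => k.
apply/eqP; rewrite -subr_eq0; apply/eqP.
have wk y : w (vtx y k) = w (vtx x k) by [].
have : delta (vtx x k) = 0; last by [].
apply: (L2_layer_cst n1) => [|y z].
  apply/L2P; have /L2P[mphi phioo] := phiL2 k; have /L2P[mpsi psioo] := psiL2 k.
  split; first exact: cmeasurable_layer.
  apply: (le_lt_trans (sqr_L2normB mu mphi mpsi)).
  by rewrite lte_mul_pinfty// lte_add_pinfty.
by apply: (mulfI (w0 (vtx y k))); rewrite [in RHS](wk y) -(wk z); exact: det.
Qed.

End uniqueness.

(** * The explicit solution *)

Section geometric_bound.
Variable R : realType.
Implicit Types (t : nat -> R[i]) (A r : R).
Local Notation normc := Normc.normc.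

Lemma geometric_sum_le A r N : 0 <= A -> 0 <= r < 1 ->
  \sum_(m < N) A * r ^+ m <= A / (1 - r).
Proof.
move=> A0 /andP[r0 r1]; have r1' : 0 < 1 - r by rewrite subr_gt0.
rewrite -mulr_sumr ler_wpM2l// -[leRHS]mul1r ler_pdivlMr//.
by rewrite mulrC -[1 - r]opprB mulNr -subrX1 opprB gerBl exprn_ge0.
Qed.

(** Real and imaginary parts converge absolutely; the bound holds for partial sums and passes to the
    limit with an error [e]. *)
Lemma ccvg_geometric t A r : 0 <= r < 1 -> (forall m, normc (t m) <= A * r ^+ m) ->
  exists2 l, ccvg (fun N => \sum_(m < N) t m) l & normc l <= A / (1 - r).
Proof.
move=> r01 tA; have /andP[r0 r1] := r01.
have A0 : 0 <= A by have := tA 0; rewrite expr0 mulr1; exact: le_trans (normc_ge0 _).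
have C (P : R[i] -> R) : (forall z, `|P z| <= normc z) -> cvgn (series (fun m => P (t m))).
  move=> Pn; apply: normed_cvg; apply: (@series_le_cvg _ _ (geometric A r)).
  - by move=> m; exact: normr_ge0.
  - by move=> m; rewrite /geometric/= mulr_ge0// exprn_ge0.
  - by move=> m; exact: le_trans (Pn _) (tA m).
  - by apply: is_cvg_geometric_series; rewrite ger0_norm.
have ReS N : complex.Re (\sum_(m < N) t m) = series (fun m => complex.Re (t m)) N.
  by rewrite /series/= big_mkord; elim/big_rec2: _ => // m x y _ <-; rewrite ReD.
have ImS N : complex.Im (\sum_(m < N) t m) = series (fun m => complex.Im (t m)) N.
  by rewrite /series/= big_mkord; elim/big_rec2: _ => // m x y _ <-; rewrite ImD.
pose l := limn (series (fun m => complex.Re (t m))) +i* limn (series (fun m => complex.Im (t m))).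
have tl : ccvg (fun N => \sum_(m < N) t m) l.
  apply/ccvgP; split; [under eq_fun do rewrite ReS|under eq_fun do rewrite ImS].
    exact: C (@Re_le_normc R).
  exact: C (@Im_le_normc R).
exists l => //; apply/ler_addgt0Pl => e e0.
have [N _ /(_ N (leqnn N))] := (cvgrPdist_le _ _).1 tl e e0.
rewrite /= sub0r normrN ger0_norm ?normc_ge0// => Nl.
apply: (@le_trans _ _ (normc ((l - \sum_(m < N) t m) + \sum_(m < N) t m))).
  by rewrite subrK.
rewrite (le_trans (le_normcD _ _))// lerD//.
  by rewrite -normcN opprB.
apply: le_trans (normc_sum _ _ _) _; apply: le_trans (geometric_sum_le N A0 r01).
by apply: ler_sum => m _; exact: tA.
Qed.

End geometric_bound.

(** * The fractional potential and the explicit formula *)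

Section riesz_potential.
Variables (R : realType) (p : nat) (p_prime : prime p) (n : nat).
Local Notation vertex := (vertex p_prime n).
Local Notation q := ((p ^ n)%:R : R).
Local Notation normc := Normc.normc.
Local Notation e := (rpow p).
Implicit Types (F : vertex -> R[i]) (s : R) (v : vertex).

(** When F consists of averages, a difference of consecutive layers is the part of the function with
    frequencies of norm exactly p^k, on which D^s acts as multiplication by p^(s k). *)
Definition jump s F v : R[i] := (e (s * (height v)%:~R))%:C * (F v - F (upper v)).

(* On the layer of height k this is \sum_(j <= k) p^(s j) (F_j - F_(j - 1)); when F
   consists of the averages of f, it is the average of D^s f. *)
Definition fractional s F v : R[i] :=
  xget 0 [set l | ccvg (fun N => \sum_(m < N) jump s F (iter m (@upper _ _ _) v)) l].

Lemma height_iter_upper m v : height (iter m (@upper _ _ _) v) = height v - m%:Z.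
Proof.
elim: m => [|m IH]; first by rewrite subr0.
by rewrite iterS [LHS]/= IH; lia.
Qed.

Variables (s : R) (s_gt0 : 0 < s).

Lemma rpowN_lt1 : 0 <= e (- s) < 1.
Proof.
rewrite ltW ?(rpow_gt0 p_prime)//= rpowN invf_lt1 ?(rpow_gt0 p_prime)//.
have : (1 : R) `^ s < p%:R `^ s.
  by apply: gt0_ltr_powR; rewrite ?nnegrE ?ler0n// ltr1n prime_gt1.
by rewrite powR1.
Qed.

Lemma normc_jump F (C : R) m v : (forall u, normc (F u) <= C) ->
  normc (jump s F (iter m (@upper _ _ _) v)) <=
  (2 * C * e (s * (height v)%:~R)) * e (- s) ^+ m.
Proof.
move=> FC; rewrite /jump Normc.normcM normc_real height_iter_upper.
rewrite ger0_norm; last exact/ltW/(rpow_gt0 p_prime).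
have -> : e (s * (height v - m%:Z)%:~R) = e (s * (height v)%:~R) * e (- s) ^+ m.
  rewrite intrB mulrBr (rpowD p_prime) -mulNr; congr (_ * _).
  by rewrite /rpow powRrM powR_mulrn ?powR_ge0.
have -> : 2 * C * e (s * (height v)%:~R) * e (- s) ^+ m =
  e (s * (height v)%:~R) * e (- s) ^+ m * (2 * C) by ring.
rewrite ler_wpM2l ?mulr_ge0 ?exprn_ge0 ?(ltW (rpow_gt0 p_prime _))//.
apply: (le_trans (le_normcD _ _)); rewrite normcN.
by have := FC (iter m (@upper _ _ _) v); have := FC (upper (iter m (@upper _ _ _) v)); lra.
Qed.

Variables (F : vertex -> R[i]) (C : R) (FC : forall v, normc (F v) <= C).

Lemma fractionalP v :
  ccvg (fun N => \sum_(m < N) jump s F (iter m (@upper _ _ _) v)) (fractional s F v).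
Proof.
apply: (@xgetPex _ 0 [set l | ccvg
  (fun N => \sum_(m < N) jump s F (iter m (@upper _ _ _) v)) l]).
have [l Hl _] := ccvg_geometric rpowN_lt1 (fun m => normc_jump m v FC).
by exists l.
Qed.

Lemma normc_fractional v :
  normc (fractional s F v) <= 2 * C * e (s * (height v)%:~R) / (1 - e (- s)).
Proof.
have [l Hl ?] := ccvg_geometric rpowN_lt1 (fun m => normc_jump m v FC).
by rewrite (ccvg_unique (fractionalP v) Hl).
Qed.

Lemma fractional_upper v : fractional s F v = jump s F v + fractional s F (upper v).
Proof.
apply: (ccvg_unique (u := fun N => \sum_(m < N.+1) jump s F (iter m (@upper _ _ _) v))).
  exact: (ccvg_shift _ _).2 (fractionalP v).
under eq_fun do rewrite big_ord_recl.
apply: ccvgD; first exact: ccvg_cst.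
apply: ccvg_near (fractionalP _); apply: nearW => N.
by apply: eq_bigr => m _; rewrite lift0 iterSr.
Qed.

Hypothesis F_mean : forall v, child_avg F v = F v.

(** Each child exceeds [v] by its own jump, and the jumps over the children average to 0 by the mean
    value property of [F]. *)
Lemma child_avg_fractional v : child_avg (fractional s F) v = fractional s F v.
Proof.
pose c : R[i] := (e (s * (height v + 1)%:~R))%:C.
transitivity (child_avg (fun u => c * (F u + (- F v)) + fractional s F v) v).
  rewrite /child_avg; congr (_ * _); apply: eq_bigr => a _.
  by rewrite fractional_upper /jump upper_lower.
rewrite (child_avgD (fun u => c * (F u + (- F v)))) child_avg_cst child_avgZ.
by rewrite child_avgD child_avg_cst F_mean subrr mulr0 add0r.
Qed.

Variable alpha : R.
Hypothesis sE : s = 2 * alpha - n%:R.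

Definition poisson v : R[i] :=
  (e ((alpha - n%:R) * (height v)%:~R))%:C * F v -
  (e (- alpha * (height v)%:~R - s))%:C * fractional s F v.

(** Here [x], [y] are the values of F at [v] and above it, and [z] is that of the potential above
    [v]. The two sides differ by [(Y * a * a * W - X * c * c) * (x - y)]: the hypothesis expresses
    the cancellation of the jump. *)
Let poisson_identity (K : comNzRingType) (X Y a c W x y z : K) :
  Y * a * a * W = X * c * c ->
  X * c * c * y - Y * a * a * z + (X * (a * c * x) - Y * (a * c * (W * (x - y) + z))) =
  (a + c) * (X * c * x - Y * a * (W * (x - y) + z)).
Proof.
move=> rel; apply/eqP; rewrite -subr_eq0; apply/eqP.
transitivity ((Y * a * a * W - X * c * c) * (x - y)); first by ring.
by rewrite rel subrr mul0r.
Qed.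

Lemma poisson_laplacian v : laplacian poisson v - (mass2 p n alpha)%:C * poisson v = 0.
Proof.
apply/laplacian_eq.
have sumq G : child_avg G v = G v -> \sum_a G (lower v a) = q%:C * G v.
  by move=> <-; rewrite /child_avg mulrA -rmorphM mulfV ?rmorph1 ?mul1r// q_neq0.
rewrite /poisson; have hl a : height (lower v a) = height v + 1 by [].
have hu : height (upper v) = height v - 1 by [].
under eq_bigr do rewrite hl.
rewrite hu sumrB -!mulr_sumr (sumq _ (F_mean v)) (sumq _ (child_avg_fractional v)).
rewrite (fractional_upper v) /jump.
move: (F v) (F (upper v)) (fractional s F (upper v)) => x y z.
pose h : R := (height v)%:~R; pose a := e alpha; pose c := e (n%:R - alpha).
(* [X] and [Y] are the two weights at the height of the children; going up by one level multiplies
   them by [c] and [a] respectively. *)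
pose X := e ((alpha - n%:R) * (h + 1)); pose Y := e (- alpha * (h + 1) - s).
pose W := e (s * h).
have q_ac : q = a * c by rewrite -rpow_nat -(rpowD p_prime); congr e; ring.
rewrite !intrD !mulrNz -/h.
have -> : e ((alpha - n%:R) * (h - 1)) = X * c * c.
  by rewrite -!(rpowD p_prime); congr e; ring.
have -> : e (- alpha * (h - 1) - s) = Y * a * a.
  by rewrite -!(rpowD p_prime); congr e; ring.
have -> : e ((alpha - n%:R) * h) = X * c.
  by rewrite -!(rpowD p_prime); congr e; ring.
have -> : e (- alpha * h - s) = Y * a.
  by rewrite -!(rpowD p_prime); congr e; ring.
have rel : Y * a * a * W = X * c * c.
  by rewrite -!(rpowD p_prime); congr e; rewrite sE; ring.
rewrite -/X -/Y -/W -/a -/c q_ac.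
have {rel} : Y%:C * a%:C * a%:C * W%:C = X%:C * c%:C * c%:C :> R[i].
  by rewrite -!rmorphM/= rel.
rewrite !rmorphD !rmorphM /=.
exact: poisson_identity.
Qed.

Lemma renormalized_poisson (k : nat) x : renormalized alpha poisson k x =
  layer F k%:Z x - (e (- s * (k%:R + 1)))%:C * layer (fractional s F) k%:Z x.
Proof.
rewrite /renormalized /poisson /layer /= mulrBr !mulrA -!rmorphM.
rewrite -/(e _) -!(rpowD p_prime); congr (_ - _%:C * _).
  have -> : (n%:R - alpha) * k%:R + (alpha - n%:R) * (k%:Z)%:~R = 0 by rewrite -pmulrn; ring.
  by rewrite rpow0 mul1r.
by congr e; rewrite sE -pmulrn; ring.
Qed.

End riesz_potential.
(** * Fourier transforms of the layers *)

Section series_integral.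
Context d (T : measurableType d) (R : realType) (mu : {measure set T -> \bar R}).
Local Notation normc := Normc.normc.

Lemma nneseries_geometric_le (u : nat -> \bar R) (A r : R) : 0 <= r < 1 ->
  (forall m, (0 <= u m <= (A * r ^+ m)%:E)%E) ->
  (\sum_(m <oo) u m <= (A / (1 - r))%:E)%E.
Proof.
move=> r01 uA; have A0 : 0 <= A.
  by have /andP[u0 uA0] := uA 0; rewrite expr0 mulr1 in uA0; rewrite -lee_fin (le_trans u0).
apply: lime_le; first by apply: is_cvg_nneseries => m _ _; have /andP[] := uA m.
apply: nearW => N; apply: (@le_trans _ _ (\sum_(0 <= m < N) (A * r ^+ m)%:E)%E).
  by apply: lee_sum => m _; have /andP[] := uA m.
by rewrite sumEFin lee_fin big_mkord geometric_sum_le.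
Qed.

(** The sum of the norms serves as majorant: the pointwise bounds keep it finite everywhere, the L^1
    bounds make it integrable, and dominated convergence applies to the partial sums. *)
Lemma cintegral_series (t : nat -> T -> R[i]) (l : T -> R[i]) (A B r : R) :
  0 <= r < 1 -> (forall m, cmeasurable (t m)) -> cmeasurable l ->
  (forall m x, normc (t m x) <= A * r ^+ m) ->
  (forall m, (\int[mu]_x (normc (t m x))%:E <= (B * r ^+ m)%:E)%E) ->
  (forall x, ccvg (fun N => \sum_(m < N) t m x) (l x)) ->
  cintegrable mu l /\ ccvg (fun N => \sum_(m < N) cintegral mu (t m)) (cintegral mu l).
Proof.
move=> r01 mt ml tA tB tl.
pose H x := (\sum_(m <oo) (normc (t m x))%:E)%E.
have Hfin x : H x \is a fin_num.
  have HA : (H x <= (A / (1 - r))%:E)%E.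
    by apply: nneseries_geometric_le r01 _ => m; rewrite !lee_fin normc_ge0 tA.
  rewrite ge0_fin_numE ?(le_lt_trans HA) ?ltry//.
  by apply: nneseries_ge0 => m _ _; rewrite lee_fin normc_ge0.
have mH : measurable_fun setT H.
  apply: ge0_emeasurable_sum => [m x _ _|m _]; first by rewrite lee_fin normc_ge0.
  exact/measurable_EFinP/measurable_normc.
have iH : mu.-integrable setT (EFin \o (fine \o H)).
  apply: (eq_integrable measurableT H); first by move=> x _ /=; rewrite fineK.
  apply/integrableP; split=> //.
  under eq_integral => x _.
    rewrite gee0_abs; last by apply: nneseries_ge0 => m _ _; rewrite lee_fin normc_ge0.
    over.
  rewrite /H integral_nneseries//; last 2 first.
  - by move=> m; exact/measurable_EFinP/measurable_normc.
  - by move=> m x _; rewrite lee_fin normc_ge0.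
  apply: le_lt_trans (ltry (B / (1 - r))); apply: nneseries_geometric_le r01 _ => m.
  by rewrite tB andbT integral_ge0// => x _; rewrite lee_fin normc_ge0.
have it m : cintegrable mu (t m).
  apply: (cintegrable_dom (mt m) (h := fun x => normc (t m x))) => //.
  apply/integrableP; split; first exact/measurable_EFinP/measurable_normc.
  under eq_integral => x _ do rewrite gee0_abs ?lee_fin ?normc_ge0//.
  exact: le_lt_trans (tB m) (ltry _).
have [//|||il sl] := dominated_ccvg (u := fun N x => \sum_(m < N) t m x) _ ml iH.
- by move=> N; apply: cmeasurable_sum.
- move=> N x; apply: (le_trans (normc_sum _ _ _)).
  rewrite -lee_fin /= fineK// -sumEFin -(big_mkord xpredT (fun m => (normc (t m x))%:E)).
  by apply: nneseries_lim_ge => m _ _; rewrite lee_fin normc_ge0.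
- exact: tl.
split=> //; apply: ccvg_near sl; apply: nearW => N.
by rewrite (cintegral_sum _ (F := fun m : 'I_N => t m)).
Qed.

End series_integral.

Section fourier_layers.
Variables (R : realType) (p : nat) (p_prime : prime p) (n : nat).
Local Notation Qp := (Qp p_prime).
Local Notation Qpn := ('rV[Qp]_n).
Local Notation pp := (p%:R : Qp).
Local Notation digits := {ffun 'I_n -> 'I_p}.
Local Notation vertex := (vertex p_prime n).
Local Notation q := ((p ^ n)%:R : R).
Local Notation normc := Normc.normc.
Local Notation e := (rpow p).
Variables (mu : {measure set Qpn -> \bar R}) (mu_haar : haar mu).
Implicit Types (F : vertex -> R[i]) (u : Qpn -> R[i]) (w x xi : Qpn) (k : int).

Lemma cintegrable_translate w u : cintegrable mu u ->
  cintegrable mu (fun x => u (w + x)).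
Proof.
move=> [ur ui]; split.
  exact: (haar_integrable mu_haar w ur).
exact: (haar_integrable mu_haar w ui).
Qed.

Lemma cintegral_translate w u : cintegrable mu u ->
  cintegral mu (fun x => u (w + x)) = cintegral mu u.
Proof.
move=> [ur ui]; rewrite /cintegral /Rintegral; congr (fine _ +i* fine _).
  exact: (haar_integral mu_haar w ur).
exact: (haar_integral mu_haar w ui).
Qed.

Lemma cmeasurable_chi xi : cmeasurable (fun x => chi R (dot x xi)).
Proof.
have [m /pcosetP xm] := pcoset_common 0 xi.
apply: (@cmeasurable_periodic _ _ _ _ _ m%:Z); apply: chi_dot_periodic => i.
by have := xm i; rewrite mxE subr0 opprK.
Qed.

Lemma cintegrable_chi u xi : cintegrable mu u ->
  cintegrable mu (fun x => u x * chi R (dot x xi)).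
Proof.
move=> iu; apply: (cintegrable_bounded (C := 1) iu (cmeasurable_chi xi)) => x.
by rewrite normc_chi.
Qed.

Section harmonic.
Variables (F : vertex -> R[i]) (F_mean : forall v, child_avg F v = F v).

(** Writes a layer as an average of translates of the next one, by shifts independent of [x], so
    that translation invariance of the integral can be used. *)
Lemma layer_children k x : layer F k x =
  (q^-1)%:C * \sum_(a : digits) layer F (k + 1) (pp ^ k *: digit_row a + x).
Proof.
rewrite /layer -F_mean /child_avg children_sum; congr (_ * _).
by apply: eq_bigr => a _; rewrite addrC.
Qed.

Lemma le_integral_normc_layer k :
  (\int[mu]_x (normc (layer F k x))%:E <= \int[mu]_x (normc (layer F (k + 1) x))%:E)%E.
Proof.
have q0 := q_gt0 R p_prime n.
have mF l : measurable_fun setT (fun x => (normc (layer F l x))%:E).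
  exact/measurable_EFinP/measurable_normc/cmeasurable_layer.
have mFt w l : measurable_fun setT (fun x => (normc (layer F l (w + x)%R))%:E).
  exact: (measurableT_comp (mF l) (measurable_translation w)).
apply: (@le_trans _ _ (\int[mu]_x ((q^-1)%:E * \sum_(a : digits)
    (normc (layer F (k + 1) (pp ^ k *: digit_row a + x)%R))%:E))%E).
  apply: ge0_le_integral => //.
  - by move=> x _; rewrite lee_fin normc_ge0.
  - by apply: measurable_funeM; apply: emeasurable_sum => a; exact: mFt.
  - move=> x _; rewrite sumEFin -EFinM lee_fin layer_children Normc.normcM normc_real.
    rewrite ger0_norm ?invr_ge0 ?(ltW q0)// ler_wpM2l ?invr_ge0 ?(ltW q0)//.
    exact: normc_sum.
rewrite ge0_integralZl_EFin//; last 2 first.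
- by move=> x _; apply: sume_ge0 => a _; rewrite lee_fin normc_ge0.
- by apply: emeasurable_sum => a; exact: mFt.
rewrite ge0_integral_sum//; last first.
  by move=> a x _; rewrite lee_fin normc_ge0.
under eq_bigr => a _.
  rewrite (ge0_haar_integral mu_haar _ (h := fun x => (normc (layer F (k + 1) x))%:E))//;
    last by move=> x; rewrite lee_fin normc_ge0.
  over.
by rewrite sum_digits_cst muleA -EFinM mulVf ?gt_eqF// mul1e.
Qed.

Variables (f : Qpn -> R[i]) (K : int) (f_int : cintegrable mu f).
Hypothesis FK : forall k, K <= k -> layer F k = f.

Lemma integral_normc_layer_le k :
  (\int[mu]_x (normc (layer F k x))%:E <= \int[mu]_x (normc (f x))%:E)%E.
Proof.
have [Kk|/ltW kK] := leP K k; first by rewrite FK.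
have [j ->] : exists j : nat, k = K - j%:Z by exists (absz (K - k)); lia.
elim: j => [|j IH]; first by rewrite subr0 FK.
apply: le_trans (le_integral_normc_layer _) _.
by have -> : K - j.+1%:Z + 1 = K - j%:Z by lia.
Qed.

Lemma cintegrable_layer k : cintegrable mu (layer F k).
Proof.
apply: (cintegrable_dom (cmeasurable_layer F k) (h := fun x => normc (layer F k x))) => //.
apply/integrableP; split; first exact/measurable_EFinP/measurable_normc/cmeasurable_layer.
under eq_integral => x _ do rewrite gee0_abs ?lee_fin ?normc_ge0//.
have /integrableP[_] := integrable_normc f_int.
under eq_integral => x _ do rewrite gee0_abs ?lee_fin ?normc_ge0//.
exact/le_lt_trans/integral_normc_layer_le.
Qed.

(** The shifts to the children lie in p^k Z_p^n, where the character of [xi] is trivial; so all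
    translates of the next layer contribute the same integral. *)
Lemma fourier_layer_step k xi : (forall i, Zp (pp ^ k * xi 0 i)) ->
  fourier mu (layer F k) xi = fourier mu (layer F (k + 1)) xi.
Proof.
move=> xik; pose g x := layer F (k + 1) x * chi R (dot x xi).
have ig : cintegrable mu g by apply: cintegrable_chi; exact: cintegrable_layer.
pose w (a : digits) : Qpn := pp ^ k *: digit_row a.
have iw a := cintegrable_translate (w a) ig.
transitivity (cintegral mu (fun x => (q^-1)%:C * \sum_(a : digits) g (w a + x))).
  congr cintegral; apply/funext => x; rewrite layer_children -mulrA mulr_suml.
  congr (_ * _); apply: eq_bigr => a _; congr (_ * _).
  apply: (chi_dot_periodic R xik); rewrite -{1}(add0r x) addrC [w a + x]addrC.
  apply: pcosetD; apply: (@pcoset_child _ _ _ 0 k a).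
  by rewrite add0r; exact: pcoset_refl.
rewrite cintegralZ; last exact: cintegrable_sum.
rewrite cintegral_sum//; under eq_bigr do rewrite cintegral_translate//.
rewrite sumr_const card_digits -[cintegral mu g *+ _]mulr_natl mulrA.
by rewrite -(rmorph_nat (real_complex R)) -rmorphM/= mulVf ?rmorph1 ?mul1r// q_neq0.
Qed.

Lemma fourier_layer_in k xi : k <= K -> (forall i, Zp (pp ^ k * xi 0 i)) ->
  fourier mu (layer F k) xi = fourier mu f xi.
Proof.
move=> kK xik; have [j jE] : exists j : nat, K = k + j%:Z by exists (absz (K - k)); lia.
rewrite -(FK (lexx K)) jE; elim: j {jE} => [|j IH]; first by rewrite addr0.
rewrite IH; have -> : k + j.+1%:Z = k + j%:Z + 1 by lia.
by apply: fourier_layer_step => i; apply: Zp_pXle (xik i); lia.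
Qed.

(* Translating by b in p^k Z_p^n with chi (b . xi) <> 1 multiplies the integral by
   chi (b . xi) but does not change the layer. *)
Lemma fourier_layer_out k xi : ~ (forall i, Zp (pp ^ k * xi 0 i)) ->
  fourier mu (layer F k) xi = 0.
Proof.
move=> /(chi_dot_ex R)[b bk chi1].
have ig := cintegrable_chi xi (cintegrable_layer k).
have : fourier mu (layer F k) xi = chi R (dot b xi) * fourier mu (layer F k) xi.
  rewrite /fourier -{1}(cintegral_translate b ig) -cintegralZ//.
  congr cintegral; apply/funext => x; rewrite dotDl chiD mulrCA; congr (_ * (_ * _)).
  apply: (vtx_periodic F); rewrite -{2}(add0r x) addrC [0 + x]addrC.
  exact/pcoset_sym/pcosetD.
move=> /eqP; rewrite -subr_eq0 -{1}[fourier _ _ _]mul1r -mulrBl mulf_eq0 subr_eq0.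
by rewrite eq_sym (negbTE chi1) => /eqP.
Qed.

Variables (s C : R) (s_gt0 : 0 < s) (FC : forall v, normc (F v) <= C).

Lemma iter_upper m x k : iter m (@upper _ _ _) (vtx x k) = vtx x (k - m%:Z).
Proof.
elim: m => [|m IH]; first by rewrite subr0.
by rewrite iterS IH upper_vtx; congr vtx; lia.
Qed.

Let t k m x : R[i] := jump s F (vtx x (k - m%:Z)).

Let tE k m x : t k m x = (e (s * (k - m%:Z)%:~R))%:C *
  (layer F (k - m%:Z) x + - 1 * layer F (k - m%:Z - 1) x).
Proof. by rewrite /t /jump upper_vtx mulN1r. Qed.

Let it k m : cintegrable mu (t k m).
Proof.
rewrite (funext (tE k m)); apply: cintegrableZ; apply: cintegrableD.
  exact: cintegrable_layer.
by apply: cintegrableZ; exact: cintegrable_layer.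
Qed.

(** Taking [theta] equal to 1 gives integrability of the potential, and taking a character gives its
    transform term by term; modulus one leaves the majorants unchanged. *)
Lemma fractional_layer k (theta : Qpn -> R[i]) : cmeasurable theta ->
  (forall x, normc (theta x) = 1) ->
  cintegrable mu (fun x => layer (fractional s F) k x * theta x) /\
  ccvg (fun N => \sum_(m < N) cintegral mu (fun x => t k m x * theta x))
    (cintegral mu (fun x => layer (fractional s F) k x * theta x)).
Proof.
move=> mtheta theta1.
pose I := fine (\int[mu]_x (normc (f x))%:E).
have IE : (\int[mu]_x (normc (f x))%:E = I%:E)%E.
  by rewrite fineK// integral_fune_fin_num//; exact: integrable_normc.
have hm m : e (s * (k - m%:Z)%:~R) = e (s * k%:~R) * e (- s) ^+ m.
  rewrite intrB mulrBr (rpowD p_prime) -mulNr; congr (_ * _).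
  by rewrite /rpow powRrM powR_mulrn ?powR_ge0.
have nt m x : normc (t k m x * theta x) = normc (t k m x).
  by rewrite Normc.normcM theta1 mulr1.
apply: (@cintegral_series _ _ _ mu (fun m x => t k m x * theta x)
  (fun x => layer (fractional s F) k x * theta x)
  (2 * C * e (s * k%:~R)) (2 * I * e (s * k%:~R)) (e (- s))).
- exact: rpowN_lt1.
- by move=> m; apply: cmeasurableM => //; exact: cintegrable_measurable (it k m).
- by apply: cmeasurableM => //; exact: cmeasurable_layer.
- move=> m x; rewrite nt /t -iter_upper.
  exact: (normc_jump s m (vtx x k) FC).
- move=> m; under eq_integral do rewrite nt.
  apply: (@le_trans _ _ ((e (s * (k - m%:Z)%:~R))%:E *
      (\int[mu]_x (normc (layer F (k - m%:Z) x))%:E +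
       \int[mu]_x (normc (layer F (k - m%:Z - 1) x))%:E))%E).
    have e0 := ltW (rpow_gt0 p_prime (s * (k - m%:Z)%:~R) : 0 < _).
    have mF l : measurable_fun setT (fun x => (normc (layer F l x))%:E).
      exact/measurable_EFinP/measurable_normc/cmeasurable_layer.
    rewrite -ge0_integralD//; last 2 first.
    + by move=> x _; rewrite lee_fin normc_ge0.
    + by move=> x _; rewrite lee_fin normc_ge0.
    rewrite -ge0_integralZl_EFin//; last 2 first.
    + by move=> x _; rewrite -EFinD lee_fin addr_ge0 ?normc_ge0.
    + exact: emeasurable_funD.
    apply: ge0_le_integral => //.
    + by move=> x _; rewrite lee_fin normc_ge0.
    + exact/measurable_EFinP/measurable_normc/(cintegrable_measurable (it k m)).
    + by apply: measurable_funeM; exact: emeasurable_funD.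
    move=> x _; rewrite -EFinD -EFinM lee_fin tE Normc.normcM normc_real ger0_norm//.
    rewrite ler_wpM2l// (le_trans (le_normcD _ _))// lerD2l.
    by rewrite mulN1r normcN.
  rewrite hm EFinM; apply: (@le_trans _ _
    ((e (s * k%:~R))%:E * (e (- s) ^+ m)%:E * (I%:E + I%:E))%E).
    apply: lee_wpmul2l; last by rewrite -IE leeD// integral_normc_layer_le.
    by rewrite -EFinM lee_fin mulr_ge0 ?exprn_ge0 ?(ltW (rpow_gt0 p_prime _)).
  rewrite -EFinD -!EFinM lee_fin le_eqVlt; apply/orP; left; apply/eqP; ring.
- move=> x; have := ccvgMl (theta x) (fractionalP s_gt0 FC (vtx x k)).
  rewrite mulrC; apply: ccvg_near; apply: nearW => N.
  by rewrite mulr_sumr; apply: eq_bigr => m _; rewrite /t iter_upper mulrC.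
Qed.

Lemma cintegrable_fractional k : cintegrable mu (layer (fractional s F) k).
Proof.
have [] := fractional_layer k (cmeasurable_cst _ 1) (fun=> Normc.normc1 R).
by under eq_fun do rewrite mulr1.
Qed.

Lemma fourier_fractional xi : fourier mu (layer (fractional s F) K) xi =
  (vnorm R xi `^ s)%:C * fourier mu f xi.
Proof.
have [_ lim] := fractional_layer K (cmeasurable_chi xi) (fun x => normc_chi R _).
apply: (ccvg_unique lim) => {lim}.
pose D m := (e (s * (K - m%:Z)%:~R))%:C *
  (fourier mu (layer F (K - m%:Z)) xi - fourier mu (layer F (K - m%:Z - 1)) xi).
have tD m : cintegral mu (fun x => t K m x * chi R (dot x xi)) = D m.
  rewrite /D -[- fourier mu _ xi]mulN1r /fourier -cintegralZ; last first.
    exact/cintegrable_chi/cintegrable_layer.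
  rewrite -cintegralD; last 2 first.
  - exact/cintegrable_chi/cintegrable_layer.
  - exact/cintegrableZ/cintegrable_chi/cintegrable_layer.
  rewrite -cintegralZ; last first.
    apply: cintegrableD; first exact/cintegrable_chi/cintegrable_layer.
    exact/cintegrableZ/cintegrable_chi/cintegrable_layer.
  congr cintegral; apply/funext => x; rewrite tE -mulrA mulrDl mulrA; congr (_ * _).
have Fin k : k <= K -> (forall i, Zp (pp ^ k * xi 0 i)) -> _ := @fourier_layer_in k xi.
have Fout k := @fourier_layer_out k xi.
(* At frequency 0 all the layers involved have the same integral, and 0 to the power [s] is 0 as [s]
   is positive. *)
have [xi0|xi0] := eqVneq xi 0.
  apply: ccvg_near (ccvg_cst _); apply: nearW => N; rewrite big1 => [|m _].
    by rewrite xi0 vnorm0 powR0 ?gt_eqF// mul0r.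
  have xiZ k i : Zp (pp ^ k * xi 0 i) by rewrite xi0 mxE mulr0; exact: Zp_0.
  by rewrite tD /D !Fin ?subrr ?mulr0//; lia.
have [j [xij xijN]] := vector_order xi0.
have vxi : vnorm R xi `^ s = e (s * j%:~R).
  by rewrite (vnormE R xij xijN) -powR_intmul ?ler0n// -powRrM mulrC.
have inZ k : j <= k -> forall i, Zp (pp ^ k * xi 0 i).
  by move=> jk i; apply: Zp_pXle (xij i).
have outZ k : k < j -> ~ forall i, Zp (pp ^ k * xi 0 i).
  by move=> kj H; apply: xijN => i; apply: Zp_pXle (H i); lia.
(* If [K - m > j], both layers of the jump have the transform of [f] at [xi]; if [K - m < j], both
   transforms vanish. *)
have D0 m : K - m%:Z != j -> D m = 0.
  move=> mj; rewrite /D; have [jm|mj'] := ltP j (K - m%:Z).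
    rewrite !Fin ?subrr ?mulr0//; try lia; apply: inZ; lia.
  rewrite !Fout ?subrr ?mulr0//; apply: outZ; lia.
(* For [K < j] the frequency is absent from [f], which is its own layer [K], and both sides
   vanish. *)
have [jK|Kj] := leP j K; last first.
  apply: ccvg_near (ccvg_cst _); apply: nearW => N; rewrite big1 => [|m _].
    by rewrite -(FK (lexx K)) Fout ?mulr0//; exact: outZ.
  by rewrite tD D0//; lia.
(* The only surviving jump is at height [j], where the norm of [xi] is p^j: the layer [j] has the
   transform of [f] and the layer above it has transform 0. *)
pose m0 := absz (K - j).
apply: ccvg_near (ccvg_cst _); exists m0.+1 => // N /= mN.
rewrite (bigD1 (Ordinal mN))//= big1 ?addr0 => [|m mm0].
  rewrite tD /D; have -> : K - m0%:Z = j by rewrite /m0; lia.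
  by rewrite Fin// Fout ?subr0 ?vxi//; apply: outZ; lia.
rewrite tD D0//; apply: contraNneq mm0 => mj; apply/eqP/val_inj => /=.
by rewrite /m0; lia.
Qed.

End harmonic.
End fourier_layers.

(** * Injectivity of the Fourier transform *)

Section cosets_generate.
Variables (p : nat) (p_prime : prime p) (n : nat).
Local Notation Qp := (Qp p_prime).
Local Notation Qpn := ('rV[Qp]_n).
Local Notation vertex := (vertex p_prime n).
Implicit Types (x y z : Qpn) (k l : int).

Definition coset_system : set (set Qpn) :=
  [set A | A = set0 \/ exists x k, A = pcoset x k].

(** Two cosets are nested or disjoint; the empty set is in the system for the second case. *)
Lemma coset_systemI : setI_closed coset_system.
Proof.
have W x k y l : k <= l -> coset_system (pcoset x k `&` pcoset y l).
  move=> kl; have [[z [xz yz]]|N] := pselect (exists z, (pcoset x k `&` pcoset y l) z).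
    right; exists z, l; apply/seteqP; split=> w /=.
      by move=> [xw yw]; apply: pcoset_trans yw; exact: pcoset_sym.
    move=> zw; split; last exact: pcoset_trans zw.
    by apply: pcoset_trans (pcoset_le kl zw).
  by left; apply/seteqP; split=> w // xyw; apply: N; exists w.
move=> A B [->|[x [k ->]]]; first by left; rewrite set0I.
move=> [->|[y [l ->]]]; first by left; rewrite setI0.
by have [/W//|/ltW/W] := leP k l; rewrite setIC.
Qed.

Lemma coset_fiber k : exists f : vertex -> nat,
  forall i, [set x | f (vtx x k) = i] = set0 \/
    exists x, [set x | f (vtx x k) = i] = pcoset x k.
Proof.
have /countable_injP[f fI] := countable_boundary p_prime n k.
exists f => i; have [[x xi]|N] := pselect (exists x, f (vtx x k) = i); last first.
  by left; apply/seteqP; split=> x // xi; apply: N; exists x.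
right; exists x; apply/seteqP; split=> y /=; last by move=> /vtx_eq <-.
by rewrite -xi => /fI yx; apply/vtx_eq/esym/yx; rewrite inE.
Qed.

Lemma coset_system_sub_measurable (A : set Qpn) : coset_system A -> measurable A.
Proof. by move=> [->|[x [k ->]]]; [exact: measurable0|exact: measurable_pcoset]. Qed.

(** An open set is the union over [m] of the sets of points whose coset of height [m] it contains,
    and each of these is a union of cosets from a countable family. *)
Lemma measurable_coset_system : @measurable _ Qpn = <<s coset_system >>.
Proof.
apply/seteqP; split.
  apply: smallest_sub; first exact: smallest_sigma_algebra.
  move=> A oA.
  pose U (m : nat) := [set x | pcoset x m%:Z `<=` A].
  have -> : A = \bigcup_m U m.
    apply/seteqP; split=> x; last by move=> [m _]; apply; exact: pcoset_refl.
    move=> Ax; have /nbhs_pcosetP[m mA] : nbhs x A by exact: open_nbhs_nbhs.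
    by exists m.
  apply: sigma_algebra_bigcup => m; have [f fP] := coset_fiber m%:Z.
  have -> : U m = \bigcup_i ([set x | f (vtx x m%:Z) = i] `&` U m).
    by apply/seteqP; split=> x; [move=> Ux; exists (f (vtx x m%:Z))|move=> [i _ []]].
  apply: sigma_algebra_bigcup => i; apply: sub_sigma_algebra.
  have [->|[x E]] := fP i; first by left; rewrite set0I.
  have [xA|xA] := pselect (pcoset x m%:Z `<=` A).
    right; exists x, m%:Z; rewrite E; apply/seteqP; split=> y; first by case.
    by move=> xy; split=> //; rewrite /U/= -(pcoset_eq xy).
  left; apply/seteqP; split=> y //; rewrite E => -[xy].
  by rewrite /U/= -(pcoset_eq xy).
apply: smallest_sub; first exact: smallest_sigma_algebra.
exact: coset_system_sub_measurable.
Qed.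

Variables (R : realType) (mu : {measure set Qpn -> \bar R}).

(** The measurable sets over which [g] integrates to 0 form a Dynkin class containing an
    intersection-stable generator, hence are all the measurable sets. *)
Lemma integral_coset_eq0 (g : Qpn -> R) : mu.-integrable setT (EFin \o g) ->
  (forall x k, (\int[mu]_(y in pcoset x k) (g y)%:E = 0)%E) ->
  {ae mu, forall x, g x = 0}.
Proof.
move=> ig g0; have mg : measurable_fun setT (EFin \o g) by exact: measurable_int ig.
pose P (A : set Qpn) := (\int[mu]_(y in A) (g y)%:E = 0)%E.
have PG : coset_system `<=` P.
  by move=> A [->|[x [k ->]]]; [exact: integral_set0|exact: g0].
have PU (F : (set Qpn)^nat) : (forall i, measurable (F i)) -> trivIset setT F ->
    (forall i, P (F i)) -> P (\bigcup_i F i).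
  move=> mF tF PF; rewrite /P integral_bigcup//.
    by rewrite eseries0// => i _ _; exact: PF.
  by apply: integrableS ig => //; exact: bigcup_measurable.
(* The Dynkin argument needs the whole space, which is obtained as a countable disjoint union of
   cosets of height 0. *)
have PT : P setT.
  have [f fP] := coset_fiber 0.
  have sysf i : coset_system [set x | f (vtx x 0) = i].
    by have [->|[x ->]] := fP i; [left|right; exists x, 0].
  have -> : setT = \bigcup_i [set x | f (vtx x 0) = i].
    by apply/seteqP; split=> x // _; exists (f (vtx x 0)).
  apply: PU => [i|i j _ _ [x [<- <-]]//|i].
    exact: coset_system_sub_measurable.
  exact: PG.
have PC (A : set Qpn) : measurable A -> P A -> P (~` A).
  move=> mA PA; have := PT; rewrite /P -(setUv A) integral_setU//.
  - by rewrite PA add0e.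
  - exact: measurableC.
  - exact: measurable_funTS.
  - by rewrite disj_set2E setICr.
have Pm (A : set Qpn) : measurable A -> P A.
  have /seteqP[sub _] := measurable_coset_system => /sub.
  exact: (dynkin_induction measurable_coset_system coset_systemI PT PG PC PU).
have : ae_eq mu setT (EFin \o g) (cst 0%E).
  apply: (integral_ae_eq measurableT ig (measurable_cst _)) => E _ mE.
  by rewrite integral_cst// mul0e -[RHS](Pm E mE).
by apply: filterS => x /(_ I) [].
Qed.

End cosets_generate.

(** * Characters separate integrable functions *)

Section fourier_injective.
Variables (R : realType) (p : nat) (p_prime : prime p) (n : nat).
Local Notation Qp := (Qp p_prime).
Local Notation Qpn := ('rV[Qp]_n).
Local Notation pp := (p%:R : Qp).
Local Notation normc := Normc.normc.
Variables (mu : {measure set Qpn -> \bar R}) (d : Qpn -> R[i]).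
Hypotheses (d_int : cintegrable mu d) (d_hat : forall xi, fourier mu d xi = 0).
Implicit Types (theta : Qpn -> R[i]) (a x xi : Qpn) (k : int).

(** Vanishing is imposed at every frequency so that the class is stable under products with
    characters; the bound by 1 keeps [d * theta] dominated by [d]. *)
Definition annihilated theta := [/\ cmeasurable theta,
  forall x, normc (theta x) <= 1 &
  forall xi, cintegral mu (fun x => d x * theta x * chi R (dot x xi)) = 0].

Let annihilated1 : annihilated (fun=> 1).
Proof.
split=> [|x|xi]; [exact: cmeasurable_cst|by rewrite Normc.normc1|].
by under eq_fun do rewrite mulr1; exact: d_hat.
Qed.

(* Up to the factor 1 / p, a sum of p characters, which vanishes where
   p^(k + 1) (x_i - a_i), but not p^k (x_i - a_i), is a p-adic integer. *)
Definition char_mean a (i : 'I_n) k x : R[i] :=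
  (p%:R^-1)%:C * \sum_(c < p) chi R (c%:R * (pp ^ k * (x 0 i - a 0 i))).

Let p_neq0 : (p%:R : R) != 0. Proof. by rewrite pnatr_eq0 -lt0n prime_gt0. Qed.

Lemma char_mean1 a i k x : Zp (pp ^ k * (x 0 i - a 0 i)) -> char_mean a i k x = 1.
Proof.
move=> xZ; rewrite /char_mean chi_sum_Zp// -(rmorph_nat (real_complex R)) -rmorphM/=.
by rewrite mulVf// rmorph1.
Qed.

Lemma char_mean0 a i k x : ~ Zp (pp ^ k * (x 0 i - a 0 i)) ->
  Zp (pp ^ (k + 1) * (x 0 i - a 0 i)) -> char_mean a i k x = 0.
Proof.
move=> xZ xZ1; rewrite /char_mean chi_sum ?mulr0//.
by rewrite mulrA -[X in X * _]/(pp ^ 1 * pp ^ k) -pXD addrC.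
Qed.

Lemma normc_char_mean a i k x : normc (char_mean a i k x) <= 1.
Proof.
rewrite /char_mean Normc.normcM normc_real ger0_norm ?invr_ge0//.
rewrite ler_pdivrMl ?mulr1 ?ltr0n ?prime_gt0//.
apply: (le_trans (normc_sum _ _ _)); under eq_bigr do rewrite normc_chi.
by rewrite sumr_const card_ord.
Qed.

Let char_meanE a i k x : char_mean a i k x =
  \sum_(c < p) (p%:R^-1)%:C * chi R (- (c%:R * (pp ^ k * a 0 i))) *
    chi R (dot x ((c%:R * pp ^ k) *: delta_mx 0 i)).
Proof.
rewrite /char_mean mulr_sumr; apply: eq_bigr => c _.
have E (K : comNzRingType) (b u v w : K) : b * (u * (v - w)) = - (b * (u * w)) + b * u * v.
  by rewrite mulrBr mulrBr addrC [b * (u * v)]mulrA.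
by rewrite E chiD mulrA dot_delta.
Qed.

(** The mean is a finite combination of characters, and multiplication by a character only shifts
    the frequency. *)
Lemma annihilatedM a i k theta : annihilated theta ->
  annihilated (fun x => theta x * char_mean a i k x).
Proof.
move=> [mtheta theta1 H].
have mc xi : cmeasurable (fun x => chi R (dot x xi)) by exact: cmeasurable_chi.
split=> [|x|xi].
- apply: cmeasurableM => //; rewrite (funext (char_meanE a i k)).
  by apply: cmeasurable_sum => c; apply: cmeasurableM => //; exact: cmeasurable_cst.
- rewrite Normc.normcM -[1]mulr1 ler_pM ?normc_ge0//; exact: normc_char_mean.
pose b (c : 'I_p) : R[i] := (p%:R^-1)%:C * chi R (- (c%:R * (pp ^ k * a 0 i))).
pose eta (c : 'I_p) : Qpn := (c%:R * pp ^ k) *: delta_mx 0 i + xi.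
pose g c x := d x * theta x * chi R (dot x (eta c)).
have ig c : cintegrable mu (g c).
  by apply: cintegrable_chi; exact: cintegrable_bounded theta1.
transitivity (cintegral mu (fun x => \sum_(c < p) b c * g c x)).
  congr cintegral; apply/funext => x.
  rewrite char_meanE !mulr_sumr mulr_suml; apply: eq_bigr => c _.
  by rewrite /g /eta dotDr chiD -/(b c); ring.
rewrite cintegral_sum => [|c]; last exact: cintegrableZ.
by rewrite big1// => c _; rewrite cintegralZ// H mulr0.
Qed.

(** On the coset of [a] of height [k - m] this is already the indicator of the coset of height [k];
    farther away only the bound by 1 is known. *)
Definition char_prod a k (m : nat) x : R[i] :=
  \prod_(l < m) \prod_(i < n) char_mean a i (- k + l%:Z) x.

Lemma annihilated_char_prod a k m : annihilated (char_prod a k m).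
Proof.
elim: m => [|m IH].
  by have -> : char_prod a k 0 = fun=> 1 by apply/funext => x; rewrite /char_prod big_ord0.
have -> : char_prod a k m.+1 = fun x => char_prod a k m x *
    \prod_(i <- index_enum 'I_n) char_mean a i (- k + m%:Z) x.
  by apply/funext => x; rewrite /char_prod big_ord_recr.
elim: (index_enum _) => [|i s IHs].
  by under eq_fun do rewrite big_nil mulr1.
have := annihilatedM a i (- k + m%:Z) IHs.
by congr annihilated; apply/funext => x; rewrite big_cons -mulrA [X in _ * X]mulrC.
Qed.

(* At each point the sequence is eventually constant, as one of the factors vanishes
   outside the coset. *)
Lemma ccvg_char_prod a k x :
  ccvg (fun m => d x * char_prod a k m x) (if x \in pcoset a k then d x else 0).
Proof.
case: ifPn => [/set_mem/pcosetP ax|]; last rewrite notin_setE => ax.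
  apply: ccvg_near (ccvg_cst _); apply: nearW => m.
  rewrite /char_prod big1 ?mulr1// => l _; rewrite big1// => i _.
  by apply: char_mean1; apply: Zp_pXle (ax i); lia.
have [i /Zp_order[m0 [xN xZ]]] : exists i, ~ Zp (pp ^ (- k) * (x 0 i - a 0 i)).
  by apply/existsNP => H; apply: ax; apply/pcosetP.
have c0 : char_mean a i (- k + m0%:Z) x = 0 by exact: char_mean0 xN xZ.
apply: ccvg_near (ccvg_cst _); exists m0.+1 => // m /= m0m.
have -> : char_prod a k m x = 0; last by rewrite mulr0.
apply/eqP/prodf_eq0; exists (Ordinal m0m); first exact: isT.
by apply/prodf_eq0; exists i; [exact: isT|exact/eqP].
Qed.

Lemma fourier_injective : {ae mu, forall x, d x = 0}.
Proof.
have coset0 a k : cintegral mu (fun x => if x \in pcoset a k then d x else 0) = 0.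
  have md := cintegrable_measurable d_int.
  have mi : cmeasurable (fun x : Qpn => if x \in pcoset a k then d x else 0).
    have -> : (fun x => if x \in pcoset a k then d x else 0) =
        (fun x => d x * (if x \in pcoset a k then 1 else 0)).
      by apply/funext => x; case: ifP; rewrite ?mulr1 ?mulr0.
    apply: cmeasurableM => //; apply: (@cmeasurable_periodic _ _ _ _ _ k) => x y xy.
    have -> // : (x \in pcoset a k) = (y \in pcoset a k).
    apply/idP/idP => /set_mem ax; apply/mem_set; first exact: pcoset_trans ax xy.
    exact: pcoset_trans ax (pcoset_sym xy).
  have mprod m : cmeasurable (char_prod a k m) by have [] := annihilated_char_prod a k m.
  have [||_ lim] := dominated_ccvg (u := fun m x => d x * char_prod a k m x) _ mi
      (integrable_normc d_int) _ (ccvg_char_prod a k).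
  - by move=> m; exact: cmeasurableM.
  - move=> m x; have [_ + _] := annihilated_char_prod a k m => /(_ x).
    by rewrite Normc.normcM => ?; rewrite ler_piMr ?normc_ge0.
  apply: (ccvg_unique lim); apply: ccvg_near (ccvg_cst _); apply: nearW => m.
  (* The integral of the product is its transform at frequency 0, where the character is 1. *)
  have [_ _ /(_ 0)] := annihilated_char_prod a k m => <-.
  congr cintegral; apply/funext => x; rewrite chi_Zp ?mulr1//.
  rewrite /dot big1; first exact: Zp_0.
  by move=> i _; rewrite mxE mulr0.
(* [P] is the real or the imaginary part; [P 0 = 0] makes it commute with restriction to a coset. *)
have H (P : R[i] -> R) : P 0 = 0 ->
    mu.-integrable setT (EFin \o (fun x => P (d x))) ->
    (forall a k, \int[mu]_x P (if x \in pcoset a k then d x else 0) = 0) ->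
    {ae mu, forall x, P (d x) = 0}.
  move=> P0 iP I0; apply: integral_coset_eq0 => // a k.
  have E : (fun x => (P (if x \in pcoset a k then d x else 0))%:E) =
      ((fun x => (P (d x))%:E) \_ (pcoset a k)).
    by apply/funext => x; rewrite /patch; case: ifP => // _; rewrite P0.
  have := congr1 (@EFin R) (I0 a k); rewrite /Rintegral E -integral_mkcond fineK//.
  apply: integrable_fin_num.
    exact: measurable_pcoset.
  by apply: integrableS iP => //; exact: measurable_pcoset.
have [dr di] := d_int.
have := H (@complex.Re R) erefl dr (fun a k => congr1 (@complex.Re R) (coset0 a k)).
have := H (@complex.Im R) erefl di (fun a k => congr1 (@complex.Im R) (coset0 a k)).
apply: filterS2 => x dxi dxr; exact: complex_ext.
Qed.

End fourier_injective.

(** * Bruhat--Schwartz functions *)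

Section schwartz_functions.
Variables (R : realType) (p : nat) (p_prime : prime p) (n : nat).
Local Notation Qp := (Qp p_prime).
Local Notation Qpn := ('rV[Qp]_n).
Local Notation vertex := (vertex p_prime n).
Local Notation normc := Normc.normc.
Variables (mu : {measure set Qpn -> \bar R}) (mu_haar : haar mu).
Implicit Types (x y : Qpn) (k : int).

(** By compactness, finitely many cosets on which [f] is constant cover the support. The largest of
    their heights gives [K], the sum of the norms of the values gives [C], and off these cosets [f]
    is 0. *)
Lemma schwartz_periodic (f : Qpn -> R[i]) : schwartz f ->
  exists (K M : nat) (C : R), [/\ coset_periodic K%:Z f, forall x, normc (f x) <= C &
    forall x, ~ pcoset 0 (- M%:Z) x -> f x = 0].
Proof.
move=> [floc fcomp].
have /choice[m mP] x : exists m : nat, forall y, pcoset x m%:Z y -> f y = f x.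
  by have [m mf] := nbhs_pcosetP (floc x); exists m.
have := fcomp; rewrite compact_cover => /(_ Qpn setT (fun x => pcoset x (m x)%:Z)).
case=> [x _|x _|D' _ fD']; [exact: open_pcoset|by exists x => //; exact: pcoset_refl|].
have [D fD] : exists D : seq Qpn, forall x, closure [set x | f x != 0] x ->
    exists2 i, i \in D & pcoset i (m i)%:Z x.
  by exists (finmap.enum_fset D') => x /fD'[i iD ix]; exists i.
clear D' fD'.
have f0 x : (forall i, i \in D -> ~ pcoset i (m i)%:Z x) -> f x = 0.
  move=> H; apply/eqP; apply: contrapT => /negP fx.
  have /fD[i iD ix] : closure [set x | f x != 0] x by exact: subset_closure.
  exact: H ix.
have /choice[M MP] x : exists j : nat, pcoset 0 (- j%:Z) x by exact: pcoset_common.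
exists (\max_(i <- D) m i)%N, (\max_(i <- D) M i)%N, (\sum_(i <- D) normc (f i)).
split.
- move=> x y xy.
  (* Cosets of the maximal height are contained in a covering coset or disjoint from it, so [x] and
     [y] belong to the same covering cosets. *)
  have in_iff i : i \in D -> pcoset i (m i)%:Z x <-> pcoset i (m i)%:Z y.
    move=> iD; have mxy : pcoset x (m i)%:Z y.
      by apply: pcoset_le xy; rewrite lez_nat; exact: leq_bigmax_seq.
    by split=> ix; [exact: pcoset_trans ix mxy|exact: pcoset_trans ix (pcoset_sym mxy)].
  have [[i iD ix]|N] := pselect (exists2 i, i \in D & pcoset i (m i)%:Z x).
    by rewrite (mP i x ix) (mP i y)//; apply/(in_iff i iD).
  rewrite !f0// => i iD; first by move=> /(in_iff i iD) ix; apply: N; exists i.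
  by move=> ix; apply: N; exists i.
- move=> x; have [[i iD ix]|N] := pselect (exists2 i, i \in D & pcoset i (m i)%:Z x).
    rewrite (mP i x ix) (big_rem i)//= lerDl sumr_ge0// => j _; exact: normc_ge0.
  rewrite f0 ?Normc.normc0 ?sumr_ge0// => [j _|i iD ix]; first exact: normc_ge0.
  by apply: N; exists i.
- move=> x xN; apply: f0 => i iD ix; apply: xN.
  apply: (pcoset_trans (y := i)).
    by apply: pcoset_le (MP i); rewrite lerN2 lez_nat; exact: leq_bigmax_seq.
  by apply: pcoset_le ix; lia.
Qed.

Lemma cintegrable_compact_support (f : Qpn -> R[i]) (k l : int) (C : R) :
  coset_periodic k f -> (forall x, normc (f x) <= C) ->
  (forall x, ~ pcoset 0 l x -> f x = 0) -> cintegrable mu f.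
Proof.
move=> fk fC f0; have mA := measurable_pcoset (0 : Qpn) l.
have iA : mu.-integrable setT (EFin \o \1_(pcoset (0 : Qpn) l)).
  apply/integrableP; split; first exact/measurable_EFinP.
  rewrite (eq_integral (fun x => (\1_(pcoset (0 : Qpn) l) x)%:E)); last first.
    by move=> x _ /=; rewrite ger0_norm.
  by rewrite integral_indic// setIT (haar_pcoset mu_haar) ltry.
have ih : mu.-integrable setT (EFin \o (fun x => C * \1_(pcoset 0 l) x)).
  by apply: (eq_integrable measurableT _ _ _ (integrableZl measurableT C iA)).
apply: (cintegrable_dom (cmeasurable_periodic fk) ih) => x.
rewrite indicE; case: (boolP (x \in _)) => [_|]; first by rewrite mulr1.
by rewrite notin_setE => /f0 ->; rewrite mulr0 Normc.normc0.
Qed.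

Variables (f : Qpn -> R[i]) (K : int) (fK : coset_periodic K f).

(* The average of f over the coset v, computed from the descendants of v of height K,
   on which f is constant. *)
Definition level_avg (v : vertex) : R[i] :=
  tree_avg (if height v <= K then absz (K - height v) else 0%N) (fun u => f (repr_vtx u)) v.

Let frepr x k : K <= k -> f (repr_vtx (vtx x k)) = f x.
Proof. by move=> Kk; apply/esym/fK; apply: pcoset_le (repr_vtxP x k). Qed.

Lemma layer_level_avg k : K <= k -> layer level_avg k = f.
Proof.
move=> Kk; apply/funext => x; rewrite /layer /level_avg /=.
case: ifP => [kK|_]; last exact: frepr.
by have -> : absz (K - k) = 0%N; [lia|exact: frepr].
Qed.

(** At heights less than [K], a child is averaged over one level fewer than its parent; from [K] on,
    [f] is constant on the coset and all children share its value. *)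
Lemma level_avg_mean v : child_avg level_avg v = level_avg v.
Proof.
have [vK|Kv] := ltP (height v) K; last first.
  rewrite -[RHS](child_avg_cst _ v) /child_avg; congr (_ * _); apply: eq_bigr => a _.
  have lf k x : K <= k -> level_avg (vtx x k) = f x.
    by move=> /layer_level_avg/(congr1 (@^~ x)).
  rewrite lowerE -[in RHS](vtxK v) !lf//; last lia.
  apply/esym/fK; apply: (pcoset_le Kv); apply: (@pcoset_child _ _ _ _ _ a); exact: pcoset_refl.
rewrite {2}/level_avg ltW//.
have -> : absz (K - height v) = (absz (K - (height v + 1))%R).+1 by lia.
rewrite tree_avgSr; congr (_ * _); apply: eq_bigr => a _.
by rewrite /level_avg lowerE /=; have -> : height v + 1 <= K by lia.
Qed.

Lemma normc_level_avg (C : R) v : (forall x, normc (f x) <= C) -> normc (level_avg v) <= C.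
Proof. by move=> fC; apply: normc_tree_avg => u; exact: fC. Qed.

End schwartz_functions.

(** * Asymptotics of the solution *)

Section vertex_sums.
Variables (R : realType) (p : nat) (p_prime : prime p) (n : nat).
Local Notation Qpn := ('rV[Qp p_prime]_n).
Local Notation vertex := (vertex p_prime n).
Local Notation q := ((p ^ n)%:R : R).
Local Notation normc := Normc.normc.
Variables (mu : {measure set Qpn -> \bar R}) (mu_haar : haar mu).
Implicit Types (h : vertex -> R[i]) (k : int).

Lemma summable_layer h k : cintegrable mu (layer h k) ->
  summable (boundary p_prime n k) (fun v => (normc (h v))%:E).
Proof.
move=> ih; rewrite /summable; under eq_esum => v _ do rewrite gee0_abs ?lee_fin ?normc_ge0//.
rewrite (ge0_integral_boundary mu_haar); last by move=> v; rewrite lee_fin normc_ge0.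
rewrite lte_mul_pinfty// ?lee_fin ?exprz_ge0//.
have /integrableP[_] := integrable_normc ih.
by under eq_integral => x _ do rewrite gee0_abs ?lee_fin ?normc_ge0//.
Qed.

(** The positive and negative parts in [csum] correspond to those of the integrand, so each part
    reduces to the nonnegative case. *)
Lemma csum_layer h k : cintegrable mu (layer h k) ->
  csum (boundary p_prime n k) h = (q ^ k)%:C * cintegral mu (layer h k).
Proof.
have H (g : vertex -> R) : mu.-integrable setT (EFin \o (fun x => g (vtx x k))) ->
    fine (\esum_(v in boundary p_prime n k) (Num.max (g v) 0)%:E) -
    fine (\esum_(v in boundary p_prime n k) (Num.max (- g v) 0)%:E) =
    q ^ k * \int[mu]_x g (vtx x k).
  move=> ig; have pos (g' : vertex -> R) v : (0 <= (Num.max (g' v) 0)%:E)%E.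
    by rewrite lee_fin le_max lexx orbT.
  rewrite !(ge0_integral_boundary mu_haar)//; last exact: (pos (fun v => - g v)).
  pose G x := (g (vtx x k))%:E.
  have -> : (\int[mu]_x (Num.max (g (vtx x k)) 0)%:E = \int[mu]_x G^\+%E x)%E.
    by apply: eq_integral => x _; rewrite funeposE /G EFin_max.
  have -> : (\int[mu]_x (Num.max (- g (vtx x k)) 0)%:E = \int[mu]_x G^\-%E x)%E.
    by apply: eq_integral => x _; rewrite funenegE /G -EFinN EFin_max.
  have fp := integrable_pos_fin_num measurableT ig.
  have fn := integrable_neg_fin_num measurableT ig.
  rewrite !fineM// -mulrBr /Rintegral integralE; congr (_ * _); exact/esym/(fineB fp fn).
move=> [ir ii]; apply: complex_ext; rewrite ?ReM ?ImM /= ?mul0r ?subr0 ?addr0.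
  exact: H ir.
exact: H ii.
Qed.

End vertex_sums.

(** * Limits for the explicit solution *)

Section main.
Variables (R : realType) (p : nat) (p_prime : prime p) (n : nat).
Local Notation Qp := (Qp p_prime).
Local Notation Qpn := ('rV[Qp]_n).
Local Notation vertex := (vertex p_prime n).
Local Notation q := ((p ^ n)%:R : R).
Local Notation normc := Normc.normc.
Local Notation e := (rpow p).
Variables (mu : {measure set Qpn -> \bar R}) (mu_haar : haar mu).
Variables (f : Qpn -> R[i]) (K : nat) (C s alpha : R) (F : vertex -> R[i]).
Hypotheses (f_int : cintegrable mu f) (fC : forall x, normc (f x) <= C).
Hypotheses (s_gt0 : 0 < s) (sE : s = 2 * alpha - n%:R).
Hypotheses (F_mean : forall v, child_avg F v = F v) (FC : forall v, normc (F v) <= C).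
Hypothesis FK : forall k, K%:Z <= k -> layer F k = f.

Local Notation G := (fractional s F).
Local Notation phi := (poisson s F alpha).
Local Notation g0 := (layer G K%:Z).

(** At heights greater than [K] two consecutive layers of F both equal [f], so all further jumps
    vanish and the potential is stationary. *)
Let layer_fractional k : K%:Z <= k -> layer G k = g0.
Proof.
move=> Kk; have [j ->] : exists j : nat, k = K%:Z + j%:Z by exists (absz (k - K%:Z)); lia.
elim: j => [|j IH]; first by rewrite addr0.
rewrite -IH; apply/funext => x; rewrite /layer (fractional_upper s_gt0 FC).
rewrite /jump upper_vtx; have -> : K%:Z + j.+1%:Z - 1 = K%:Z + j%:Z by lia.
have Fx l : K%:Z <= l -> F (vtx x l) = f x by move=> /FK/(congr1 (@^~ x)).
have E1 : F (vtx x (K%:Z + j.+1%:Z)) = f x by apply: Fx; rewrite lerDl.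
have E2 : F (vtx x (K%:Z + j%:Z)) = f x by apply: Fx; rewrite lerDl.
by rewrite E1 E2 subrr mulr0 add0r.
Qed.

Let w (k : nat) : R := e (- s * (k%:R + 1)).

Let renormalized_phi (k : nat) x : (K <= k)%N ->
  renormalized alpha phi k x = f x - (w k)%:C * g0 x.
Proof.
move=> Kk; rewrite (renormalized_poisson F sE).
by rewrite FK ?layer_fractional ?lez_nat.
Qed.

Let w_cvg0 : w k @[k --> \oo] --> 0.
Proof.
have -> : w = (fun k => e (- s) ^+ k.+1).
  apply/funext => k; rewrite /w natr1 /rpow powRrM powR_mulrn ?powR_ge0//.
have /andP[r0 r1] := rpowN_lt1 p_prime s_gt0.
rewrite (cvg_shiftS (fun k => e (- s) ^+ k)); apply: cvg_expr.
by rewrite ger0_norm.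
Qed.

Let w_gt0 k : 0 < w k. Proof. exact: rpow_gt0. Qed.

Let G_int k : cintegrable mu (layer G k).
Proof. exact: (cintegrable_fractional mu_haar F_mean f_int FK s_gt0 FC). Qed.

Let F_int k : cintegrable mu (layer F k).
Proof. exact: (cintegrable_layer mu_haar F_mean f_int FK). Qed.

Let phi_int k : cintegrable mu (layer phi k).
Proof.
have -> : layer phi k = fun x => (e ((alpha - n%:R) * k%:~R))%:C * layer F k x +
    - (e (- alpha * k%:~R - s))%:C * layer G k x.
  by apply/funext => x; rewrite mulNr.
by apply: cintegrableD; exact: cintegrableZ.
Qed.

Let phi_bounded k : exists B, forall x, normc (layer phi k x) <= B.
Proof.
pose B1 := normc (e ((alpha - n%:R) * k%:~R))%:C * C.
pose B2 := normc (e (- alpha * k%:~R - s))%:C * (2 * C * e (s * k%:~R) / (1 - e (- s))).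
exists (B1 + B2) => x; rewrite /layer /poisson /=.
rewrite (le_trans (le_normcD _ _))// normcN !Normc.normcM lerD// ler_wpM2l ?normc_ge0//.
exact: (normc_fractional s_gt0 FC).
Qed.

Let phi_L2 k : L2 mu (layer phi k).
Proof. by have [B HB] := phi_bounded k; exact: L2_bounded HB. Qed.

Let f_L2 : L2 mu f. Proof. exact: L2_bounded fC. Qed.

Let g0_bounded x : normc (g0 x) <= 2 * C * e (s * (K%:Z)%:~R) / (1 - e (- s)).
Proof. exact: (normc_fractional s_gt0 FC (vtx x K%:Z)). Qed.

Let g0_L2 : L2 mu g0. Proof. by apply: L2_bounded g0_bounded; exact: G_int. Qed.

Lemma poisson_solution : solution mu alpha f phi.
Proof.
split=> //; first exact: (poisson_laplacian s_gt0 FC F_mean sE).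
split=> //; first by move=> k; exact: L2Z.
have g0oo : cL2norm mu g0 \is a fin_num.
  have /L2P[_ h] := g0_L2; rewrite cL2normE sqrte_fin_num ?sqr_L2norm_ge0//.
  by rewrite ge0_fin_numE ?sqr_L2norm_ge0.
have near : \forall k \near \oo, (w k * fine (cL2norm mu g0))%:E =
    cL2norm mu (fun x => renormalized alpha phi k x - f x).
  exists K => // k /= Kk.
  have -> : (fun x => renormalized alpha phi k x - f x) = (fun x => (- w k)%:C * g0 x).
    by apply/funext => x; rewrite renormalized_phi// addrC addKr rmorphN mulNr.
  rewrite cL2normZ; last exact: cmeasurable_layer.
  by rewrite normc_real normrN ger0_norm ?(ltW (w_gt0 k))// EFinM fineK.
apply: cvg_trans (near_eq_cvg near) _.
apply: cvg_EFin; first exact: nearW.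
by rewrite -(mul0r (fine (cL2norm mu g0))); apply: cvgMl.
Qed.

Lemma vladimirov_fractional : vladimirov mu s f g0.
Proof.
split=> [|xi]; first exact: G_int.
exact: (fourier_fractional mu_haar F_mean f_int FK s_gt0 FC).
Qed.

(** The difference of two representatives is integrable with zero transform, so injectivity
    applies. *)
Lemma vladimirov_ae g : vladimirov mu s f g -> {ae mu, forall x, g x = g0 x}.
Proof.
move=> [g_int ghat]; have [_ g0hat] := vladimirov_fractional.
have ig0 : cintegrable mu g0 by exact: G_int.
have d_int : cintegrable mu (fun x => g x + - 1 * g0 x).
  by apply: cintegrableD => //; exact: cintegrableZ.
have : {ae mu, forall x, g x + - 1 * g0 x = 0}.
  apply: fourier_injective => // xi; rewrite /fourier.
  transitivity (cintegral mu (fun x => g x * chi R (dot x xi) +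
      - 1 * (g0 x * chi R (dot x xi)))).
    by congr cintegral; apply/funext => x; rewrite mulrDl mulrA.
  rewrite cintegralD ?cintegralZ; last 3 first.
  - exact: cintegrable_chi.
  - exact: cintegrable_chi.
  - by apply: cintegrableZ; exact: cintegrable_chi.
  by rewrite -!/(fourier _ _ _) ghat g0hat mulN1r subrr.
by apply: filterS => x; rewrite mulN1r => /eqP; rewrite subr_eq0 => /eqP.
Qed.

Lemma ucvg_renormalized : ucvg (renormalized alpha phi) f.
Proof.
move=> r r0; pose B := 2 * C * e (s * (K%:Z)%:~R) / (1 - e (- s)).
have wB : w k * B @[k --> \oo] --> (0 : R) by rewrite -(mul0r B); apply: cvgMl.
have near1 : \forall k \near \oo, w k * B < r by apply: (cvgr_lt 0).
have near2 : \forall k \near \oo, (K <= k)%N by exists K.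
apply: filterS2 near1 near2 => k wr Kk x.
rewrite renormalized_phi// addrC addKr normcN Normc.normcM normc_real.
rewrite ger0_norm ?(ltW (w_gt0 k))//; apply: le_lt_trans wr.
by rewrite ler_wpM2l ?(ltW (w_gt0 k))// g0_bounded.
Qed.

Lemma ccvg_renormalized x : ccvg (fun k : nat =>
  (p%:R `^ (k%:R * (n%:R - alpha)))%:C * phi (vtx x k%:Z)) (f x).
Proof.
apply/cvgrPdist_lt => r r0; apply: filterS (ucvg_renormalized r0) => k /(_ x).
by rewrite sub0r normrN ger0_norm ?normc_ge0// mulrC mulrC /renormalized [_ * k%:R]mulrC.
Qed.

Lemma normal_derivative_poisson g : vladimirov mu s f g -> normal_derivative mu alpha f phi g.
Proof.
move=> gP; have g_ae := vladimirov_ae gP; have [g_int _] := gP.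
have mg := cintegrable_measurable g_int.
have mg0 : cmeasurable g0 by exact: cmeasurable_layer.
pose c (k : nat) : R[i] := (p%:R `^ ((k%:R + 1) * (2 * alpha - n%:R)))%:C.
have mN h : cmeasurable h -> cmeasurable (fun x => - h x).
  move=> mh; have := cmeasurableM (cmeasurable_cst _ (-1)) mh.
  by under eq_fun do rewrite mulN1r.
have ren_int k : cintegrable mu (renormalized alpha phi k) by exact: cintegrableZ.
split.
(* Membership in L^2 is required for [k < K] too, before the exact formula is available; boundedness
   and integrability of each layer provide it. *)
- move=> k.
  have -> : (fun x => (f x - renormalized alpha phi k x) * c k) =
      (fun x => c k * (f x + - 1 * renormalized alpha phi k x)).
    by apply/funext => x; rewrite mulN1r mulrC.
  apply: L2Z; have [B HB] := phi_bounded k%:Z.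
  apply: (@L2_bounded _ _ _ _ _ (C + normc (p%:R `^ ((n%:R - alpha) * k%:R))%:C * B)).
    by apply: cintegrableD => //; exact: cintegrableZ.
  move=> x; rewrite mulN1r (le_trans (le_normcD _ _))// normcN lerD//.
  by rewrite /renormalized Normc.normcM ler_wpM2l ?normc_ge0.
- apply/L2P; split=> //; rewrite (ae_sqr_L2norm mg mg0)//.
  by have /L2P[] := g0_L2.
have near : \forall k \near \oo, cL2norm mu (fun=> 0 : R[i]) =
    cL2norm mu (fun x => (f x - renormalized alpha phi k x) * c k - g x).
  exists K => // k /= Kk.
  (* [c k] is the inverse of [w k], so the rescaled difference is exactly [g0], which equals [g]
     almost everywhere: the norms are eventually 0. *)
  have -> : (fun x => (f x - renormalized alpha phi k x) * c k - g x) =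
      (fun x => g0 x + - g x).
    apply/funext => x; rewrite renormalized_phi// subKr mulrAC -rmorphM.
    rewrite -/(e _) /w -(rpowD p_prime) -sE.
    have -> : - s * (k%:R + 1) + (k%:R + 1) * s = 0 by ring.
    by rewrite rpow0 mul1r.
  rewrite !cL2normE; congr sqrte; apply: ae_sqr_L2norm.
  - exact: cmeasurable_cst.
  - by apply: cmeasurableD => //; exact: mN.
  - by apply: filterS g_ae => x ->; rewrite subrr.
apply: cvg_trans (near_eq_cvg near) _; rewrite cL2norm0; exact: cvg_cst.
Qed.

Let energy v := phi v * cutoff_residual alpha phi v.

Let layer_energy k x : layer energy k x = layer phi k x *
  (layer phi (k - 1) x - (e (n%:R - alpha))%:C * layer phi k x).
Proof. by rewrite /layer /energy /cutoff_residual upper_vtx. Qed.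

Let energy_int k : cintegrable mu (layer energy k).
Proof.
rewrite (funext (layer_energy k)).
have [B HB] := phi_bounded k; have [B' HB'] := phi_bounded (k - 1).
pose c := (e (n%:R - alpha))%:C : R[i].
apply: (@cintegrable_bounded _ _ _ _ _ _ (B' + normc c * B)) => //.
  apply: cintegrable_measurable; have := cintegrableD (phi_int (k - 1))
    (cintegrableZ (- c) (phi_int k)).
  by congr cintegrable; apply/funext => x; rewrite mulNr.
move=> x; rewrite (le_trans (le_normcD _ _))// normcN lerD//.
by rewrite Normc.normcM ler_wpM2l ?normc_ge0.
Qed.

Lemma summable_energy (k : nat) : summable (boundary p_prime n k%:Z)
  (fun v => (normc (phi v * cutoff_residual alpha phi v))%:E).
Proof. exact: (summable_layer mu_haar (energy_int k%:Z)). Qed.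

(** In the residual the contributions of [y] (the value of f) cancel, leaving
    [X * c * W * (1 - S) * z]. The powers of p then collapse to [rho * (c - a)], which is the
    constant of the limit. *)
Let energy_ring_identity (A : comNzRingType) (Q X W S a c rho y z : A) :
  Q * X * X * c * W = rho * c -> rho * c * S = rho * a ->
  Q * (X * (y - W * z) * (X * c * (y - W * S * z) - c * (X * (y - W * z)))) =
  rho * (c - a) * (y * z + - W * (z * z)).
Proof.
move=> E1 E2; transitivity (Q * X * X * c * W * (1 - S) * (z * (y - W * z))); first by ring.
rewrite E1; transitivity ((rho * c - rho * c * S) * (z * (y - W * z))); first by ring.
by rewrite E2; ring.
Qed.

(** The factor [q ^ k] is the number of vertices of height [k] per unit volume. The inequality
    [K < k] is strict because the residual also involves the layer [k - 1], to which the exact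
    formula must apply. *)
Lemma energy_identity (k : nat) x : (K < k)%N ->
  (q ^ k%:Z)%:C * layer energy k%:Z x =
  (e (n%:R - 2 * alpha) * (e (n%:R - alpha) - e alpha))%:C *
    (f x * g0 x + - (w k)%:C * (g0 x * g0 x)).
Proof.
move=> Kk; have ren (j : nat) : (K <= j)%N -> layer phi j%:Z x =
    (e ((alpha - n%:R) * j%:R))%:C * (f x - (w j)%:C * g0 x).
  move=> Kj; rewrite -renormalized_phi// /renormalized mulrA -rmorphM -/(e _) -(rpowD p_prime).
  have -> : (alpha - n%:R) * j%:R + (n%:R - alpha) * j%:R = 0 by ring.
  by rewrite rpow0 mul1r.
case: k Kk => // k Kk; rewrite layer_energy.
have -> : k.+1%:Z - 1 = k%:Z by lia.
rewrite !ren//; last exact: ltnW.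
have qk : q ^ k.+1%:Z = e (n%:R * k.+1%:R).
  by rewrite /rpow powRrM powR_mulrn ?powR_ge0// -/(e _) rpow_nat.
rewrite qk; move: (f x) (g0 x) => y z.
pose X := e ((alpha - n%:R) * k.+1%:R); pose c := e (n%:R - alpha).
have Xk : e ((alpha - n%:R) * k%:R) = X * c.
  by rewrite -(rpowD p_prime); congr e; rewrite -natr1; ring.
have wk : w k = w k.+1 * e s.
  by rewrite /w -(rpowD p_prime); congr e; rewrite -natr1; ring.
rewrite -/X -/c Xk wk.
have E1 : e (n%:R * k.+1%:R) * X * X * c * w k.+1 = e (n%:R - 2 * alpha) * c.
  by rewrite -!(rpowD p_prime); congr e; rewrite sE; ring.
have E2 : e (n%:R - 2 * alpha) * c * e s = e (n%:R - 2 * alpha) * e alpha.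
  by rewrite -!(rpowD p_prime); congr e; rewrite sE; ring.
rewrite !rmorphM rmorphB /=; apply: energy_ring_identity.
  by have := congr1 (real_complex R) E1; rewrite !rmorphM.
by have := congr1 (real_complex R) E2; rewrite !rmorphM.
Qed.

Lemma csum_energy_cvg g : vladimirov mu s f g ->
  ccvg (fun k : nat => csum (boundary p_prime n k%:Z)
      (fun v => phi v * cutoff_residual alpha phi v))
    ((p%:R `^ (n%:R - 2 * alpha) * (p%:R `^ (n%:R - alpha) - p%:R `^ alpha))%:C *
      cintegral mu (fun x => f x * g x)).
Proof.
move=> gP; have g_ae := vladimirov_ae gP; have [g_int _] := gP.
have mg0 : cmeasurable g0 by exact: cmeasurable_layer.
have mf := cintegrable_measurable f_int; have mg := cintegrable_measurable g_int.
rewrite -!/(e _); set c0 := (_)%:C.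
have -> : cintegral mu (fun x => f x * g x) = cintegral mu (fun x => f x * g0 x).
  apply: ae_cintegral; [exact: cmeasurableM|exact: cmeasurableM|].
  by apply: filterS g_ae => x ->.
have i1 : cintegrable mu (fun x => f x * g0 x) by exact: cintegrable_bounded g0_bounded.
have i2 : cintegrable mu (fun x => g0 x * g0 x).
  by apply: (cintegrable_bounded _ mg0 g0_bounded); exact: G_int.
set I1 := cintegral mu (fun x => f x * g0 x); pose I2 := cintegral mu (fun x => g0 x * g0 x).
(* By the exact identity the sum over the layer is eventually an affine function of [w k], which
   tends to 0. *)
have lim : ccvg (fun k => c0 * (I1 + I2 * (- w k)%:C)) (c0 * (I1 + I2 * 0)).
  apply: ccvgMl; apply: ccvgD; first exact: ccvg_cst.
  apply: ccvgMl; apply/ccvgP; split=> /=; last exact: cvg_cst.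
  by rewrite -[0](@oppr0 R); exact: cvgN.
rewrite mulr0 addr0 in lim; apply: ccvg_near lim; exists K.+1 => // k /= Kk.
rewrite (csum_layer mu_haar (energy_int k%:Z)) -cintegralZ//.
transitivity (cintegral mu (fun x => c0 * (f x * g0 x + - (w k)%:C * (g0 x * g0 x)))).
  rewrite cintegralZ; last by apply: cintegrableD => //; exact: cintegrableZ.
  rewrite cintegralD// ?cintegralZ//; last exact: cintegrableZ.
  by rewrite rmorphN mulrC [_ * I2]mulrC [X in _ = X]mulrC.
by congr cintegral; apply/funext => x; rewrite energy_identity.
Qed.

End main.

Theorem theorem1p3 (R : realType) (p : nat) (p_prime : prime p)
    (n : nat) (n_ge1 : (1 <= n)%N)
    (mu : {measure set 'rV[Qp p_prime]_n -> \bar R}) (mu_haar : haar mu)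
    (f : 'rV[Qp p_prime]_n -> R[i]) (f_schwartz : schwartz f)
    (alpha : R) (alpha_gt : n%:R / 2 < alpha) :
  (exists! phi : vertex p_prime n -> R[i], solution mu alpha f phi) /\
  (exists g, vladimirov mu (2 * alpha - n%:R) f g) /\
  forall phi : vertex p_prime n -> R[i], solution mu alpha f phi ->
    [/\ ucvg (renormalized alpha phi) f,
        forall x, ccvg (fun k : nat =>
          (p%:R `^ (k%:R * (n%:R - alpha)))%:C * phi (vtx x k%:Z)) (f x) &
        forall g, vladimirov mu (2 * alpha - n%:R) f g ->
          [/\ normal_derivative mu alpha f phi g,
              forall k : nat, summable (boundary p_prime n k%:Z)
                (fun v => (Normc.normc (phi v * cutoff_residual alpha phi v))%:E) &
              ccvg (fun k : nat => csum (boundary p_prime n k%:Z)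
                     (fun v => phi v * cutoff_residual alpha phi v))
                   ((p%:R `^ (n%:R - 2 * alpha)
                       * (p%:R `^ (n%:R - alpha) - p%:R `^ alpha))%:C
                    * cintegral mu (fun x => f x * g x))]].
Proof.
have [K [M [C [fK fC f0]]]] := schwartz_periodic f_schwartz.
have f_int := cintegrable_compact_support mu_haar fK fC f0.
have s_gt0 : 0 < 2 * alpha - n%:R.
  by move: alpha_gt; rewrite ltr_pdivrMr// mulrC subr_gt0.
pose F := level_avg f K%:Z.
have F_mean v : child_avg F v = F v by exact: level_avg_mean.
have FC v : Normc.normc (F v) <= C by exact: normc_level_avg.
have FK k : K%:Z <= k -> layer F k = f by exact: layer_level_avg.
have sol := poisson_solution mu_haar f_int fC s_gt0 erefl F_mean FC FK.
split; first by exists (poisson (2 * alpha - n%:R) F alpha); split=> // psi;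
  exact: (solution_unique mu_haar n_ge1 sol).
split.
  exists (layer (fractional (2 * alpha - n%:R) F) K%:Z).
  exact: (vladimirov_fractional mu_haar f_int s_gt0 F_mean FC FK).
(* By uniqueness an arbitrary solution is the explicit one, for which all the limits are known. *)
move=> phi phi_sol; rewrite -(solution_unique mu_haar n_ge1 sol phi_sol); split.
- exact: (ucvg_renormalized s_gt0 erefl FC FK).
- exact: (ccvg_renormalized s_gt0 erefl FC FK).
move=> g gP; split.
- exact: (normal_derivative_poisson mu_haar f_int fC s_gt0 erefl F_mean FC FK gP).
- exact: (summable_energy mu_haar alpha f_int s_gt0 F_mean FC FK).
- exact: (csum_energy_cvg mu_haar f_int s_gt0 erefl F_mean FC FK gP).
Qed.
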